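(* Let $1<p<\infty$, let $\gamma>0$ if $1<p\le3$ and $2\gamma\ge p-3$ if $p>3$ (with $\gamma>0$), and suppose that $q\in L_{\gamma+3/2}(\mathbb{R}^3)$. Let $H$ be the Schrödinger operator in $L_p(\mathbb{R}^3)$ associated with $-\Delta+q$. Then every eigenvalue $\lambda\in\mathbb{C}\setminus[0,\infty)$ of $H$ satisfies $$|\lambda|^{\gamma}\le C(\gamma,\theta)\int_{\mathbb{R}^3}|q(x)|^{\gamma+3/2}\,dx,$$ where $\theta=\arg\lambda\in(0,2\pi)$ and $$C(\gamma,\theta)=\frac{1}{4\pi\,\sin^{2\gamma}(\theta/2)}\left(\frac{2\gamma+1}{2\gamma+3}\right)^{2\gamma}\Gamma\!\left(\frac{4\gamma}{2\gamma+1}\right)^{(2\gamma+1)/2}.$$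
   Context: Here $n=3$. $\Gamma$ is the gamma function. For $1<p<\infty$, $p'$ is defined by $1/p+1/p'=1$. The complex-valued measurable potential $q$ is factorized as $q=ab$ with $a=|q|^{1/2}$, $b=(\operatorname{sgn}q)|q|^{1/2}$, where $\operatorname{sgn}q(x)=q(x)/|q(x)|$ if $q(x)\ne0$ and $\operatorname{sgn}q(x)=0$ otherwise. $H_0$ is the operator $-\Delta$ in $L_p(\mathbb{R}^n)$ with domain the Sobolev space $W_p^2(\mathbb{R}^n)$, and $A,B$ are the operators of multiplication by $a,b$ in $L_p(\mathbb{R}^n)$ with maximal domains. For $u\in L_{p,\mathrm{loc}}(\mathbb{R}^n)$ put $M_{\nu,p}(u)=\sup_{x}\int_{|x-y|<1}|u(y)|^p|x-y|^{\nu-n}\,dy$. Standing assumptions: $M_{\nu,p'}(a)<\infty$ for some $0<\nu<p'$; $M_{\mu,p}(b)<\infty$ for some $0<\mu<p$; and $\int_{|x-y|<1}|q(y)|\,dy\to0$ as $|x|\to\infty$. Under these assumptions, for $z\in\mathbb{C}\setminus[0,\infty)$ the operator $B(H_0-z)^{-1}A$ is densely defined and has a unique bounded extension $Q(z)$ to $L_p(\mathbb{R}^n)$, which is compact, and $H_0+AB$ admits a closed extension $H$ with $\sigma_{ess}(H)=\sigma_{ess}(H_0)=[0,\infty)$ such that $\lambda\in\mathbb{C}\setminus[0,\infty)$ is an eigenvalue of $H$ if and only if $-1$ is an eigenvalue of $Q(\lambda)$. This $H$ is the Schrödinger operator associated with $-\Delta+q$. *)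

(* Defs.v *)
From HB Require Import structures.
From mathcomp Require Import all_boot all_order all_algebra.
From mathcomp Require Import complex.
From mathcomp Require Import all_classical all_reals all_analysis.

Set Implicit Arguments.
Unset Strict Implicit.
Unset Printing Implicit Defensive.

Import Order.TTheory GRing.Theory Num.Theory.
Import numFieldNormedType.Exports.

Local Open Scope classical_set_scope.
Local Open Scope ring_scope.

(* R^3, with the Borel sigma-algebra used by lebesgue_measure on each factor.
   It is convertible to R * R * R, where the normed space structure lives. *)
Notation space3 R :=
  (measurableTypeR R * measurableTypeR R * measurableTypeR R)%type.

(* Complex-valued functions on R^3. Elements of L_p are represented by such
   functions; equality in L_p is equality almost everywhere. *)
Notation field3 R := (space3 R -> R[i]).

Section Volume.
Context {R : realType}.

Definition vol2 :
    set (measurableTypeR R * measurableTypeR R) -> \bar R :=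
  (lebesgue_measure \x lebesgue_measure)%E.

HB.instance Definition _ := Measure.on vol2.

(* The library's sigma-finite instance of a product measure is shadowed by the
   instance for products of subprobabilities, so it is rebuilt here. *)
Lemma sigma_finite_vol2 : sigma_finite setT vol2.
Proof.
have /sigma_finiteP[F [TF ndF Foo]] := sigma_finiteT (@lebesgue_measure R).
exists (fun n => F n `*` F n).
  rewrite -setXTT TF predeqE => -[x y]; split.
    move=> [/= [n _ Fnx] [k _ Fky]]; exists (maxn n k) => //; split.
    - by move: x Fnx; exact/subsetPset/ndF/leq_maxl.
    - by move: y Fky; exact/subsetPset/ndF/leq_maxr.
  by move=> [n _ []/= ? ?]; split; exists n.
move=> k; have [mF Fk] := Foo k; split; first exact: measurableX.
by rewrite [vol2 _]product_measure1E// lte_mul_pinfty// ge0_fin_numE.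
Qed.

HB.instance Definition _ :=
  @Measure_isSigmaFinite.Build _ _ _ vol2 sigma_finite_vol2.

Definition vol : set (space3 R) -> \bar R := (vol2 \x lebesgue_measure)%E.

HB.instance Definition _ := Measure.on vol.

Lemma sigma_finite_vol : sigma_finite setT vol.
Proof.
have /sigma_finiteP[F [TF ndF Foo]] := sigma_finiteT vol2.
have /sigma_finiteP[G [TG ndG Goo]] := sigma_finiteT (@lebesgue_measure R).
exists (fun n => F n `*` G n).
  rewrite -setXTT TF TG predeqE => -[x y]; split.
    move=> [/= [n _ Fnx] [k _ Gky]]; exists (maxn n k) => //; split.
    - by move: x Fnx; exact/subsetPset/ndF/leq_maxl.
    - by move: y Gky; exact/subsetPset/ndG/leq_maxr.
  by move=> [n _ []/= ? ?]; split; exists n.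
move=> k; have [mF Fk] := Foo k; have [mG Gk] := Goo k.
split; first exact: measurableX.
by rewrite [vol _]product_measure1E// lte_mul_pinfty// ge0_fin_numE.
Qed.

HB.instance Definition _ :=
  @Measure_isSigmaFinite.Build _ _ _ vol sigma_finite_vol.

End Volume.

Section LpSpaces.
Context {R : realType}.
Implicit Types (p : R) (u v : field3 R).

Definition cabs (z : R[i]) : R := ComplexField.Normc.normc z.

Definition enorm (x : space3 R) : R :=
  Num.sqrt (x.1.1 ^+ 2 + x.1.2 ^+ 2 + x.2 ^+ 2).

Definition dist3 (x y : space3 R) : R :=
  enorm ((x.1.1 - y.1.1, x.1.2 - y.1.2), x.2 - y.2).

Definition cmeasurable u : Prop :=
  measurable_fun setT (fun x => complex.Re (u x)) /\
  measurable_fun setT (fun x => complex.Im (u x)).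

Definition cintegral u : R[i] :=
  Complex (\int[vol]_x complex.Re (u x))%R (\int[vol]_x complex.Im (u x))%R.

Definition cLnorm p u : \bar R := 'N[vol]_p%:E[EFin \o (cabs \o u)]%E.

Definition inLp p u : Prop := cmeasurable u /\ (cLnorm p u < +oo)%E.

Definition Lp_dist p u v : \bar R := cLnorm p (fun x => u x - v x).

End LpSpaces.

Section Sobolev.
Context {R : realType}.
Implicit Types (p : R) (u v f : field3 R) (phi : R * R * R -> R).

Definition basis3 (i : 'I_3) : R * R * R :=
  (((i == 0)%:R, (i == 1)%:R), (i == 2)%:R).

Definition partial (i : 'I_3) phi : R * R * R -> R :=
  fun x => 'D_(basis3 i) phi x.

Definition iter_partial (s : seq 'I_3) phi : R * R * R -> R :=
  foldr partial phi s.

Definition smooth phi : Prop :=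
  forall s : seq 'I_3, continuous (iter_partial s phi) /\
    forall (i : 'I_3) x, derivable (iter_partial s phi) x (basis3 i).

Definition test_function phi : Prop :=
  smooth phi /\
  exists2 K : set (R * R * R), compact K & forall x, ~ K x -> phi x = 0.

Definition weak_partial (i : 'I_3) u v : Prop :=
  forall phi, test_function phi ->
    cintegral (fun x => u x * (partial i phi x)%:C%C) =
    - cintegral (fun x => v x * (phi x)%:C%C).

(* u lies in the Sobolev space W_p^2 iff such d1 and d2 exist; they are then
   its weak derivatives of order one and two. *)
Definition W2_with_derivatives p u (d1 : 'I_3 -> field3 R)
    (d2 : 'I_3 -> 'I_3 -> field3 R) : Prop :=
  [/\ inLp p u,
      forall i, inLp p (d1 i) /\ weak_partial i u (d1 i) &
      forall i j, inLp p (d2 i j) /\ weak_partial j (d1 i) (d2 i j)].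

End Sobolev.

(* An operator in L_p is given by its graph: T u f means that u belongs to the
   domain of T and that T u = f. *)
Definition operator (R : realType) : Type := field3 R -> field3 R -> Prop.

Section Operators.
Context {R : realType}.
Implicit Types (p : R) (u v f g : field3 R) (S T : operator R) (z : R[i]).

Definition linear_operator p T : Prop :=
  [/\ (forall u f, T u f -> inLp p u /\ inLp p f),
      (forall u v f g, T u f -> inLp p v -> inLp p g ->
         u = v %[ae vol] -> f = g %[ae vol] -> T v g),
      (forall u f g, T u f -> T u g -> f = g %[ae vol]),
      T (fun=> 0) (fun=> 0) &
      (forall z u v f g, T u f -> T v g ->
         T (fun x => z * u x + v x) (fun x => z * f x + g x))].

Definition op_sub T S : Prop := forall u f, T u f -> S u f.

Definition op_add S T : operator R := fun u f =>
  exists g h, [/\ S u g, T u h & f = (fun x => g x + h x)].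

Definition op_comp S T : operator R := fun u f => exists2 g, T u g & S g f.

Definition op_inv T : operator R := fun u f => T f u.

Definition op_subC T z : operator R := fun u f =>
  exists2 g, T u g & f = (fun x => g x - z * u x).

Definition op_mul p (a : field3 R) : operator R := fun u f =>
  [/\ inLp p u, inLp p f & f = (fun x => a x * u x) %[ae vol]].

Definition free_laplacian p : operator R := fun u f =>
  inLp p f /\ exists d1 d2, W2_with_derivatives p u d1 d2 /\
    f = (fun x => - \sum_(i < 3) d2 i i x) %[ae vol].

Definition densely_defined p T : Prop :=
  forall u (e : R), inLp p u -> 0 < e ->
    exists v f, T v f /\ (Lp_dist p u v < e%:E)%E.

Definition bounded_operator p T : Prop :=
  [/\ linear_operator p T, (forall u, inLp p u -> exists f, T u f) &
      exists K : R, forall u f, T u f -> (cLnorm p f <= K%:E * cLnorm p u)%E].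

(* T is densely defined and Q is its (necessarily unique) bounded extension to
   the whole of L_p. *)
Definition is_bounded_extension p T Q : Prop :=
  [/\ densely_defined p T, bounded_operator p Q & op_sub T Q].

Definition Lp_cvg p (u_ : nat -> field3 R) u : Prop :=
  Lp_dist p (u_ n) u @[n --> \oo] --> 0%E.

Definition closed_operator p T : Prop :=
  linear_operator p T /\
  forall (u_ f_ : nat -> field3 R) u f,
    (forall n, T (u_ n) (f_ n)) -> inLp p u -> inLp p f ->
    Lp_cvg p u_ u -> Lp_cvg p f_ f -> T u f.

Definition op_eigenvalue T z : Prop :=
  exists2 u, ~ (u = (fun=> 0) %[ae vol]) & T u (fun x => z * u x).

Definition lin_comb n (c : 'I_n -> R[i]) (e : 'I_n -> field3 R) : field3 R :=
  fun x => \sum_(k < n) c k * e k x.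

Definition finite_kernel T : Prop :=
  exists (n : nat) (e : 'I_n -> field3 R), forall u, T u (fun=> 0) ->
    exists c : 'I_n -> R[i], u = lin_comb c e %[ae vol].

Definition closed_range p T : Prop :=
  forall (u_ f_ : nat -> field3 R) f,
    (forall n, T (u_ n) (f_ n)) -> inLp p f -> Lp_cvg p f_ f ->
    exists u, T u f.

Definition finite_corange p T : Prop :=
  exists (n : nat) (e : 'I_n -> field3 R),
    (forall k, inLp p (e k)) /\
    forall f, inLp p f -> exists (c : 'I_n -> R[i]) u g,
      T u g /\ f = (fun x => g x + lin_comb c e x) %[ae vol].

Definition fredholm p T : Prop :=
  [/\ finite_kernel T, closed_range p T & finite_corange p T].

Definition ess_spectrum p T : set R[i] :=
  [set z | ~ fredholm p (op_subC T z)].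

(* In the order of R[i], 0 <= z means that z is real and nonnegative. *)
Definition nonneg_halfline : set R[i] := [set z | 0 <= z].

End Operators.

Section Schroedinger.
Context {R : realType}.
Implicit Types (p : R) (q u : field3 R) (z : R[i]).

Definition csgn z : R[i] := if z == 0 then 0 else z / (cabs z)%:C%C.

Definition factor_a q : field3 R := fun x => (cabs (q x) `^ 2^-1)%:C%C.

Definition factor_b q : field3 R :=
  fun x => csgn (q x) * (cabs (q x) `^ 2^-1)%:C%C.

Definition Mnorm (nu p : R) u : \bar R :=
  ereal_sup [set (\int[vol]_(y in [set y | (dist3 x y < 1)%R])
                    (cabs (u y) `^ p * dist3 x y `^ (nu - 3))%:E)%E
            | x in [set: space3 R]].

(* B (H_0 - z)^-1 A *)
Definition birman_schwinger p q z : operator R :=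
  op_comp (op_mul p (factor_b q))
    (op_comp (op_inv (op_subC (free_laplacian p) z))
             (op_mul p (factor_a q))).

(* The first clause determines each Q z outside [0, oo), so quantifying over Q
   existentially amounts to using the bounded extension of B (H_0 - z)^-1 A. *)
Definition schrodinger_operator p q (H : operator R) : Prop :=
  exists Q : R[i] -> operator R,
    [/\ forall z, ~ nonneg_halfline z ->
          is_bounded_extension p (birman_schwinger p q z) (Q z),
        closed_operator p H,
        op_sub (op_add (free_laplacian p)
                  (op_comp (op_mul p (factor_a q)) (op_mul p (factor_b q)))) H,
        ess_spectrum p H = ess_spectrum p (free_laplacian p) /\
          ess_spectrum p (free_laplacian p) = nonneg_halfline &
        forall z, ~ nonneg_halfline z ->
          (op_eigenvalue H z <-> op_eigenvalue (Q z) (-1))].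

Definition Gamma (s : R) : R :=
  (\int[lebesgue_measure]_(t in `]0, +oo[) (t `^ (s - 1) * expR (- t)))%R.

Definition Cconst (gamma theta : R) : R :=
  (4 * pi * sin (theta / 2) `^ (2 * gamma))^-1 *
  ((2 * gamma + 1) / (2 * gamma + 3)) `^ (2 * gamma) *
  Gamma (4 * gamma / (2 * gamma + 1)) `^ ((2 * gamma + 1) / 2).

End Schroedinger.

(* Main.v *)
Require Import Defs.
From HB Require Import structures.
From mathcomp Require Import all_boot all_order all_algebra.
From mathcomp Require Import complex ring lra.
From mathcomp Require Import all_classical all_reals all_analysis.
From mathcomp Require Import measurable_realfun.

Set Implicit Arguments.
Unset Strict Implicit.
Unset Printing Implicit Defensive.

Import Order.TTheory GRing.Theory Num.Theory.
Import numFieldNormedType.Exports.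

Local Open Scope classical_set_scope.
Local Open Scope ring_scope.

(* Let [A = |q|^(1/2)], [r = gamma + 3/2], and let [alpha] be the imaginary part
   of the square root of [lambda], i.e. [|lambda|^(1/2) sin (theta/2)]. The
   resolvent of the free Laplacian at [lambda] is dominated pointwise by
   convolution with the Yukawa kernel [G(t) = exp (- alpha t) / (4 pi t)]. An
   eigenfunction [f] of [Q lambda] for [-1] is approximated by elements of the
   domain of [B (H_0 - lambda)^-1 A], and in the limit [F = |f|] satisfies
   [F <= A (G * (A F))] almost everywhere. Multiplying by [F^(P-1)],
   integrating and applying Young's inequality with four factors gives
   [1 <= ||A||_(2r)^2 ||G||_(r/(r-1))], where the norm of [G] is an explicit
   Gamma integral. This needs [F] in [L_P] with [(2r)' <= P <= 2r]; if
   [p < (2r)'], a preliminary use of Young's inequality, which exploits that [A]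
   is uniformly locally in [L_p'], shows that [F] is in [L_(2r)'].

   The pointwise domination of the resolvent is obtained by testing the weak
   form of [(- Delta - lambda) w = m] against smooth compactly supported
   regularisations of the fundamental solution [G_lambda], in which [|x - y|^2] is replaced
   by [|x - y|^2 + e^2]; as [e] tends to [0] their residues form an approximate
   identity, and [w] is identified with [G_lambda * m] through its integrals
   over boxes. *)

(** * Integration in polar coordinates *)

(** The exponents are dictated by the constant. Raised to the power [r], the norm inequality reads
    [1 <= N * M^(r - 1)], with [N] the integral of [|q|^r] and [M] that of [G^(r/(r-1))]. The kernel
    behaves like [1/t] at the origin, so [M] is finite when [r/(r-1) < 3], that is when [gamma > 0];
    scaling in [alpha] yields [alpha^(- 2 gamma)], hence [|lambda|^gamma] and the sine. The
    restriction on [p] is [p <= 2 r], one end of the range of nonnegative Young weights. The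
    obstacle is that an eigenfunction is only known to lie in [L_p], while [A] is only uniformly
    locally in [L_p']: the potential of [A F] may a priori be infinite, and [Q] acts on [f] only
    through approximation. The dominating potentials are therefore extended-valued integrals of
    nonnegative functions, and limits are taken under integrals, against an exponential weight or
    over a box. The resolvent enters only through the graph of the Laplacian, defined with real test
    functions; complex identities are carried by pairs [p q], standing for the real part of
    [p - i q] times the complex kernel. *)

Section Measurability.
Context d (T : measurableType d) (R : realType).

Lemma measurable_lt_cst (f : T -> R) (s : R) :
  measurable_fun setT f -> measurable [set x | f x < s].
Proof.
move=> mf; rewrite -[X in measurable X]setTI.
rewrite (_ : [set _ | _] = f @^-1` `]-oo, s[%classic); first exact: mf.
by apply/seteqP; split => x /=; rewrite in_itv.
Qed.

End Measurability.

Section Slices.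
Context {R : realType}.
Local Notation mu := (@lebesgue_measure R).

Lemma is_derive_continuous (F f : R -> R) :
  (forall x : R, is_derive x 1 F (f x)) -> continuous F.
Proof.
by move=> dF x; apply/differentiable_continuous/derivable1_diffP; case: (dF x).
Qed.

Lemma derivableT_oo_LRcontinuous (F f : R -> R) (a b : R) :
  (forall x : R, is_derive x 1 F (f x)) -> derivable_oo_LRcontinuous F a b.
Proof.
move=> dF; have cF := is_derive_continuous dF.
split; first by move=> x _; case: (dF x).
- by apply: cvg_at_right_filter; exact: cF.
- by apply: cvg_at_left_filter; exact: cF.
Qed.

Lemma integral_itv_derive (F f : R -> R) (a b : R) : a < b -> continuous f ->
  (forall x : R, is_derive x 1 F (f x)) ->
  (\int[mu]_(x in `[a, b]) (f x)%:E = (F b - F a)%:E)%E.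
Proof.
move=> ab cf dF; rewrite EFinB; apply: (@continuous_FTC2 R f F a b) => //.
- exact: continuous_subspaceT.
- exact: derivableT_oo_LRcontinuous dF.
- by move=> x _; rewrite derive1E; case: (dF x).
Qed.

Lemma lebesgue_measure_slice (a s : R) :
  (mu [set x | ((x - a) ^+ 2 < s)%R] = (2 * Num.sqrt s)%:E)%E.
Proof.
have [s0|s0] := leP s 0.
  rewrite (_ : [set _ | _] = set0) ?measure0 ?ler0_sqrtr ?mulr0//.
  apply/seteqP; split => // x /= xs; have := sqr_ge0 (x - a).
  by rewrite leNgt => /negP; apply; exact: lt_le_trans xs s0.
rewrite (_ : [set _ | _] = `]a - Num.sqrt s, a + Num.sqrt s[%classic).
  rewrite lebesgue_measure_itv/= lte_fin ifT.
    by rewrite -EFinB; congr EFin; ring.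
  by have : 0 < Num.sqrt s by [rewrite sqrtr_gt0|]; lra.
apply/seteqP; split => x /=; rewrite in_itv/=.
  move=> xs; have : `|x - a| < Num.sqrt s.
    by rewrite -sqrtr_sqr ltr_sqrt.
  by rewrite ltr_norml => /andP[? ?]; apply/andP; split; lra.
move=> /andP[? ?]; rewrite -(sqr_sqrtr (ltW s0)) -[(x - a) ^+ 2]real_normK ?num_real//.
by rewrite ltr_pXn2r ?nnegrE ?sqrtr_ge0// ltr_norml; apply/andP; split; lra.
Qed.

Lemma lebesgue_half_disc (a s : R) : 0 < s ->
  (\int[mu]_(x in `[(a - Num.sqrt s)%R, (a + Num.sqrt s)%R])
     (2 * Num.sqrt (s - (x - a) ^+ 2))%:E = (pi * s)%:E)%E.
Proof.
move=> s0; set r := Num.sqrt s.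
have r0 : 0 < r by rewrite sqrtr_gt0.
have rs : r ^+ 2 = s by rewrite sqr_sqrtr// ltW.
(* Trigonometric substitution: the integrand becomes [2 s cos^2], with primitive
   [s (t + sin t cos t)]. *)
pose F x := a + r * sin x.
pose G x := 2 * Num.sqrt (s - (x - a) ^+ 2).
have dF (x : R) : is_derive x 1 F (r * cos x).
  by rewrite /F; apply: is_derive_eq; rewrite /GRing.scale/= ; ring.
have F'E : derive1 F = fun x => r * cos x.
  by apply/funext => x; rewrite derive1E; case: (dF x).
have cF' : continuous (derive1 F).
  by rewrite F'E; apply: is_derive_continuous.
have cG : continuous G.
  move=> x; apply: cvgM; first exact: cvg_cst.
  apply: (@continuous_comp _ _ _ (fun x => s - (x - a) ^+ 2) Num.sqrt).
    exact: is_derive_continuous.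
  exact: sqrt_continuous.
have pi2 : - (pi / 2) < pi / 2 :> R by have := pi_gt0 R; lra.
have := @integration_by_substitution_increasing R F G _ _ (ltW pi2).
rewrite /F sinN sin_pihalf mulrN mulr1 => -> //; first 1 last.
- move=> x y xI yI xy; rewrite /F ltrD2l ltr_pM2l//.
  by move: xI yI; rewrite !in_itv/= => xI yI; rewrite ltr_sin ?in_itv.
- rewrite -/F; apply/cvg_ex; exists (derive1 F (- (pi / 2))); apply: cvg_at_right_filter; exact: cF'.
- rewrite -/F; apply/cvg_ex; exists (derive1 F (pi / 2)); apply: cvg_at_left_filter; exact: cF'.
- exact: derivableT_oo_LRcontinuous dF.
- exact: continuous_subspaceT.
transitivity (\int[mu]_(x in `[(- (pi / 2))%R, (pi / 2)%R]) (2 * s * cos x ^+ 2)%:E)%E.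
  apply: eq_integral => x /[!inE]; rewrite /= in_itv/= => xI; congr EFin.
  rewrite -/F -[LHS]/(G (F x) * derive1 F x) F'E /G /F; have -> : s - (a + r * sin x - a) ^+ 2 = (r * cos x) ^+ 2.
    by rewrite exprMn cos2sin2 -rs; ring.
  rewrite sqrtr_sqr ger0_norm; first by rewrite -rs; ring.
  by rewrite mulr_ge0 ?(ltW r0)//; apply: cos_ge0_pihalf.
have dH (x : R) :
    is_derive x 1 (fun x => s * (x + sin x * cos x)) (2 * s * cos x ^+ 2).
  apply: is_derive_eq; rewrite /GRing.scale/=.
  by rewrite -[X in X + _](cos2Dsin2 x); ring.
rewrite (integral_itv_derive pi2 _ dH); last exact: is_derive_continuous.
by rewrite sinN cosN sin_pihalf cos_pihalf; congr EFin; lra.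
Qed.

(** Slicing into segments gives the half-disc integral. The maximum covers negative [s], where the
    disc is empty; slicing a ball at a height beyond its radius leads to such values. *)
Lemma vol2_disc (a b s : R) :
  vol2 [set z | (z.1 - a) ^+ 2 + (z.2 - b) ^+ 2 < s] =
  (pi * Num.max s 0)%:E.
Proof.
transitivity (\int[mu]_x (2 * Num.sqrt (s - (x - a) ^+ 2))%:E)%E.
  apply: eq_integral => x _; rewrite -(lebesgue_measure_slice b) /=.
  congr (lebesgue_measure _); apply/seteqP.
  by split=> y; rewrite /xsection /= ?inE/= ltrBrDl.
have [s0|s0] := leP s 0.
  rewrite mulr0; apply: integral0_eq => x _.
  by rewrite ler0_sqrtr ?mulr0// subr_le0 (le_trans s0)// sqr_ge0.
rewrite -(lebesgue_half_disc a s0) [RHS]integral_mkcond.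
apply: eq_integral => x _; rewrite patchE; case: ifPn => // /negP xI.
rewrite ler0_sqrtr ?mulr0// leNgt subr_gt0; apply/negP => xs; apply: xI.
rewrite inE/= in_itv/=; have : `|x - a| < Num.sqrt s.
  by rewrite -sqrtr_sqr ltr_sqrt.
by rewrite ltr_norml => /andP[? ?]; apply/andP; split; lra.
Qed.

Lemma vol_ball (y : space3 R) (t : R) : 0 <= t ->
  vol [set x | dist3 x y < t] = (4 / 3 * pi * t ^+ 3)%:E.
Proof.
move=> t0; have dE x : (dist3 x y < t) =
    ((x.1.1 - y.1.1) ^+ 2 + (x.1.2 - y.1.2) ^+ 2 + (x.2 - y.2) ^+ 2 < t ^+ 2).
  rewrite /dist3 /enorm/= -[in LHS](ger0_norm t0) -sqrtr_sqr.
  have [->|tn0] := eqVneq t 0.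
    by rewrite expr0n/= sqrtr0 !ltNge sqrtr_ge0 !addr_ge0// sqr_ge0.
  by rewrite ltr_sqrt// exprn_gt0// lt_def tn0.
under eq_set do rewrite dE.
set A := [set x | _].
have mA : measurable A.
  apply: measurable_lt_cst; apply: measurable_funD; [apply: measurable_funD|];
  by apply: measurable_funX; apply: measurable_funB => //;
    do ?[exact: measurable_fst|exact: measurable_snd];
    apply: measurableT_comp => //;
    do ?[exact: measurable_fst|exact: measurable_snd].
(* [vol] integrates lengths of vertical sections over the plane; uniqueness of the product measure
   permits slicing into horizontal discs instead. *)
transitivity (product_measure2 vol2 mu A).
  apply: (@product_measure_unique _ _ _ _ R vol2 mu) => //= B C mB mC.
  rewrite product_measure2E//.
transitivity (\int[mu]_x (pi * Num.max (t ^+ 2 - (x - y.2) ^+ 2) 0)%:E)%E.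
  apply: eq_integral => x _; rewrite -(vol2_disc y.1.1 y.1.2) /=.
  congr (vol2 _); apply/seteqP.
  by split=> z; rewrite /ysection /= ?inE/= ltrBrDr.
have [->|tn0] := eqVneq t 0.
  rewrite [0 ^+ 3]expr0n mulr0; apply: integral0_eq => x _.
  by rewrite expr0n/= max_r ?mulr0// sub0r oppr_le0 sqr_ge0.
have {tn0 t0}t0 : 0 < t by rewrite lt_def tn0.
transitivity (\int[mu]_(x in `[(y.2 - t)%R, (y.2 + t)%R])
    (pi * (t ^+ 2 - (x - y.2) ^+ 2))%:E)%E.
  rewrite [RHS]integral_mkcond; apply: eq_integral => x _.
  rewrite patchE; case: ifPn => [|/negP xI].
    rewrite inE/= in_itv/= => /andP[? ?]; rewrite max_l//; nra.
  rewrite max_r ?mulr0// subr_le0 leNgt; apply/negP => xs; apply: xI.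
  rewrite inE/= in_itv/=; apply/andP; split; nra.
have ty : y.2 - t < y.2 + t by lra.
have dF (x : R) : is_derive x 1
    (fun x => pi * (t ^+ 2 * x - (x - y.2) ^+ 3 / 3))
    (pi * (t ^+ 2 - (x - y.2) ^+ 2)).
  by apply: is_derive_eq; rewrite /GRing.scale/=; field.
rewrite (integral_itv_derive ty _ dF); last exact: is_derive_continuous.
by congr EFin; field.
Qed.

End Slices.

(** Measurability and nonnegativity are arguments of the set function itself, so that a measure
    structure can be attached to it below. *)
Definition density d (T : measurableType d) (R : realType)
    (mu : {measure set T -> \bar R}) (f : T -> R)
    of measurable_fun setT f & (forall x, 0 <= f x) :=
  fun A : set T => (\int[mu]_(x in A) (f x)%:E)%E.

Section Density.
Context d (T : measurableType d) (R : realType).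
Variables (mu : {measure set T -> \bar R}) (f : T -> R).
Hypotheses (mf : measurable_fun setT f) (f0 : forall x, 0 <= f x).
Local Notation density_measure := (density mu mf f0).

Let density0 : density_measure set0 = 0%E.
Proof. exact: integral_set0. Qed.

Let density_ge0 A : (0 <= density_measure A)%E.
Proof. by apply: integral_ge0 => x _; rewrite lee_fin. Qed.

Let density_sigma_additive : semi_sigma_additive density_measure.
Proof.
apply: (@semi_sigma_additive_nng_induced _ _ _ mu (EFin \o f)).
  exact/measurable_EFinP.
by move=> x; rewrite lee_fin.
Qed.

HB.instance Definition _ := isMeasure.Build _ _ _ density_measure
  density0 density_ge0 density_sigma_additive.

Import HBNNSimple.
Local Open Scope ereal_scope.

(** On indicators this is the definition of the density; simple functions follow by linearity and
    the general case by monotone convergence on both sides along the same approximating sequence. *)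
Lemma ge0_integral_density (g : T -> \bar R) :
  measurable_fun setT g -> (forall x, 0 <= g x) ->
  \int[density_measure]_x g x = \int[mu]_x (g x * (f x)%:E).
Proof.
move=> mg g0; pose h := nnsfun_approx measurableT mg.
have -> : \int[density_measure]_x g x =
    lim (\int[density_measure]_x (EFin \o h n) x @[n --> \oo]).
  under eq_integral => x _.
    rewrite (_ : g x = lim ((EFin \o h n) x @[n --> \oo])); last first.
      by apply/esym/cvg_lim => //; exact: cvg_nnsfun_approx.
    over.
  apply: monotone_convergence => //.
  - by move=> n; exact/measurable_EFinP.
  - by move=> n x _ /=; rewrite lee_fin.
  - by move=> x _ a b ab; rewrite lee_fin; exact/lefP/nd_nnsfun_approx.
have -> : \int[mu]_x (g x * (f x)%:E) =
    lim (\int[mu]_x ((EFin \o h n) x * (f x)%:E) @[n --> \oo]).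
  under eq_integral => x _.
    rewrite (_ : g x * _ = lim ((EFin \o h n) x * (f x)%:E @[n --> \oo])); last first.
      apply/esym/cvg_lim => //; apply: cvgeZr => //.
      exact: cvg_nnsfun_approx.
    over.
  apply: monotone_convergence => //.
  - move=> n; apply: emeasurable_funM; first exact/measurable_EFinP.
    exact/measurable_EFinP.
  - by move=> n x _ /=; rewrite mule_ge0 ?lee_fin.
  - move=> x _ a b ab; rewrite lee_wpmul2r ?lee_fin//.
    exact/lefP/nd_nnsfun_approx.
suff suf n : \int[density_measure]_x (EFin \o h n) x =
    \int[mu]_x ((EFin \o h n) x * (f x)%:E).
  by under eq_fun do rewrite suf.
have mind r : measurable_fun setT (fun x => (r * \1_(h n @^-1` [set r]) x)%:E).
  by apply/measurable_EFinP; exact: measurable_funM.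
transitivity (\sum_(y \in range (h n)) y%:E * density_measure (h n @^-1` [set y])).
  under eq_integral do rewrite /= fimfunE -fsumEFin//.
  rewrite ge0_integral_fsum//; last first.
    by move=> y x _; rewrite nnfun_muleindic_ge0.
  apply: eq_fsbigr => r _; rewrite integralZl_indic_nnsfun// integral_indic//=.
  by rewrite setIT.
transitivity (\int[mu]_x (\sum_(y \in range (h n))
    (y * \1_(h n @^-1` [set y]) x)%:E * (f x)%:E)); last first.
  apply: eq_integral => x _; rewrite /= [in RHS]fimfunE -fsumEFin//.
  by rewrite ge0_mule_fsuml// => y; rewrite nnfun_muleindic_ge0.
rewrite ge0_integral_fsum//; last 2 first.
- by move=> y; apply: emeasurable_funM => //; exact/measurable_EFinP.
- move=> y x _; apply: mule_ge0; last by rewrite lee_fin.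
  by rewrite EFinM nnfun_muleindic_ge0.
apply: eq_fsbigr => r _.
have [r0|r0] := leP 0%R r; last first.
  rewrite preimage_nnfun0// /density integral_set0 mule0.
  by apply/esym/integral0_eq => x _; rewrite indic0 /= mulr0 mul0e.
under eq_integral do rewrite EFinM -muleA.
rewrite ge0_integralZl//; last 2 first.
- apply: emeasurable_funM; last exact/measurable_EFinP.
  exact/measurable_EFinP.
- by move=> x _; rewrite mule_ge0 ?lee_fin.
congr (_ * _); rewrite /density integral_mkcond.
apply: eq_integral => x _; rewrite patchE indicE.
by case: ifPn; rewrite ?mul1e ?mul0e.
Qed.

End Density.

Section Radial.
Context {R : realType}.
Local Notation mu := (@lebesgue_measure R).

Lemma dist3_ge0 (x y : space3 R) : 0 <= dist3 x y.
Proof. exact: sqrtr_ge0. Qed.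

Lemma dist3C (x y : space3 R) : dist3 x y = dist3 y x.
Proof. by rewrite /dist3 /enorm/=; congr Num.sqrt; ring. Qed.

Lemma measurable_fun_dist3 d (T : measurableType d) (f g : T -> space3 R) :
  measurable_fun setT f -> measurable_fun setT g ->
  measurable_fun setT (fun z => dist3 (f z) (g z)).
Proof.
move=> mf mg; apply: (@measurableT_comp _ _ _ _ _ _ (@Num.sqrt R)).
  by apply: continuous_measurable_fun; exact: sqrt_continuous.
have m3 (h : T -> space3 R) : measurable_fun setT h ->
    measurable_fun setT (fun z => (h z).1.1) /\
    measurable_fun setT (fun z => (h z).1.2) /\
    measurable_fun setT (fun z => (h z).2).
  move=> mh; have m1 : measurable_fun setT (fun z => (h z).1).
    exact: (measurableT_comp measurable_fst).
  split; first exact: (measurableT_comp measurable_fst m1).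
  split; first exact: (measurableT_comp measurable_snd m1).
  exact: (measurableT_comp measurable_snd).
have [f1 [f2 f3]] := m3 _ mf; have [g1 [g2 g3]] := m3 _ mg.
by apply: measurable_funD; [apply: measurable_funD|];
  apply: measurable_funX; exact: measurable_funB.
Qed.

(** The area of the sphere of radius [t], the derivative of the volume of the ball; the extension by
    0 makes it a density on the whole line. *)
Let shell (t : R) : R := if 0 < t then 4 * pi * t ^+ 2 else 0.

Let measurable_shell : measurable_fun setT shell.
Proof.
apply: measurable_fun_ifT => //; first exact: measurable_fun_ltr.
by apply: measurable_funM => //; exact: measurable_funX.
Qed.

Let shell_ge0 t : 0 <= shell t.
Proof.
rewrite /shell; case: ifPn => // _.
by rewrite mulr_ge0// ?sqr_ge0// mulr_ge0// pi_ge0.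
Qed.

(* Both sides are integrals against the push-forward of the volume under the
   distance to [y], which is determined by the volumes of balls. *)
Lemma ge0_integral_radial (F : R -> \bar R) (y : space3 R) :
  measurable_fun setT F -> (forall t, (0 <= F t)%E) ->
  (\int[vol]_x F (dist3 x y) =
   \int[mu]_(t in `]0%R, +oo[) (F t * (4 * pi * t ^+ 2)%:E))%E.
Proof.
move=> mF F0; pose phi (x : space3 R) : measurableTypeR R := dist3 x y.
have mphi : measurable_fun setT phi by exact: measurable_fun_dist3.
rewrite -(@ge0_integral_pushforward _ _ _ _ _ _ mphi vol setT F)//.
transitivity (\int[density mu measurable_shell shell_ge0]_t F t)%E.
  pose phiM := isMeasurableFun.Build _ _ _ _ _ mphi.
  pose phi' : {mfun space3 R >-> measurableTypeR R} := HB.pack phi phiM.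
  suff key (A : set (measurableTypeR R)) : measurable A ->
      pushforward vol phi' A = density mu measurable_shell shell_ge0 A.
    by apply: eq_measure_integral => A mA _; exact: key.
  move=> mA; apply: (@measure_unique _ R (measurableTypeR R) [set A | exists x : R, A = `]-oo, x[%classic]
     (fun k => `]-oo, k%:R[%classic) _ _ _ _ (pushforward vol phi')
     (density mu measurable_shell shell_ge0)) => //.
  - exact: RGenInftyO.measurableE.
  - move=> _ _ [a ->] [b ->]; exists (Num.min a b).
    by apply/seteqP; split => t /=; rewrite !in_itv/= lt_min => /andP.
  - by move=> k; exists k%:R.
  - apply/seteqP; split => // t _; exists (Num.trunc `|t|).+1 => //=.
    rewrite in_itv/= (le_lt_trans (ler_norm t))//.
    exact: truncnS_gt.
  - move=> _ [a ->].
    have [a0|a0] := leP a 0.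
      rewrite [LHS](_ : _ = 0%E); last first.
        rewrite -[LHS]/(vol (phi @^-1` _)) (_ : _ @^-1` _ = set0) ?measure0//.
        apply/seteqP; split => // x /=; rewrite in_itv/= => xa.
        by have := dist3_ge0 x y; rewrite leNgt (lt_le_trans xa).
      apply/esym; apply: integral0_eq => t /=; rewrite in_itv/= => ta.
      by rewrite /shell ltNge (ltW (lt_le_trans ta _)).
    transitivity (4 / 3 * pi * a ^+ 3)%:E.
      by rewrite -(vol_ball y (ltW a0)); congr (vol _);
        apply/seteqP; split => x /=; rewrite in_itv.
    transitivity (\int[mu]_(t in `[0%R, a]) (4 * pi * t ^+ 2)%:E)%E.
      have dF (t : R) : is_derive t 1 (fun t => 4 / 3 * pi * t ^+ 3) (4 * pi * t ^+ 2).
        by apply: is_derive_eq; rewrite /GRing.scale/=; field.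
      rewrite (integral_itv_derive a0 _ dF); last exact: is_derive_continuous.
      by rewrite expr0n/= mulr0 subr0.
    have mt D : measurable_fun D (fun t : R => (4 * pi * t ^+ 2)%:E).
      apply/measurable_funTS/measurable_EFinP; apply: measurable_funM => //.
    rewrite -integral_itv_bndo_bndc; last exact: mt.
    rewrite -integral_itv_obnd_cbnd; last exact: mt.
    rewrite integral_mkcond [RHS]integral_mkcond; apply: eq_integral => t _.
    rewrite !patchE !mem_setE/= !in_itv/= /shell.
    by case: ifPn => [/andP[-> ->]|]//; case: ifPn => //; case: ifPn => // -> ->.
  move=> k; rewrite [ltLHS](_ : _ = (4 / 3 * pi * k%:R ^+ 3)%:E) ?ltry//.
  by rewrite -(vol_ball y (ler0n _ _)); congr (vol _);
    apply/seteqP; split => x /=; rewrite in_itv.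
rewrite ge0_integral_density// [RHS]integral_mkcond.
apply: eq_integral => t _; rewrite patchE mem_setE/= in_itv/= andbT /shell.
by case: ifPn; rewrite ?mule0.
Qed.

End Radial.

(** * The Gamma integral *)

Section GammaIntegral.
Context {R : realType}.
Local Notation mu := (@lebesgue_measure R).

Lemma is_derive_powR (a t : R) : 0 < t ->
  is_derive t 1 ((@powR R) ^~ a) (a * t `^ (a - 1)).
Proof.
move=> t0; have tI : t \in `]0, +oo[ by rewrite in_itv/= t0.
have := @powR_derive1 R a t tI; rewrite derive1E => <-.
by apply: derivableP; exact: derivable_powR.
Qed.

Lemma integral_itv_derive_in (F f : R -> R) (a b : R) : a < b ->
  (forall x, a <= x <= b -> {for x, continuous f}) ->
  (forall x, a <= x <= b -> is_derive x 1 F (f x)) ->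
  (\int[mu]_(x in `[a, b]) (f x)%:E = (F b - F a)%:E)%E.
Proof.
move=> ab cf dF; rewrite EFinB.
have cF x : a <= x <= b -> {for x, continuous F}.
  move=> xab; apply/differentiable_continuous/derivable1_diffP.
  by case: (dF x xab).
have oc x : x \in `]a, b[ -> a <= x <= b.
  by rewrite in_itv/= => /andP[/ltW-> /ltW->].
apply: (@continuous_FTC2 R f F a b) => //.
- apply: continuous_in_subspaceT => x; rewrite inE/= in_itv/=; exact: cf.
- split.
  + by move=> x /oc /dF[].
  + by apply: cvg_at_right_filter; apply: cF; rewrite lexx ltW.
  + by apply: cvg_at_left_filter; apply: cF; rewrite lexx ltW.
- by move=> x /oc xab; rewrite derive1E; case: (dF x xab).
Qed.

Let gam (s t : R) : R := t `^ (s - 1) * expR (- t).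

Let gam_ge0 s t : 0 <= gam s t.
Proof. by rewrite mulr_ge0 ?powR_ge0 ?expR_ge0. Qed.

Let measurable_gam s : measurable_fun setT (gam s).
Proof.
apply: measurable_funM; first exact: measurable_powR.
by apply: measurableT_comp => //.
Qed.

(** The exponential is at most 1 and [t^(s - 1)] has the primitive [t^s / s]. Since the derivative
    of a real power is at hand only for positive [t], the fundamental theorem is used on intervals
    exhausting []0, 1]], with the uniform bound [1 / s]. *)
Let integral_gam01_lty s : 0 < s ->
  (\int[mu]_(t in `]0%R, 1%R]) (gam s t)%:E < +oo)%E.
Proof.
move=> s0; pose D n : set R := `](n.+1%:R^-1)%R, 1%R]%classic.
have DE : `]0%R, 1%R]%classic = \bigcup_n D n.
  apply/seteqP; split => [t|t [n _]]; rewrite /D/= !in_itv/= => /andP[t0 t1].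
    exists (Num.trunc (t^-1)) => //; rewrite /D/= in_itv/= t1 andbT.
    by rewrite invf_plt ?posrE// truncnS_gt.
  by rewrite t1 (lt_trans _ t0) ?invr_gt0.
have mg E : measurable_fun E (fun t => (gam s t)%:E).
  by apply/measurable_funTS/measurable_EFinP; exact: measurable_gam.
have := @ge0_nondecreasing_set_cvg_integral _ (measurableTypeR R) R D (EFin \o gam s) mu.
rewrite -DE => cvgD.
apply: (@le_lt_trans _ _ (s^-1)%:E); last by rewrite ltry.
apply: (cvge_le _ (cvgD _ _ _ _)).
- exists 0%N => // n _ /=.
  have [->|n0] := eqVneq n 0%N.
    rewrite /D invr1 set_itv_ge ?integral_set0 ?lee_fin ?invr_ge0 ?(ltW s0)//.
    by rewrite bnd_simp ltxx.
  have n1 : n.+1%:R^-1 < 1 :> R by rewrite invf_lt1// ltr1n ltnS lt0n.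
  have np : 0 < n.+1%:R^-1 :> R by rewrite invr_gt0.
  apply: (@le_trans _ _ (\int[mu]_(t in D n) (t `^ (s - 1))%:E)%E).
    apply: ge0_le_integral => //=.
    - exact: measurable_itv.
    - by move=> t _; rewrite lee_fin.
    - by apply/measurable_funTS/measurable_EFinP; exact: measurable_gam.
    - by apply/measurable_funTS/measurable_EFinP; exact: measurable_powR.
    - move=> t; rewrite /D/= in_itv/= => /andP[t0 _]; rewrite lee_fin /gam.
      by rewrite ler_piMr ?powR_ge0// -expR0 ler_expR oppr_le0 ltW// (lt_trans np).
  rewrite integral_itv_obnd_cbnd; last first.
    by apply/measurable_funTS/measurable_EFinP; exact: measurable_powR.
  have dF (x : R) : 0 < x -> is_derive x 1 (fun t => s^-1 * t `^ s) (x `^ (s - 1)).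
    move=> x0; have := is_derive_powR s x0 => d.
    by apply: is_derive_eq; rewrite /GRing.scale/= mulrA mulVf ?mul1r// gt_eqF.
  rewrite (integral_itv_derive_in n1 _ (fun x xI => dF x _)).
  - by rewrite powR1 mulr1 lee_fin lerBlDr lerDl mulr_ge0 ?powR_ge0 ?invr_ge0 ?ltW.
  - move=> x /andP[x0 _]; have xp := lt_le_trans np x0.
    apply/differentiable_continuous/derivable1_diffP.
    by case: (is_derive_powR (s - 1) xp).
  - by move=> x /andP[x0 _]; exact: lt_le_trans np x0.
- move=> m n mn; apply/subsetPset => t; rewrite /D/= !in_itv/= => /andP[t0 ->].
  by rewrite andbT (le_lt_trans _ t0)// lef_pV2 ?posrE// ler_nat ltnS.
- by move=> n; rewrite /D.
- by move=> n; exact: mg.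
- by move=> n t _; rewrite lee_fin.
Qed.

(** Half of the exponential absorbs the power: with [m = 2 n],
    [(t / m)^n <= exp (t / m)^n = exp (t / 2)]. *)
Let integral_gam1y_lty s :
  (\int[mu]_(t in `[1%R, +oo[) (gam s t)%:E < +oo)%E.
Proof.
pose n := (Num.trunc `|s - 1|).+1; pose m : R := (2 * n)%:R.
have m0 : 0 < m by rewrite ltr0n muln_gt0.
have sn : s - 1 <= n%:R.
  by rewrite (le_trans (ler_norm _))// ltW// truncnS_gt.
have gle t : 1 <= t -> gam s t <= m ^+ n * expR (- (t / 2)).
  move=> t1; have t0 : 0 < t by exact: lt_le_trans t1.
  rewrite /gam (_ : - t = t / 2 * -1 + - (t / 2)); last by lra.
  rewrite mulrN1 expRD mulrA ler_wpM2r ?expR_ge0// expRN ler_pdivrMr ?expR_gt0//.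
  apply: (@le_trans _ _ (t ^+ n)).
    by rewrite -powR_mulrn ?(ltW t0)//; exact: ler_powR.
  rewrite (_ : t = m * (t / m)); last by field; rewrite gt_eqF.
  rewrite exprMn ler_wpM2l ?exprn_ge0 ?(ltW m0)//.
  rewrite (_ : m * (t / m) / 2 = (t / m) *+ n); last first.
    by rewrite -mulr_natr /m natrM; field; rewrite gt_eqF// ltr0n.
  rewrite -[t / m *+ n]mulr_natr expRM_natr lerXn2r ?nnegrE ?expR_ge0 ?divr_ge0 ?(ltW t0) ?(ltW m0)//.
  by rewrite (le_trans _ (expR_ge1Dx _))// lerDr.
have dF (t : R) : is_derive t 1 (fun t => - 2 * m ^+ n * expR (- (t / 2)))
    (m ^+ n * expR (- (t / 2))).
  by apply: is_derive_eq; rewrite /GRing.scale/=; field.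
have mf D : measurable_fun D (fun t : R => (m ^+ n * expR (- (t / 2)))%:E).
  apply/measurable_funTS/measurable_EFinP/measurable_funM => //.
  by apply: measurableT_comp => //; apply: measurableT_comp => //; exact: measurable_funM.
apply: (@le_lt_trans _ _ (\int[mu]_(t in `[1%R, +oo[) (m ^+ n * expR (- (t / 2)))%:E)%E).
  apply: ge0_le_integral => //.
  - by move=> t _; rewrite lee_fin.
  - by apply/measurable_funTS/measurable_EFinP; exact: measurable_gam.
  - exact: mf.
  - by move=> t /=; rewrite in_itv/= andbT lee_fin; exact: gle.
rewrite (@ge0_continuous_FTC2y R _ (fun t => - 2 * m ^+ n * expR (- (t / 2))) 1 0).
- by rewrite -EFinB ltry.
- by move=> t _; rewrite mulr_ge0 ?expR_ge0 ?exprn_ge0 ?(ltW m0).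
- by apply: continuous_subspaceT; exact: is_derive_continuous.
- rewrite -[X in _ --> X](mulr0 (- 2 * m ^+ n)).
  apply: cvgM; first exact: cvg_cst.
  apply: (@cvg_comp _ _ _ (fun t : R => t / 2) (fun t => expR (- t)) _ +oo%R).
    apply/cvgryPge => A; near=> t; rewrite ler_pdivlMr//.
  exact: cvgr_expR.
- by move=> t _; case: (dF t).
- by apply: cvg_at_right_filter; exact: (is_derive_continuous dF).
- by move=> t _; rewrite derive1E; case: (dF t).
Unshelve. all: by end_near. Qed.

(** [Gamma] is the real value of an extended integral, hence meaningful only once that integral is
    finite; finiteness is checked separately on both sides of 1. *)
Lemma GammaE (s : R) : 0 < s ->
  (\int[mu]_(t in `]0%R, +oo[) (t `^ (s - 1) * expR (- t))%:E = (Gamma s)%:E)%E.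
Proof.
move=> s0; rewrite /Gamma /Rintegral fineK// ge0_fin_numE; last first.
  by apply: integral_ge0 => t _; rewrite lee_fin; exact: gam_ge0.
have mg E : measurable_fun E (fun t => (gam s t)%:E).
  by apply/measurable_funTS/measurable_EFinP; exact: measurable_gam.
rewrite (_ : `]0%R, +oo[%classic = `]0%R, 1%R] `|` `]1%R, +oo[); last first.
  by rewrite -itv_bndbnd_setU// bnd_simp.
rewrite ge0_integral_setU//=; last 3 first.
- exact: mg.
- by move=> t _; rewrite lee_fin; exact: gam_ge0.
- apply/disj_setPS => t [/=]; rewrite !in_itv/= andbT => /andP[_ t1].
  by rewrite ltNge t1.
rewrite [X in (_ + X < _)%E]integral_itv_obnd_cbnd; last exact: mg.
by apply: lte_add_pinfty; [exact: integral_gam01_lty|exact: integral_gam1y_lty].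
Qed.

Lemma ge0_integral_scale (c : R) (g : R -> \bar R) : 0 < c ->
  measurable_fun setT g -> (forall t, (0 <= g t)%E) ->
  (\int[mu]_(t in `]0%R, +oo[) g t =
   c%:E * \int[mu]_(t in `]0%R, +oo[) g (c * t)%R)%E.
Proof.
move=> c0 mg g0.
pose phi (t : measurableTypeR R) : measurableTypeR R := c * t.
have mphi : measurable_fun setT phi by exact: measurable_funM.
have -> : (\int[mu]_(t in `]0%R, +oo[) g (c * t)%R =
    \int[pushforward mu phi]_(t in `]0%R, +oo[) g t)%E.
  rewrite ge0_integral_pushforward//; last exact: measurable_funTS.
  congr (integral _ _ _); apply/seteqP; split => t /=;
    by rewrite !in_itv/= !andbT /phi pmulr_rgt0.
rewrite -(@ge0_integral_mscale _ _ R (pushforward mu phi) `]0%R, +oo[ _ (NngNum (ltW c0)) g)//; last exact: measurable_funTS.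
apply: eq_measure_integral => A mA _.
(* The push-forward under multiplication by [c], multiplied by [c], gives every half-open interval
   its length, so it is Lebesgue measure. *)
apply: lebesgue_measure_unique => // _ [[a b] _ <-].
rewrite -[RHS]/(c%:E * mu (phi @^-1` `]a, b]))%E.
rewrite (_ : _ @^-1` _ = `]a / c, b / c]%classic); last first.
  by apply/seteqP; split => t /=; rewrite !in_itv/= /phi ler_pdivlMr//
    ltr_pdivrMr// mulrC.
rewrite !lebesgue_measure_itv/= !lte_fin ltr_pM2r ?invr_gt0//.
case: ifPn => _; last by rewrite mule0.
by rewrite -EFinB -!EFinB -EFinM -mulrBl mulrC divfK// gt_eqF.
Qed.

Lemma integral_powR_expR (s c : R) : 0 < s -> 0 < c ->
  (\int[mu]_(t in `]0%R, +oo[) (t `^ (s - 1) * expR (- (c * t)))%:E =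
   (Gamma s / c `^ s)%:E)%E.
Proof.
move=> s0 c0.
have mg : measurable_fun setT (EFin \o gam s).
  by apply/measurable_EFinP; exact: measurable_gam.
have := GammaE s0.
rewrite (@ge0_integral_scale c (EFin \o gam s))//; last first.
  by move=> t; rewrite lee_fin; exact: gam_ge0.
under eq_integral => t /[!inE]/=.
  rewrite in_itv/= andbT => t0.
  rewrite /gam powRM ?(ltW t0) ?(ltW c0)// -mulrA EFinM; over.
rewrite ge0_integralZl//=; last 3 first.
- apply/measurable_funTS/measurable_EFinP/measurable_funM.
    exact: measurable_powR.
  by apply: measurableT_comp => //; apply: measurableT_comp => //; exact: measurable_funM.
- by move=> t _; rewrite lee_fin mulr_ge0 ?powR_ge0 ?expR_ge0.
- by rewrite lee_fin powR_ge0.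
rewrite muleA -EFinM mulr_powRB1 ?(ltW c0)// => /(congr1 (fun x => (c `^ s)^-1%:E * x)%E).
by rewrite muleA -!EFinM mulVf ?mul1e// ?gt_eqF ?powR_gt0// mulrC.
Qed.

(** The surface factor [t^2] of polar coordinates turns [t^(- m)] into [t^((3 - m) - 1)], a Gamma
    integrand; [m < 3] is integrability at the centre. *)
Lemma integral_dist_powR_expR (m c : R) (y : space3 R) : m < 3 -> 0 < c ->
  (\int[vol]_x (dist3 x y `^ (- m) * expR (- (c * dist3 x y)))%:E =
   (4 * pi * Gamma (3 - m) / c `^ (3 - m))%:E)%E.
Proof.
move=> m3 c0.
rewrite (@ge0_integral_radial _ (fun t => (t `^ (- m) * expR (- (c * t)))%:E)); last 2 first.
- apply/measurable_EFinP/measurable_funM; first exact: measurable_powR.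
  by apply: measurableT_comp => //; apply: measurableT_comp => //; exact: measurable_funM.
- by move=> t; rewrite lee_fin mulr_ge0 ?powR_ge0 ?expR_ge0.
under eq_integral => t /[!inE]/=.
  rewrite in_itv/= andbT => t0.
  rewrite -EFinM (_ : t `^ _ * _ * _ = 4 * pi * (t `^ (3 - m - 1) * expR (- (c * t)))); last first.
    rewrite (_ : 3 - m - 1 = - m + 2%:R); last by lra.
    rewrite powRD; last by rewrite (gt_eqF t0) implybT.
    by rewrite powR_mulrn ?(ltW t0)//; ring.
  rewrite EFinM; over.
rewrite ge0_integralZl//=; last 3 first.
- apply/measurable_funTS/measurable_EFinP/measurable_funM.
    exact: measurable_powR.
  by apply: measurableT_comp => //; apply: measurableT_comp => //; exact: measurable_funM.
- by move=> t _; rewrite lee_fin mulr_ge0 ?powR_ge0 ?expR_ge0.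
- by rewrite lee_fin mulr_ge0 ?pi_ge0.
by rewrite integral_powR_expR ?subr_gt0// -EFinM mulrA.
Qed.

End GammaIntegral.

(** * Kernel inequalities of Young type *)

(** Every value of the exponential lies above its tangent at the weighted mean [m]; in the weighted
    sum of the tangents the linear terms cancel and [expR m] remains. *)
Lemma expR_convex4 (R : realType) (t1 t2 t3 t4 x1 x2 x3 x4 : R) :
  0 <= t1 -> 0 <= t2 -> 0 <= t3 -> 0 <= t4 -> t1 + t2 + t3 + t4 = 1 ->
  expR (t1 * x1 + t2 * x2 + t3 * x3 + t4 * x4) <=
  t1 * expR x1 + t2 * expR x2 + t3 * expR x3 + t4 * expR x4.
Proof.
move=> p1 p2 p3 p4 t1E; set m := (X in expR X <= _).
have tangent t x : 0 <= t -> t * (expR m * (1 + (x - m))) <= t * expR x.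
  move=> t0; rewrite ler_wpM2l// -[in leRHS](subrK m x) [leRHS]expRD mulrC.
  by rewrite ler_wpM2r ?expR_ge0// expR_ge1Dx.
apply: le_trans (lerD (lerD (lerD (tangent _ x1 p1) (tangent _ x2 p2))
  (tangent _ x3 p3)) (tangent _ x4 p4)).
rewrite [leRHS](_ : _ = expR m * ((t1 + t2 + t3 + t4) * (1 - m) + m)); last first.
  by rewrite /m; ring.
by rewrite t1E mul1r subrK mulr1.
Qed.

(* Writing each factor as an exponential, this is convexity of [expR] for the
   four weights on the right, which sum to 1. *)
Lemma four_factor_young (R : realType) (r P M N f a k a' f' : R) :
  1 < r -> 1 < P -> P <= 2 * r -> P <= (P - 1) * (2 * r) ->
  0 < M -> 0 < N -> 0 <= f -> 0 <= a -> 0 <= k -> 0 <= a' -> 0 <= f' ->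
  let rc := r / (r - 1) in
  let t := (2 * r)^-1 in
  f `^ (P - 1) * a * (k * (a' * f')) <= N `^ r^-1 * M `^ rc^-1 *
    (t / N * (a `^ (2 * r) * f' `^ P) + t / N * (f `^ P * a' `^ (2 * r)) +
     (1 - P^-1 - t) / M * (k `^ rc * f `^ P) + (P^-1 - t) / M * (k `^ rc * f' `^ P)).
Proof.
move=> r1 P1 P2r P2r' M0 N0 f0 a0 k0 a'0 f'0 /=.
set rc := r / (r - 1); set t1 := (2 * r)^-1.
pose ta := 1 - P^-1 - t1.
pose tb := P^-1 - t1.
have t10 : 0 <= t1 by rewrite invr_ge0; lra.
have ta0 : 0 <= ta.
  rewrite /ta /t1 (_ : _ - _ - _ = ((P - 1) * (2 * r) - P) / (P * (2 * r))).
    by rewrite divr_ge0//; nra.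
  by field; apply/andP; split; rewrite gt_eqF//; lra.
have tb0 : 0 <= tb by rewrite subr_ge0 lef_pV2 ?posrE//; lra.
rewrite -/ta -/tb; set rhs := (X in _ <= X).
have rhs0 : 0 <= rhs.
  have N0' := ltW N0; have M0' := ltW M0.
  by rewrite /rhs; do ?[exact: powR_ge0|assumption|apply: addr_ge0|
    apply: mulr_ge0|rewrite invr_ge0].
(* Vanishing factors are treated apart because the general case takes logarithms; for [f] this uses
   [P > 1]. *)
have [Fx0|Fx0] := eqVneq f 0.
  by rewrite Fx0 powR0 ?mul0r//; apply/eqP; lra.
have [->|Ax0] := eqVneq a 0; first by rewrite mulr0 mul0r.
have [->|kz0] := eqVneq k 0; first by rewrite mul0r mulr0.
have [->|Ay0] := eqVneq a' 0; first by rewrite mul0r !mulr0.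
have [->|Fy0] := eqVneq f' 0; first by rewrite !mulr0.
have exists_ln (x : R) : 0 <= x -> x != 0 -> exists u, x = expR u.
  by move=> x0 xn0; exists (ln x); rewrite lnK// posrE lt_def xn0.
rewrite /rhs {rhs rhs0}.
have [u uE] := exists_ln _ f0 Fx0; have [v vE] := exists_ln _ a0 Ax0.
have [b bE] := exists_ln _ k0 kz0; have [v' v'E] := exists_ln _ a'0 Ay0.
have [u' u'E] := exists_ln _ f'0 Fy0.
rewrite uE vE bE v'E u'E.
have [n ->] := exists_ln _ (ltW N0) (lt0r_neq0 N0).
have [m ->] := exists_ln _ (ltW M0) (lt0r_neq0 M0).
have shift c x y : c / expR x * expR y = c * expR (y - x).
  by rewrite expRB mulrA mulrAC.
rewrite -!expRM -!expRD !shift.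
set e1 := (X in t1 * expR X); set e2 := (X in t1 * _ + t1 * expR X).
set e3 := (X in ta * expR X); set e4 := (X in tb * expR X).
have := @expR_convex4 R t1 t1 ta tb e1 e2 e3 e4 t10 t10 ta0 tb0.
have -> : t1 + t1 + ta + tb = 1 by rewrite /ta /tb; lra.
move=> /(_ erefl) e4le; apply: le_trans (ler_wpM2l (expR_ge0 _) e4le).
(* The inequality of exponents is an equality, which is how the weights were found. With
   [t = 1/(2 r)], [f] collects [P t + P (1 - 1/P - t) = P - 1], [f'] collects
   [P t + P (1/P - t) = 1], [a] and [a'] collect [2 r t = 1], and [k] collects [rc (1 - 2 t) = 1];
   the powers of [N] and [M] cancel in the same way. *)
rewrite -expRD ler_expR le_eqVlt; apply/orP; left; apply/eqP.
rewrite /e1 /e2 /e3 /e4 /ta /tb /t1 /rc; field.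
by rewrite !gt_eqF//; lra.
Qed.

(** The two bounds on [P] place it between [2 r] and the exponent conjugate to [2 r]; they say
    precisely that the last two weights are nonnegative. *)
Lemma young_exponents (R : realType) (r P : R) :
  1 < r -> 1 < P -> P <= 2 * r -> P <= (P - 1) * (2 * r) ->
  [/\ 0 < r / (r - 1), 0 <= (2 * r)^-1, 0 <= 1 - P^-1 - (2 * r)^-1,
      0 <= P^-1 - (2 * r)^-1 &
      (2 * r)^-1 + (2 * r)^-1 + (1 - P^-1 - (2 * r)^-1) + (P^-1 - (2 * r)^-1) = 1].
Proof.
move=> r1 P1 P2r P2r'; split.
- by rewrite divr_gt0//; lra.
- by rewrite invr_ge0; lra.
- rewrite (_ : _ - _ - _ = ((P - 1) * (2 * r) - P) / (P * (2 * r))).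
    by rewrite divr_ge0//; nra.
  by field; apply/andP; split; rewrite gt_eqF//; lra.
- by rewrite subr_ge0 lef_pV2 ?posrE//; lra.
- by lra.
Qed.

(** Young's inequality produces the constant in the homogeneous form on the right; the [r]-th power
    clears the roots because [r] divided by its conjugate exponent is [r - 1]. *)
Lemma young_power (R : realType) (r M N : R) : 1 < r -> 0 <= N -> 0 <= M ->
  N * M `^ (r - 1) = (N `^ r^-1 * M `^ (r / (r - 1))^-1) `^ r.
Proof.
move=> r1 N0 M0; rewrite powRM ?powR_ge0// -!powRrM mulVf ?powRr1 ?gt_eqF//; last by lra.
by congr (_ * _ `^ _); field; rewrite !gt_eqF//; lra.
Qed.

Lemma ge0_integralD4 d (T : measurableType d) (R : realType)
    (mu : {measure set T -> \bar R}) (f g h i : T -> \bar R) :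
  measurable_fun setT f -> measurable_fun setT g ->
  measurable_fun setT h -> measurable_fun setT i ->
  (forall x, 0 <= f x)%E -> (forall x, 0 <= g x)%E ->
  (forall x, 0 <= h x)%E -> (forall x, 0 <= i x)%E ->
  (\int[mu]_x (f x + g x + h x + i x) =
   \int[mu]_x f x + \int[mu]_x g x + \int[mu]_x h x + \int[mu]_x i x)%E.
Proof.
move=> mf mg mh mi f0 g0 h0 i0.
have mfg : measurable_fun setT (fun x => f x + g x)%E by exact: emeasurable_funD.
rewrite ge0_integralD//; last 2 first.
- by move=> x _; rewrite !adde_ge0.
- exact: emeasurable_funD.
rewrite ge0_integralD//; last by move=> x _; rewrite adde_ge0.
by rewrite ge0_integralD.
Qed.

Section PairIntegrals.
Context {R : realType}.
Local Notation T := (space3 R).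
Local Notation vol := (@vol R).
Local Notation vv := (vol \x vol)%E.
Local Open Scope ereal_scope.

Lemma measurable_powR_comp d (X : measurableType d) (f : X -> R) (p : R) :
  measurable_fun setT f -> measurable_fun setT (fun x => f x `^ p)%R.
Proof. by move=> mf; apply: (measurableT_comp (measurable_powR p)). Qed.

Lemma integral_pair_mul (f g : T -> R) :
  measurable_fun setT f -> measurable_fun setT g ->
  (forall x, 0 <= f x)%R -> (forall x, 0 <= g x)%R ->
  \int[vv]_z (f z.1 * g z.2)%:E = \int[vol]_x (f x)%:E * \int[vol]_y (g y)%:E.
Proof.
move=> mf mg f0 g0; rewrite (fubini_tonelli1 (fun z : T * T => (f z.1 * g z.2)%:E)).
- rewrite /fubini_F; under eq_integral => x _.
    under eq_integral => y _ do rewrite /= EFinM.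
    rewrite ge0_integralZl//; last 3 first.
    + exact/measurable_EFinP.
    + by move=> y _; rewrite lee_fin.
    + by rewrite lee_fin.
    over.
  rewrite ge0_integralZr//=; first exact/measurable_EFinP.
  + by move=> x _; rewrite lee_fin.
  + by apply: integral_ge0 => y _; rewrite lee_fin.
- by apply/measurable_EFinP/measurable_funM; exact: measurableT_comp.
- by move=> z; rewrite lee_fin mulr_ge0.
Qed.

Lemma integral_pair_kernel1 (h : T * T -> R) (g : T -> R) (M : R) :
  measurable_fun setT h -> (forall z, 0 <= h z)%R ->
  measurable_fun setT g -> (forall x, 0 <= g x)%R ->
  (forall x, \int[vol]_y (h (x, y))%:E <= M%:E) ->
  \int[vv]_z (h z * g z.1)%:E <= M%:E * \int[vol]_x (g x)%:E.
Proof.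
move=> mh h0 mg g0 hM.
have M0 : (0 <= M)%R.
  rewrite -lee_fin; apply: le_trans (hM ((0, 0), 0)%R).
  by apply: integral_ge0 => y _; rewrite lee_fin.
have mhg : measurable_fun setT (fun z : T * T => (h z * g z.1)%:E).
  apply/measurable_EFinP/measurable_funM => //.
  by apply: measurableT_comp => //; exact: measurable_fst.
have hg0 z : 0 <= (h z * g z.1)%:E by rewrite lee_fin mulr_ge0.
rewrite (fubini_tonelli1 (fun z : T * T => (h z * g z.1)%:E))//.
rewrite -ge0_integralZl//; last 2 first.
- exact/measurable_EFinP.
- by move=> x _; rewrite lee_fin.
apply: ge0_le_integral => //.
- by move=> x _; apply: integral_ge0 => y _.
- exact: measurable_fun_fubini_tonelli_F.
- by apply: emeasurable_funM => //; exact/measurable_EFinP.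
move=> x _; rewrite /fubini_F /=.
under eq_integral => y _ do rewrite EFinM.
rewrite ge0_integralZr//; last 3 first.
- by apply/measurable_EFinP; exact: measurable_fun_pair2.
- by move=> y _; rewrite lee_fin.
- by rewrite lee_fin.
by rewrite lee_wpmul2r ?lee_fin.
Qed.

Lemma integral_pair_kernel2 (h : T * T -> R) (g : T -> R) (M : R) :
  measurable_fun setT h -> (forall z, 0 <= h z)%R ->
  measurable_fun setT g -> (forall x, 0 <= g x)%R ->
  (forall y, \int[vol]_x (h (x, y))%:E <= M%:E) ->
  \int[vv]_z (h z * g z.2)%:E <= M%:E * \int[vol]_x (g x)%:E.
Proof.
move=> mh h0 mg g0 hM.
have M0 : (0 <= M)%R.
  rewrite -lee_fin; apply: le_trans (hM ((0, 0), 0)%R).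
  by apply: integral_ge0 => y _; rewrite lee_fin.
have mhg : measurable_fun setT (fun z : T * T => (h z * g z.2)%:E).
  apply/measurable_EFinP/measurable_funM => //.
  by apply: measurableT_comp => //; exact: measurable_snd.
have hg0 z : 0 <= (h z * g z.2)%:E by rewrite lee_fin mulr_ge0.
rewrite (fubini_tonelli2 (fun z : T * T => (h z * g z.2)%:E))//.
rewrite -ge0_integralZl//; last 2 first.
- exact/measurable_EFinP.
- by move=> x _; rewrite lee_fin.
apply: ge0_le_integral => //.
- by move=> x _; apply: integral_ge0 => y _.
- exact: measurable_fun_fubini_tonelli_G.
- by apply: emeasurable_funM => //; exact/measurable_EFinP.
move=> y _; rewrite /fubini_G /=.
under eq_integral => x _ do rewrite EFinM.
rewrite ge0_integralZr//; last 3 first.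
- by apply/measurable_EFinP; exact: measurable_fun_pair1.
- by move=> x _; rewrite lee_fin.
- by rewrite lee_fin.
by rewrite lee_wpmul2r ?lee_fin.
Qed.

(** Extended-valued on purpose: it is used for nonnegative kernels and densities whose integral may
    be infinite. *)
Definition potential (k : T * T -> R) (g : T -> R) (x : T) : \bar R :=
  \int[vol]_y (k (x, y) * g y)%:E.

Lemma measurable_potential (k : T * T -> R) (g : T -> R) :
  measurable_fun setT k -> (forall z, 0 <= k z)%R ->
  measurable_fun setT g -> (forall x, 0 <= g x)%R ->
  measurable_fun setT (potential k g).
Proof.
move=> mk k0 mg g0.
apply: (measurable_fun_fubini_tonelli_F (fun z : T * T => (k z * g z.2)%:E)).
- apply/measurable_EFinP/measurable_funM => //.
  by apply: measurableT_comp => //; exact: measurable_snd.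
- by move=> z; rewrite lee_fin mulr_ge0.
Qed.

Lemma integral_mul_potential (k : T * T -> R) (f g : T -> R) :
  measurable_fun setT k -> (forall z, 0 <= k z)%R ->
  measurable_fun setT f -> (forall x, 0 <= f x)%R ->
  measurable_fun setT g -> (forall x, 0 <= g x)%R ->
  \int[vol]_x ((f x)%:E * potential k g x) =
  \int[vv]_z (f z.1 * (k z * g z.2))%:E.
Proof.
move=> mk k0 mf f0 mg g0.
have m1 : measurable_fun setT (fun z : T * T => k z * g z.2)%R.
  apply: measurable_funM => //.
  by apply: measurableT_comp => //; exact: measurable_snd.
rewrite (fubini_tonelli1 (fun z : T * T => (f z.1 * (k z * g z.2))%:E)).
- apply: eq_integral => x _; rewrite /fubini_F/=.
  under eq_integral => y _ do rewrite EFinM.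
  rewrite ge0_integralZl//.
  + apply/measurable_EFinP.
    by apply: (@measurable_fun_pair2 _ _ _ _ _ _ (fun z : T * T => k z * g z.2)%R).
  + by move=> y _; rewrite lee_fin mulr_ge0.
  + by rewrite lee_fin.
- apply/measurable_EFinP/measurable_funM => //.
  by apply: measurableT_comp => //; exact: measurable_fst.
- by move=> z; rewrite lee_fin !mulr_ge0.
Qed.

(** A Schur-type test. After multiplication by [F^(P - 1)] the left side integrates to [I], and each
    of the four Young terms integrates to at most its weight times [I]. The weights sum to 1, so
    [I <= C * I] with [C = N^(1/r) * M^(1/rc)], and [0 < I < +oo] forces [1 <= C]. *)
Lemma kernel_fixpoint_bound (k : T * T -> R) (A F : T -> R) (r P M N : R) :
  (1 < r)%R -> (1 < P)%R -> (P <= 2 * r)%R -> (P <= (P - 1) * (2 * r))%R ->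
  measurable_fun setT k -> (forall z, 0 <= k z)%R ->
  measurable_fun setT A -> (forall x, 0 <= A x)%R ->
  measurable_fun setT F -> (forall x, 0 <= F x)%R ->
  (0 < M)%R -> (0 < N)%R ->
  (forall x, \int[vol]_y (k (x, y) `^ (r / (r - 1)))%:E <= M%:E) ->
  (forall y, \int[vol]_x (k (x, y) `^ (r / (r - 1)))%:E <= M%:E) ->
  \int[vol]_x (A x `^ (2 * r))%:E <= N%:E ->
  0 < \int[vol]_x (F x `^ P)%:E -> \int[vol]_x (F x `^ P)%:E < +oo ->
  {ae vol, forall x, (F x)%:E <= (A x)%:E * potential k (fun y => A y * F y)%R x} ->
  (1 <= N * M `^ (r - 1))%R.
Proof.
move=> r1 P1 P2r P2r' mk k0 mA A0 mF F0 M0 N0 kM1 kM2 AN I0 Ioo FU.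
have [rc0 t10 ta0 tb0 tE] := young_exponents r1 P1 P2r P2r'.
have pointwise z := four_factor_young r1 P1 P2r P2r' M0 N0 (F0 z.1) (A0 z.1)
  (k0 z) (A0 z.2) (F0 z.2).
have Fpow x : (F x `^ P = F x `^ (P - 1) * F x)%R.
  by rewrite mulrC mulr_powRB1// (lt_trans _ P1).
have r0 : (0 <= r)%R by rewrite (le_trans _ (ltW r1)).
rewrite (young_power r1 (ltW N0) (ltW M0)).
move: rc0 t10 ta0 tb0 tE pointwise kM1 kM2 => /=.
set rc := (r / (r - 1))%R; set t1 := ((2 * r)^-1)%R.
set ta := (1 - P^-1 - t1)%R; set tb := (P^-1 - t1)%R.
set C := (N `^ (r^-1) * M `^ (rc^-1))%R.
move=> rc0 t10 ta0 tb0 tE pointwise kM1 kM2.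
set I := \int[vol]_x (F x `^ P)%:E in I0 Ioo *.
have mFP : measurable_fun setT (fun x => F x `^ P)%R by exact: measurable_powR_comp.
have mA2 : measurable_fun setT (fun x => A x `^ (2 * r))%R by exact: measurable_powR_comp.
have mkr : measurable_fun setT (fun z => k z `^ rc)%R by exact: measurable_powR_comp.
have mFA : measurable_fun setT (fun x => F x `^ (P - 1) * A x)%R.
  by apply: measurable_funM => //; exact: measurable_powR_comp.
have mAF : measurable_fun setT (fun x => A x * F x)%R by exact: measurable_funM.
have FA0 x : (0 <= F x `^ (P - 1) * A x)%R by rewrite mulr_ge0 ?powR_ge0.
have AF0 x : (0 <= A x * F x)%R by rewrite mulr_ge0.
have mU := measurable_potential mk k0 mAF AF0.
have U0 x : 0 <= potential k (fun y => A y * F y)%R x.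
  by apply: integral_ge0 => y _; rewrite lee_fin mulr_ge0.
have fst_ (f : T -> R) : measurable_fun setT f ->
    measurable_fun setT (fun z : T * T => f z.1) by move=> mf; exact: measurableT_comp.
have snd_ (f : T -> R) : measurable_fun setT f ->
    measurable_fun setT (fun z : T * T => f z.2) by move=> mf; exact: measurableT_comp.
have step1 : I <= \int[vv]_z ((F z.1 `^ (P - 1) * A z.1) * (k z * (A z.2 * F z.2)))%:E.
  rewrite -(integral_mul_potential mk k0 mFA FA0 mAF AF0).
  apply: ae_ge0_le_integral => //.
  - by move=> x _; rewrite lee_fin powR_ge0.
  - exact/measurable_EFinP.
  - by move=> x _; rewrite mule_ge0 ?lee_fin.
  - by apply: emeasurable_funM => //; exact/measurable_EFinP.
  apply: filterS FU => x FUx _.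
  by rewrite Fpow EFinM (EFinM _ (A x)) -muleA lee_wpmul2l// lee_fin powR_ge0.
have C0 : (0 <= C)%R by rewrite mulr_ge0 ?powR_ge0.
have I0' := ltW I0; have N0' := ltW N0; have M0' := ltW M0.
(* The divisors [N] and [M] in the Young terms normalise each of them, so that only the weight [c]
   survives in front of [I]. *)
have bound c (h : T * T -> R) J : (0 <= c)%R -> (forall z, 0 <= h z)%R ->
    measurable_fun setT h -> \int[vv]_z (h z)%:E <= J%:E * I -> (0 < J)%R ->
    \int[vv]_z (c / J * h z)%:E <= c%:E * I.
  move=> c0 h0 mh hJ J0; under eq_integral do rewrite EFinM.
  rewrite ge0_integralZl//; last 3 first.
  - exact/measurable_EFinP.
  - by move=> z _; rewrite lee_fin.
  - by rewrite lee_fin divr_ge0// ltW.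
  apply: le_trans (lee_wpmul2l _ hJ) _; first by rewrite lee_fin divr_ge0// ltW.
  by rewrite muleA -EFinM divfK// gt_eqF.
have step2 : \int[vv]_z ((F z.1 `^ (P - 1) * A z.1) * (k z * (A z.2 * F z.2)))%:E <=
    C%:E * I.
  have m1 : measurable_fun setT (fun z : T * T => A z.1 `^ (2 * r) * F z.2 `^ P)%R.
    by apply: measurable_funM; [exact: (fst_ _ mA2)|exact: (snd_ _ mFP)].
  have m2 : measurable_fun setT (fun z : T * T => F z.1 `^ P * A z.2 `^ (2 * r))%R.
    by apply: measurable_funM; [exact: (fst_ _ mFP)|exact: (snd_ _ mA2)].
  have m3 : measurable_fun setT (fun z : T * T => k z `^ rc * F z.1 `^ P)%R.
    by apply: measurable_funM => //; exact: (fst_ _ mFP).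
  have m4 : measurable_fun setT (fun z : T * T => k z `^ rc * F z.2 `^ P)%R.
    by apply: measurable_funM => //; exact: (snd_ _ mFP).
  have b1 := bound t1 (fun z : T * T => A z.1 `^ (2 * r) * F z.2 `^ P)%R N t10
    (fun z => mulr_ge0 (powR_ge0 _ _) (powR_ge0 _ _)) m1.
  have b2 := bound t1 (fun z : T * T => F z.1 `^ P * A z.2 `^ (2 * r))%R N t10
    (fun z => mulr_ge0 (powR_ge0 _ _) (powR_ge0 _ _)) m2.
  have b3 := bound ta (fun z : T * T => k z `^ rc * F z.1 `^ P)%R M ta0
    (fun z => mulr_ge0 (powR_ge0 _ _) (powR_ge0 _ _)) m3.
  have b4 := bound tb (fun z : T * T => k z `^ rc * F z.2 `^ P)%R M tb0
    (fun z => mulr_ge0 (powR_ge0 _ _) (powR_ge0 _ _)) m4.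
  have {}b1 : \int[vv]_z (t1 / N * (A z.1 `^ (2 * r) * F z.2 `^ P))%:E <= t1%:E * I.
    apply: b1 => //; rewrite (integral_pair_mul mA2 mFP) ?lee_wpmul2r//.
    - by move=> x; exact: powR_ge0.
    - by move=> x; exact: powR_ge0.
  have {}b2 : \int[vv]_z (t1 / N * (F z.1 `^ P * A z.2 `^ (2 * r)))%:E <= t1%:E * I.
    apply: b2 => //; rewrite (integral_pair_mul mFP mA2) 1?muleC ?lee_wpmul2r//.
    - by move=> x; exact: powR_ge0.
    - by move=> x; exact: powR_ge0.
  have {}b3 : \int[vv]_z (ta / M * (k z `^ rc * F z.1 `^ P))%:E <= ta%:E * I.
    exact: (b3 (integral_pair_kernel1 mkr (fun=> powR_ge0 _ _) mFP (fun=> powR_ge0 _ _) kM1) M0).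
  have {}b4 : \int[vv]_z (tb / M * (k z `^ rc * F z.2 `^ P))%:E <= tb%:E * I.
    exact: (b4 (integral_pair_kernel2 mkr (fun=> powR_ge0 _ _) mFP (fun=> powR_ge0 _ _) kM2) M0).
  have m1' : measurable_fun setT (fun z : T * T => (t1 / N * (A z.1 `^ (2 * r) * F z.2 `^ P))%:E).
    by apply/measurable_EFinP; exact: measurable_funM.
  have m2' : measurable_fun setT (fun z : T * T => (t1 / N * (F z.1 `^ P * A z.2 `^ (2 * r)))%:E).
    by apply/measurable_EFinP; exact: measurable_funM.
  have m3' : measurable_fun setT (fun z : T * T => (ta / M * (k z `^ rc * F z.1 `^ P))%:E).
    by apply/measurable_EFinP; exact: measurable_funM.
  have m4' : measurable_fun setT (fun z : T * T => (tb / M * (k z `^ rc * F z.2 `^ P))%:E).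
    by apply/measurable_EFinP; exact: measurable_funM.
  have p1 z : 0 <= (t1 / N * (A z.1 `^ (2 * r) * F z.2 `^ P))%:E.
    by rewrite lee_fin mulr_ge0 ?divr_ge0 ?mulr_ge0 ?powR_ge0.
  have p2 z : 0 <= (t1 / N * (F z.1 `^ P * A z.2 `^ (2 * r)))%:E.
    by rewrite lee_fin mulr_ge0 ?divr_ge0 ?mulr_ge0 ?powR_ge0.
  have p3 z : 0 <= (ta / M * (k z `^ rc * F z.1 `^ P))%:E.
    by rewrite lee_fin mulr_ge0 ?divr_ge0 ?mulr_ge0 ?powR_ge0.
  have p4 z : 0 <= (tb / M * (k z `^ rc * F z.2 `^ P))%:E.
    by rewrite lee_fin mulr_ge0 ?divr_ge0 ?mulr_ge0 ?powR_ge0.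
  apply: (@le_trans _ _ (\int[vv]_z (C%:E * (
     (t1 / N * (A z.1 `^ (2 * r) * F z.2 `^ P))%:E +
     (t1 / N * (F z.1 `^ P * A z.2 `^ (2 * r)))%:E +
     (ta / M * (k z `^ rc * F z.1 `^ P))%:E +
     (tb / M * (k z `^ rc * F z.2 `^ P))%:E)))).
    apply: ge0_le_integral => //.
    - by move=> z _; rewrite lee_fin !mulr_ge0// powR_ge0.
    - apply/measurable_EFinP/measurable_funM; first exact: (fst_ _ mFA).
      by apply: measurable_funM => //; exact: (snd_ _ mAF).
    - apply: emeasurable_funM => //.
      by apply: emeasurable_funD; [apply: emeasurable_funD; [exact: emeasurable_funD|]|].
    - by move=> z _; rewrite -!EFinD -EFinM lee_fin; exact: pointwise.
  rewrite ge0_integralZl//; last 2 first.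
  - by apply: emeasurable_funD; [apply: emeasurable_funD; [exact: emeasurable_funD|]|].
  - by move=> z _; rewrite !adde_ge0.
  rewrite lee_wpmul2l ?lee_fin// (ge0_integralD4 _ m1' m2' m3' m4')//.
  apply: le_trans (leeD (leeD (leeD b1 b2) b3) b4) _.
  have /fineK <- : I \is a fin_num by rewrite ge0_fin_numE.
  rewrite -!EFinM -!EFinD lee_fin -!mulrDl.
  by rewrite tE mul1r.
have C1 : (1 <= C)%R.
  have /fineK IE : I \is a fin_num by rewrite ge0_fin_numE.
  have := le_trans step1 step2; rewrite -IE -EFinM lee_fin.
  have : (0 < fine I)%R by rewrite -lte_fin IE.
  by move=> h; rewrite -[X in (X <= _)%R -> _]mul1r ler_pM2r.
have -> : (1 = 1 `^ r :> R)%R by rewrite powR1.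
by apply: ge0_ler_powR; rewrite ?nnegrE.
Qed.

End PairIntegrals.

(** Young's inequality with weights [1/P], [1/p - 1/P] and [1/p']: the exponent of [f] is
    [p/P + p (1/p - 1/P) = 1]. The free parameter [t] is later put close to the integral of
    [k1^P f^p], so that the result is homogeneous of degree [1/P] in that integral, as after
    Hoelder's inequality. *)
Lemma bootstrap_young (R : realType) (p p' P t k1 k2 a f : R) :
  1 < p -> p^-1 + p'^-1 = 1 -> p < P -> 0 < t ->
  0 <= k1 -> 0 <= k2 -> 0 <= a -> 0 <= f ->
  k1 * k2 * (a * f) <= t `^ P^-1 *
    (P^-1 / t * (k1 `^ P * f `^ p) + (p^-1 - P^-1) * f `^ p +
     p'^-1 * (k2 `^ p' * a `^ p')).
Proof.
move=> p1 pp' pP t0 k10 k20 a0 f0.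
have p'E : p'^-1 = 1 - p^-1 by lra.
have p'0 : 0 < p' by rewrite -invr_gt0 p'E subr_gt0 invf_lt1//; lra.
have P0 : 0 <= P^-1 by rewrite invr_ge0; lra.
have pP0 : 0 <= p^-1 - P^-1 by rewrite subr_ge0 lef_pV2 ?posrE//; lra.
have p'V0 : 0 <= p'^-1 by rewrite invr_ge0 ltW.
set rhs := (X in _ <= X).
have rhs0 : 0 <= rhs.
  have t0' := ltW t0.
  by rewrite /rhs; do ?[exact: powR_ge0|assumption|apply: addr_ge0|
    apply: mulr_ge0|rewrite invr_ge0].
have [->|k1n0] := eqVneq k1 0; first by rewrite !mul0r.
have [->|k2n0] := eqVneq k2 0; first by rewrite mulr0 mul0r.
have [->|an0] := eqVneq a 0; first by rewrite mul0r mulr0.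
have [->|fn0] := eqVneq f 0; first by rewrite !mulr0.
have exists_ln (x : R) : 0 <= x -> x != 0 -> exists u, x = expR u.
  by move=> x0 xn0; exists (ln x); rewrite lnK// posrE lt_def xn0.
rewrite /rhs {rhs rhs0}.
have [u uE] := exists_ln _ k10 k1n0; have [v vE] := exists_ln _ k20 k2n0.
have [b bE] := exists_ln _ a0 an0; have [g gE] := exists_ln _ f0 fn0.
have [s sE] := exists_ln _ (ltW t0) (lt0r_neq0 t0).
rewrite uE vE bE gE sE.
have shift c x y : c / expR x * expR y = c * expR (y - x).
  by rewrite expRB mulrA mulrAC.
rewrite -!expRM -!expRD !shift.
set e1 := (X in P^-1 * expR X); set e3 := (X in p'^-1 * expR X).
have := @expR_convex4 R P^-1 (p^-1 - P^-1) p'^-1 0 e1 (g * p) e3 0 P0 pP0 p'V0 (lexx _).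
have -> : P^-1 + (p^-1 - P^-1) + p'^-1 + 0 = 1 by lra.
move=> /(_ erefl); rewrite !mul0r !addr0 => e4le.
apply: le_trans (ler_wpM2l (expR_ge0 _) e4le).
rewrite -expRD ler_expR le_eqVlt; apply/orP; left; apply/eqP.
have -> : p'^-1 * e3 = v + b by rewrite /e3; field; rewrite gt_eqF.
rewrite /e1.
have Pn0 : P != 0 by rewrite gt_eqF//; lra.
have pn0 : p != 0 by rewrite gt_eqF//; lra.
by field; rewrite Pn0.
Qed.

(** The exponent [2 r / (2 r - 1)] equals both [(1 - t) r / (r - 1)] and [t (2 r)] for
    [t = 1/(2 r - 1)]. Convexity with weights [1 - t] and [t] therefore applies, and the weights are
    then dropped. *)
Lemma powRM_le_add (R : realType) (r a k : R) : 1 < r -> 0 <= a -> 0 <= k ->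
  a `^ (2 * r / (2 * r - 1)) * k `^ (2 * r / (2 * r - 1)) <=
  k `^ (r / (r - 1)) + a `^ (2 * r).
Proof.
move=> r1 a0 k0; set P := 2 * r / (2 * r - 1).
have P0 : P != 0 by rewrite gt_eqF// divr_gt0//; lra.
have rhs0 : 0 <= k `^ (r / (r - 1)) + a `^ (2 * r) by rewrite addr_ge0 ?powR_ge0.
have [a00|an0] := eqVneq a 0; first by rewrite [a `^ P](_ : _ = 0) ?mul0r// a00 powR0.
have [k00|kn0] := eqVneq k 0; first by rewrite [k `^ P](_ : _ = 0) ?mulr0// k00 powR0.
have exists_ln (x : R) : 0 <= x -> x != 0 -> exists u, x = expR u.
  by move=> x0 xn0; exists (ln x); rewrite lnK// posrE lt_def xn0.
have [u ->] := exists_ln _ a0 an0; have [v ->] := exists_ln _ k0 kn0.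
rewrite -!expRM -expRD.
pose t := (2 * r - 1)^-1.
have t0 : 0 <= t by rewrite invr_ge0; lra.
have t1 : t <= 1 by rewrite invf_le1; lra.
have t1' : 0 <= 1 - t by lra.
have := @expR_convex4 R (1 - t) t 0 0 (v * (r / (r - 1))) (u * (2 * r)) 0 0 t1' t0 (lexx _) (lexx _).
rewrite !mul0r !addr0 subrK => /(_ erefl) le1.
apply: (@le_trans _ _ ((1 - t) * expR (v * (r / (r - 1))) + t * expR (u * (2 * r)))).
  apply: le_trans le1; rewrite ler_expR le_eqVlt; apply/orP; left; apply/eqP.
  by rewrite /P /t; field; apply/andP; split; rewrite gt_eqF//; lra.
by apply: lerD; rewrite ler_piMl ?expR_ge0//; lra.
Qed.

Section Bootstrap.
Context {R : realType}.
Local Notation T := (space3 R).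
Local Notation vol := (@vol R).
Local Notation vv := (vol \x vol)%E.
Local Open Scope ereal_scope.

(* Splitting the kernel as [k1 * k2], the factor [k2] localises [A] and [k1] lies
   in the space for which Young's inequality raises the integrability from [p]
   to the exponent conjugate to [2 r]. *)
Lemma kernel_bootstrap (k1 k2 : T * T -> R) (A F : T -> R) (p p' r M N D : R) :
  (1 < p)%R -> (p^-1 + p'^-1 = 1)%R -> (1 < r)%R ->
  (p < 2 * r / (2 * r - 1))%R ->
  measurable_fun setT k1 -> (forall z, 0 <= k1 z)%R ->
  measurable_fun setT k2 -> (forall z, 0 <= k2 z)%R ->
  measurable_fun setT A -> (forall x, 0 <= A x)%R ->
  measurable_fun setT F -> (forall x, 0 <= F x)%R ->
  (forall y, \int[vol]_x (k1 (x, y) `^ (r / (r - 1)))%:E <= M%:E) ->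
  (forall x, \int[vol]_y (k2 (x, y) `^ p' * A y `^ p')%:E <= D%:E) ->
  \int[vol]_x (A x `^ (2 * r))%:E <= N%:E ->
  \int[vol]_x (F x `^ p)%:E < +oo ->
  {ae vol, forall x, (F x)%:E <= (A x)%:E *
     potential (fun z => k1 z * k2 z)%R (fun y => A y * F y)%R x} ->
  \int[vol]_x (F x `^ (2 * r / (2 * r - 1)))%:E < +oo.
Proof.
move=> p1 pp' r1; set P := (2 * r / (2 * r - 1))%R.
move=> pP mk1 k10 mk2 k20 mA A0 mF F0 kM kD AN Ioo FU.
set I := \int[vol]_x (F x `^ p)%:E in Ioo.
have I0 : 0 <= I by apply: integral_ge0 => x _; rewrite lee_fin powR_ge0.
have Ifin : I \is a fin_num by rewrite ge0_fin_numE.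
have P0 : (0 < P)%R by rewrite (lt_trans _ pP)// (lt_trans _ p1).
have pP0 : (0 <= p^-1 - P^-1)%R.
  by rewrite subr_ge0 lef_pV2 ?posrE ?(ltW pP)// (lt_trans _ p1).
have p'V0 : (0 <= p'^-1)%R.
  rewrite (_ : p'^-1 = 1 - p^-1)%R; last by rewrite -pp' addrAC subrr add0r.
  by rewrite subr_ge0 invf_le1 ?ltW// (lt_trans _ p1).
have D0 : (0 <= D)%R.
  rewrite -lee_fin; apply: le_trans (kD ((0, 0), 0)%R).
  by apply: integral_ge0 => y _; rewrite lee_fin mulr_ge0 ?powR_ge0.
pose c := ((p^-1 - P^-1) * fine I + p'^-1 * D)%R.
have c0 : (0 <= c)%R by rewrite addr_ge0// mulr_ge0// fine_ge0.
pose c' := (P^-1 + c)%R.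
have c'0 : (0 < c')%R by rewrite ltr_wpDr// invr_gt0.
pose V := potential (fun z => k1 z `^ P)%R (fun y => F y `^ p)%R.
have mk1P : measurable_fun setT (fun z => k1 z `^ P)%R by exact: measurable_powR_comp.
have mk1r : measurable_fun setT (fun z => k1 z `^ (r / (r - 1)))%R.
  exact: measurable_powR_comp.
have mFp : measurable_fun setT (fun x => F x `^ p)%R by exact: measurable_powR_comp.
have mAP : measurable_fun setT (fun x => A x `^ P)%R by exact: measurable_powR_comp.
have mA2 : measurable_fun setT (fun x => A x `^ (2 * r))%R by exact: measurable_powR_comp.
have k1P0 z : (0 <= k1 z `^ P)%R by exact: powR_ge0.
have Fp0 x : (0 <= F x `^ p)%R by exact: powR_ge0.
have AP0 x : (0 <= A x `^ P)%R by exact: powR_ge0.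
have V0 x : 0 <= V x by apply: integral_ge0 => y _; rewrite lee_fin mulr_ge0.
have mV : measurable_fun setT V by exact: measurable_potential.
(* In the integrated inequality the first term contributes at most [1/P] once [V x <= t]; the other
   two contribute [c], from the integral of [F^p] and the local bound [D]. This explains
   [c' = 1/P + c]. *)
have U_le (x : T) (t : R) : (0 < t)%R -> V x <= t%:E ->
    potential (fun z => k1 z * k2 z)%R (fun y => A y * F y)%R x <= (t `^ P^-1 * c')%:E.
  move=> t0 Vt.
  have mk1x : measurable_fun setT (fun y => k1 (x, y)) by exact: measurable_fun_pair2.
  have mk2x : measurable_fun setT (fun y => k2 (x, y)) by exact: measurable_fun_pair2.
  have m1 : measurable_fun setT (fun y => (k1 (x, y) `^ P * F y `^ p)%:E).
    by apply/measurable_EFinP; apply: measurable_funM => //; exact: measurable_powR_comp.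
  have m2 : measurable_fun setT (fun y => (F y `^ p)%:E) by exact/measurable_EFinP.
  have m3 : measurable_fun setT (fun y => (k2 (x, y) `^ p' * A y `^ p')%:E).
    by apply/measurable_EFinP; apply: measurable_funM; exact: measurable_powR_comp.
  have n1 y : 0 <= (k1 (x, y) `^ P * F y `^ p)%:E by rewrite lee_fin mulr_ge0.
  have n2 y : 0 <= (F y `^ p)%:E by rewrite lee_fin.
  have n3 y : 0 <= (k2 (x, y) `^ p' * A y `^ p')%:E by rewrite lee_fin mulr_ge0 ?powR_ge0.
  have a0 : 0 <= (P^-1 / t)%:E by rewrite lee_fin divr_ge0 ?invr_ge0 ?ltW.
  have a1 : 0 <= (p^-1 - P^-1)%:E by rewrite lee_fin.
  have a2 : 0 <= p'^-1%:E by rewrite lee_fin.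
  apply: (@le_trans _ _ (\int[vol]_y ((t `^ P^-1)%:E *
      ((P^-1 / t)%:E * (k1 (x, y) `^ P * F y `^ p)%:E +
       (p^-1 - P^-1)%:E * (F y `^ p)%:E +
       p'^-1%:E * (k2 (x, y) `^ p' * A y `^ p')%:E)))).
    apply: ge0_le_integral => //.
    - by move=> y _; rewrite lee_fin !mulr_ge0.
    - by apply/measurable_EFinP; apply: measurable_funM; exact: measurable_funM.
    - apply: emeasurable_funM => //; apply: emeasurable_funD.
        by apply: emeasurable_funD; exact: emeasurable_funM.
      exact: emeasurable_funM.
    - move=> y _; rewrite -!EFinM lee_fin.
      exact: bootstrap_young.
  rewrite ge0_integralZl//; last 3 first.
  - apply: emeasurable_funD; last exact: emeasurable_funM.
    by apply: emeasurable_funD; exact: emeasurable_funM.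
  - by move=> y _; rewrite !adde_ge0// mule_ge0.
  - by rewrite lee_fin powR_ge0.
  rewrite [leRHS]EFinM lee_wpmul2l ?lee_fin ?powR_ge0//.
  rewrite ge0_integralD//; last 4 first.
  - by move=> y _; rewrite adde_ge0// mule_ge0.
  - by apply: emeasurable_funD; exact: emeasurable_funM.
  - by move=> y _; rewrite mule_ge0.
  - exact: emeasurable_funM.
  rewrite ge0_integralD//; last 4 first.
  - by move=> y _; rewrite mule_ge0.
  - exact: emeasurable_funM.
  - by move=> y _; rewrite mule_ge0.
  - exact: emeasurable_funM.
  rewrite !ge0_integralZl// -/I.
  have -> : c'%:E = P^-1%:E + (p^-1 - P^-1)%:E * I + p'^-1%:E * D%:E.
    by rewrite /c' /c EFinD EFinD addeA !EFinM fineK.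
  rewrite leeD ?lee_wpmul2l// leeD2r//.
  apply: le_trans (lee_wpmul2l a0 Vt) _.
  by rewrite -EFinM divfK// gt_eqF.
have FV : {ae vol, forall x, (F x `^ P)%:E <= (c' `^ P * A x `^ P)%:E * V x}.
  have Pn0 : P != 0%R by rewrite gt_eqF.
  apply: filterS FU => x FUx.
  have [A0x|An0] := eqVneq (A x) 0%R.
    have -> : F x = 0%R.
      by apply/eqP; rewrite eq_le F0 andbT -lee_fin; move: FUx; rewrite A0x mul0e.
    by rewrite powR0// mule_ge0// lee_fin mulr_ge0 ?powR_ge0.
  have cA0 : (0 < c' `^ P * A x `^ P)%R by rewrite mulr_gt0 ?powR_gt0// lt_def An0 A0.
  have := V0 x; move VE : (V x) => v; case: v VE => [v| |] // VE v0; last first.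
    by rewrite gt0_muley ?leey// lte_fin.
  apply/lee_addgt0Pr => e e0; rewrite -EFinM -EFinD lee_fin.
  (* [V x] may vanish whereas [t] must be positive, so [t = V x + d] is used; [d] is tuned so that
     the surplus is exactly [e]. *)
  pose d := (e / (c' `^ P * A x `^ P))%R.
  have d0 : (0 < d)%R by rewrite divr_gt0.
  have vd0 : (0 < v + d)%R by rewrite ltr_wpDl.
  have := U_le x (v + d)%R vd0; rewrite VE lee_fin lerDl => /(_ (ltW d0)) Ux.
  have Fle : (F x <= A x * ((v + d) `^ P^-1 * c'))%R.
    by rewrite -lee_fin EFinM; apply: le_trans FUx _; rewrite lee_wpmul2l ?lee_fin.
  apply: (@le_trans _ _ ((A x * ((v + d) `^ P^-1 * c')) `^ P)%R).
    by apply: ge0_ler_powR; rewrite ?nnegrE ?(ltW P0)// !mulr_ge0 ?powR_ge0 ?(ltW c'0).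
  rewrite !powRM ?mulr_ge0 ?powR_ge0 ?(ltW c'0)// -powRrM mulVf// powRr1 ?(ltW vd0)//.
  rewrite [leLHS](_ : _ = (c' `^ P * A x `^ P) * v + (c' `^ P * A x `^ P) * d)%R; last by ring.
  by rewrite [X in (_ + X <= _)%R]mulrC divfK// gt_eqF.
have step : \int[vol]_x (F x `^ P)%:E <=
    (c' `^ P)%:E * \int[vv]_z (A z.1 `^ P * (k1 z `^ P * F z.2 `^ p))%:E.
  rewrite -(integral_mul_potential mk1P k1P0 mAP AP0 mFp Fp0).
  rewrite -ge0_integralZl//; last 3 first.
  - by apply: emeasurable_funM => //; exact/measurable_EFinP.
  - by move=> x _; rewrite mule_ge0 ?lee_fin.
  - by rewrite lee_fin powR_ge0.
  apply: ae_ge0_le_integral => //.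
  - by move=> x _; rewrite lee_fin powR_ge0.
  - by apply/measurable_EFinP; exact: measurable_powR_comp.
  - by move=> x _; rewrite mule_ge0 ?lee_fin ?powR_ge0// mule_ge0 ?lee_fin.
  - by apply: emeasurable_funM => //; apply: emeasurable_funM => //; exact/measurable_EFinP.
  by apply: filterS FV => x + _; rewrite EFinM -muleA.
apply: le_lt_trans step _.
have M0 : (0 <= M)%R.
  rewrite -lee_fin; apply: le_trans (kM ((0, 0), 0)%R).
  by apply: integral_ge0 => y _; rewrite lee_fin powR_ge0.
have N0 : (0 <= N)%R.
  by rewrite -lee_fin; apply: le_trans AN; apply: integral_ge0 => y _; rewrite lee_fin powR_ge0.
have k1r0 z : (0 <= k1 z `^ (r / (r - 1)))%R by exact: powR_ge0.
have A20 x : (0 <= A x `^ (2 * r))%R by exact: powR_ge0.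
have fst_ (f : T -> R) : measurable_fun setT f ->
    measurable_fun setT (fun z : T * T => f z.1) by move=> mf; exact: measurableT_comp.
have snd_ (f : T -> R) : measurable_fun setT f ->
    measurable_fun setT (fun z : T * T => f z.2) by move=> mf; exact: measurableT_comp.
(* By [powRM_le_add] the product [A^P k1^P] splits into a power of the kernel alone and a power of
   [A] alone, each integrable in [x] against the fixed mass of [F^p] in [y]. *)
apply: (@le_lt_trans _ _ ((c' `^ P)%:E * (M%:E * I + N%:E * I))); last first.
  by rewrite -(fineK Ifin) -!EFinM ltry.
rewrite lee_wpmul2l ?lee_fin ?powR_ge0//.
apply: (@le_trans _ _ (\int[vv]_z ((k1 z `^ (r / (r - 1)) * F z.2 `^ p)%:E +
    (A z.1 `^ (2 * r) * F z.2 `^ p)%:E))).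
  apply: ge0_le_integral => //.
  - by move=> z _; rewrite lee_fin !mulr_ge0.
  - apply/measurable_EFinP/measurable_funM; first exact: (fst_ _ mAP).
    by apply: measurable_funM => //; exact: (snd_ _ mFp).
  - apply: emeasurable_funD; apply/measurable_EFinP/measurable_funM => //.
    + exact: (snd_ _ mFp).
    + exact: (fst_ _ mA2).
    + exact: (snd_ _ mFp).
  - move=> z _; rewrite -EFinD lee_fin -mulrDl mulrA ler_wpM2r//.
    exact: powRM_le_add.
rewrite ge0_integralD//; last 4 first.
- by move=> z _; rewrite lee_fin mulr_ge0.
- by apply/measurable_EFinP/measurable_funM => //; exact: (snd_ _ mFp).
- by move=> z _; rewrite lee_fin mulr_ge0.
- apply/measurable_EFinP/measurable_funM; first exact: (fst_ _ mA2).
  exact: (snd_ _ mFp).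
apply: leeD; first exact: (integral_pair_kernel2 mk1r _ mFp).
by rewrite (integral_pair_mul mA2 mFp)// lee_wpmul2r.
Qed.

End Bootstrap.

(** * The Yukawa kernel *)

Section Yukawa.
Context {R : realType}.
Local Notation T := (space3 R).
Local Notation vol := (@vol R).
Local Notation vv := (vol \x vol)%E.

Lemma dist3_triangle (x y z : T) : dist3 x z <= dist3 x y + dist3 y z.
Proof.
move: x y z => [[x1 x2] x3] [[y1 y2] y3] [[z1 z2] z3]; rewrite /dist3 /enorm/=.
have lagrange (a b c u v w : R) : Num.sqrt ((a + u) ^+ 2 + (b + v) ^+ 2 + (c + w) ^+ 2) <=
    Num.sqrt (a ^+ 2 + b ^+ 2 + c ^+ 2) + Num.sqrt (u ^+ 2 + v ^+ 2 + w ^+ 2).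
  set s := Num.sqrt (a ^+ 2 + _ + _); set t := Num.sqrt (u ^+ 2 + _ + _).
  have s0 : 0 <= s by exact: sqrtr_ge0.
  have t0 : 0 <= t by exact: sqrtr_ge0.
  have sE : s ^+ 2 = a ^+ 2 + b ^+ 2 + c ^+ 2 by rewrite sqr_sqrtr// !addr_ge0 ?sqr_ge0.
  have tE : t ^+ 2 = u ^+ 2 + v ^+ 2 + w ^+ 2 by rewrite sqr_sqrtr// !addr_ge0 ?sqr_ge0.
  rewrite -[leRHS]ger0_norm ?addr_ge0// -sqrtr_sqr ler_wsqrtr//.
  have : a * u + b * v + c * w <= s * t.
    apply: le_trans (ler_norm _) _.
    rewrite -[leRHS]ger0_norm ?mulr_ge0// -ler_sqr ?nnegrE// !real_normK ?num_real//.
    rewrite exprMn sE tE -subr_ge0.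
    (* Lagrange's identity, which gives the Cauchy-Schwarz inequality in three dimensions. *)
    rewrite [leRHS](_ : _ = (a * v - b * u) ^+ 2 + (a * w - c * u) ^+ 2 +
      (b * w - c * v) ^+ 2); last by ring.
    by rewrite !addr_ge0 ?sqr_ge0.
  have -> : (a + u) ^+ 2 + (b + v) ^+ 2 + (c + w) ^+ 2 =
    s ^+ 2 + t ^+ 2 + 2 * (a * u + b * v + c * w) by rewrite sE tE; ring.
  have -> : (s + t) ^+ 2 = s ^+ 2 + t ^+ 2 + 2 * (s * t) by ring.
  by move=> h; rewrite lerD2l ler_pM2l.
by have := lagrange (x1 - y1) (x2 - y2) (x3 - y3) (y1 - z1) (y2 - z2) (y3 - z3);
  rewrite !addrA !subrK.
Qed.

(** The fundamental solution of [alpha^2 - Delta] in dimension three, as a function of the distance.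
    At distance 0 its value is 0 by the convention on inverses, so it does not dominate a
    regularised kernel there; pointwise comparisons are made at positive distance. *)
Definition yukawa (alpha t : R) : R := expR (- (alpha * t)) / (4 * pi * t).

Lemma yukawa_ge0 alpha t : 0 <= t -> 0 <= yukawa alpha t.
Proof. by move=> t0; rewrite divr_ge0 ?expR_ge0// mulr_ge0// mulr_ge0// pi_ge0. Qed.

Lemma measurable_expR_scale (alpha : R) :
  measurable_fun setT (fun t : R => expR (- (alpha * t))).
Proof.
by apply: measurableT_comp => //; apply: measurableT_comp => //.
Qed.

(** The inverse is written [f * (f^2)^(-1)] with a real power of a nonnegative base, a formula that
    respects [0^-1 = 0]. *)
Lemma measurable_inv_fun d (X : measurableType d) (f : X -> R) :
  measurable_fun setT f -> measurable_fun setT (fun x => (f x)^-1).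
Proof.
move=> mf; rewrite (_ : (fun x => _) = (fun x => f x * (f x ^+ 2) `^ (-1))).
  by apply: measurable_funM => //; apply: measurable_powR_comp; exact: measurable_funX.
apply/funext => x; rewrite powR_inv1 ?sqr_ge0//.
have [->|f0] := eqVneq (f x) 0; first by rewrite invr0 mul0r.
by rewrite expr2 invfM mulrA divff// mul1r.
Qed.

Lemma measurable_yukawa alpha : measurable_fun setT (yukawa alpha).
Proof.
apply: measurable_funM; first exact: measurable_expR_scale.
by apply: measurable_inv_fun; exact: measurable_funM.
Qed.

Lemma measurable_pair_dist3 : measurable_fun setT (fun z : T * T => dist3 z.1 z.2).
Proof. by apply: measurable_fun_dist3; [exact: measurable_fst|exact: measurable_snd]. Qed.

Lemma yukawa_powR (alpha m t : R) : 0 < m -> 0 <= t ->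
  yukawa alpha t `^ m = (4 * pi) `^ (- m) * (t `^ (- m) * expR (- (m * alpha * t))).
Proof.
move=> m0 t0; have pi0 : 0 <= 4 * pi :> R by rewrite mulr_ge0// pi_ge0.
rewrite /yukawa powRM ?expR_ge0 ?invr_ge0 ?mulr_ge0 ?pi_ge0//.
rewrite -expRM mulNr (mulrC (alpha * t)) mulrA.
have -> : (4 * pi * t)^-1 `^ m = (4 * pi) `^ (- m) * t `^ (- m).
  by rewrite -powR_inv1 ?mulr_ge0 ?pi_ge0// -powRrM mulN1r powRM.
by rewrite [LHS]mulrC !mulrA.
Qed.

Lemma integral_yukawa_powR (alpha m : R) (y : T) : 0 < alpha -> 0 < m < 3 ->
  (\int[vol]_x (yukawa alpha (dist3 x y) `^ m)%:E =
   ((4 * pi) `^ (- m) * (4 * pi * Gamma (3 - m) / (m * alpha) `^ (3 - m)))%:E)%E.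
Proof.
move=> a0 /andP[m0 m3].
have mp : measurable_fun setT
    (fun x : T => (dist3 x y `^ (- m) * expR (- (m * alpha * dist3 x y)))).
  have md : measurable_fun setT (fun x : T => dist3 x y) by exact: measurable_fun_dist3.
  apply: measurable_funM; first exact: measurable_powR_comp.
  exact: (measurableT_comp (measurable_expR_scale _) md).
under eq_integral => x _ do rewrite yukawa_powR ?dist3_ge0// EFinM.
rewrite ge0_integralZl//; last 3 first.
- exact/measurable_EFinP.
- by move=> x _; rewrite lee_fin mulr_ge0 ?powR_ge0 ?expR_ge0.
- by rewrite lee_fin powR_ge0.
by rewrite integral_dist_powR_expR ?mulr_gt0// EFinM.
Qed.

Lemma Gamma_gt0 (s : R) : 0 < s -> 0 < Gamma s.
Proof.
move=> s0; rewrite -lte_fin -GammaE//.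
(* A lower bound of the integrand on [[1, 2]]; the minimum serves both signs of [s - 1]. *)
pose c := Num.min 1 (2 `^ (s - 1)) * expR (- 2) : R.
have c0 : 0 < c by rewrite mulr_gt0 ?expR_gt0// lt_min ltr01 powR_gt0.
apply: (@lt_le_trans _ _ (\int[@lebesgue_measure R]_(t in `[1%R, 2%R]) c%:E)%E).
  by rewrite integral_cst//= lebesgue_measure_itv/= lte_fin ltr1n -EFinB -EFinM
    lte_fin mulr_gt0// subr_gt0 ltr1n.
have mg D : measurable_fun D (fun t : R => (t `^ (s - 1) * expR (- t))%:E).
  apply/measurable_funTS/measurable_EFinP/measurable_funM; first exact: measurable_powR.
  exact: measurableT_comp.
apply: (@le_trans _ _ (\int[@lebesgue_measure R]_(t in `[1%R, 2%R])
    (t `^ (s - 1) * expR (- t))%:E)%E).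
  apply: ge0_le_integral => //.
  - by move=> t _; rewrite lee_fin ltW.
  - exact: mg.
  - move=> t /=; rewrite in_itv/= => /andP[t1 t2]; rewrite lee_fin.
    have t0 : 0 < t by exact: lt_le_trans t1.
    apply: ler_pM; rewrite ?le_min ?ler01 ?powR_ge0 ?expR_ge0 ?ler_expR ?lerN2//.
    rewrite ge_min; have [s1|s1] := leP 1 s.
      by rewrite -[X in X <= _](powRr0 t) ler_powR// subr_ge0.
    apply/orP; right; rewrite -(opprB 1 s) !powRN lef_pV2 ?posrE ?powR_gt0//.
    by apply: ge0_ler_powR; rewrite ?nnegrE ?subr_ge0 ?(ltW s1) ?(ltW t0).
apply: ge0_subset_integral => //.
- exact: mg.
- by move=> t _; rewrite lee_fin mulr_ge0 ?powR_ge0 ?expR_ge0.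
- by move=> t /=; rewrite !in_itv/= andbT => /andP[t1 _]; exact: lt_le_trans t1.
Qed.

Lemma integral_expR_dist (c : R) (y : T) : 0 < c ->
  (\int[vol]_x (expR (- (c * dist3 x y)))%:E = (4 * pi * Gamma 3 / c `^ 3)%:E)%E.
Proof.
move=> c0; have := @integral_dist_powR_expR R 0 c y (ltr0n _ _) c0.
by rewrite subr0 => <-; apply: eq_integral => x _; rewrite oppr0 powRr0 mul1r.
Qed.

Lemma integral_ball_dist_exp (n : nat) (y : T) :
  (\int[vol]_(x in [set x | (dist3 x y < 1)%R]) (dist3 x y ^+ n)%:E =
    (4 * pi / n.+3%:R)%:E)%E.
Proof.
pose F (t : R) : \bar R := (if t < 1 then t `^ n%:R else 0)%:E.
have mF : measurable_fun setT F.
  apply/measurable_EFinP; apply: measurable_fun_ifT => //.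
  exact: measurable_fun_ltr.
have F0 t : (0 <= F t)%E by rewrite lee_fin; case: ifPn => // _; exact: powR_ge0.
transitivity (\int[vol]_x F (dist3 x y))%E.
  rewrite integral_mkcond; apply: eq_integral => x _.
  rewrite patchE /F powR_mulrn ?dist3_ge0//.
  by have [h|h] := boolP (dist3 x y < 1); [rewrite mem_set|rewrite memNset// => h'; move: h; rewrite h'].
rewrite (ge0_integral_radial _ mF F0).
have dG (m : nat) (t : R) :
    is_derive t 1 (fun t => 4 * pi / m.+1%:R * t ^+ m.+1) (4 * pi * t ^+ m).
  have d := @is_deriveX R R id m.+1 t 1 1 (is_derive_id _ _).
  have m0 : m.+1%:R != 0 :> R by rewrite pnatr_eq0.
  have XE : (id : R -> R) ^+ m.+1 = (fun t => t ^+ m.+1).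
    by apply/funext => u; rewrite exprfctE.
  rewrite XE in d; have := is_deriveZ (4 * pi / m.+1%:R) d.
  rewrite (_ : _ *: _ = 4 * pi * t ^+ m)//.
  by rewrite /GRing.scale/= mulr1; field.
have mG D : measurable_fun D (fun t : R => (4 * pi * t ^+ n.+2)%:E).
  by apply/measurable_funTS/measurable_EFinP; exact: measurable_funM.
have cG : continuous (fun t : R => 4 * pi * t ^+ n.+2).
  move=> t; apply: cvgM; first exact: cvg_cst.
  exact: exprn_continuous.
have := integral_itv_derive (@ltr01 R) cG (dG n.+2).
rewrite expr1n expr0n/= mulr0 mulr1 subr0 => <-.
rewrite -integral_itv_bndo_bndc; last exact: mG.
rewrite -integral_itv_obnd_cbnd; last exact: mG.
rewrite integral_mkcond [RHS]integral_mkcond; apply: eq_integral => t _.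
rewrite !patchE !mem_setE/= !in_itv/= andbT /F.
case: ifPn => //= t0; case: ifPn => t1; last by rewrite mul0e.
by rewrite powR_mulrn ?(ltW t0)// -EFinM; congr EFin; rewrite !exprS expr0; ring.
Qed.

Lemma cabsE (z : R[i]) : cabs z = Num.sqrt (complex.Re z ^+ 2 + complex.Im z ^+ 2).
Proof. by case: z. Qed.

Lemma cabs_ge0 (z : R[i]) : 0 <= cabs z.
Proof. by rewrite cabsE sqrtr_ge0. Qed.

Lemma measurable_sqrt_comp d (X : measurableType d) (f : X -> R) :
  measurable_fun setT f -> measurable_fun setT (fun x => Num.sqrt (f x)).
Proof.
apply: (@measurableT_comp _ _ _ _ _ _ (@Num.sqrt R)).
by apply: continuous_measurable_fun; exact: sqrt_continuous.
Qed.

Lemma measurable_cabs (u : field3 R) :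
  cmeasurable u -> measurable_fun setT (fun x => cabs (u x)).
Proof.
move=> [mr mi]; under eq_fun do rewrite cabsE.
by apply: measurable_sqrt_comp; apply: measurable_funD; exact: measurable_funX.
Qed.

(* Each point is averaged over the unit ball around it, which trades the
   exponential weight for the local supremum defining [Mnorm]. *)
Lemma integral_expR_dist_Mnorm (u : field3 R) (nu p c : R) : 0 < nu -> 0 < c ->
  cmeasurable u -> (Mnorm nu p u < +oo)%E ->
  exists D : R, forall x : T,
    (\int[vol]_y (expR (- (c * dist3 x y)) * cabs (u y) `^ p)%:E <= D%:E)%E.
Proof.
move=> nu0 c0 mu Moo.
pose g (y : T) : R := cabs (u y) `^ p.
have mg : measurable_fun setT g by apply: measurable_powR_comp; exact: measurable_cabs.
have g0 y : 0 <= g y by exact: powR_ge0.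
have Mub (x : T) : (\int[vol]_(y in [set y | (dist3 x y < 1)%R])
    (g y * dist3 x y `^ (nu - 3))%:E <= Mnorm nu p u)%E.
  by apply: ereal_sup_ubound; exists x.
have M0 : (0 <= Mnorm nu p u)%E.
  apply: le_trans (Mub ((0, 0), 0)); apply: integral_ge0 => y _.
  by rewrite lee_fin mulr_ge0 ?powR_ge0.
have Mfin : Mnorm nu p u \is a fin_num by rewrite ge0_fin_numE.
pose G := fine (Mnorm nu p u).
(* A natural exponent above [nu - 3]: at distance below 1 the averaging kernel [d^n] is then
   dominated by the weight [d^(nu - 3)] of [Mnorm], while being bounded and having an explicit
   mass. *)
pose n := (Num.trunc `|nu - 3|).+1.
have nun : nu - 3 <= n%:R by rewrite (le_trans (ler_norm _))// ltW// truncnS_gt.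
pose b (z : T * T) : R := if dist3 z.1 z.2 < 1 then dist3 z.1 z.2 `^ n%:R else 0.
have mb : measurable_fun setT b.
  apply: measurable_fun_ifT => //.
    by apply: measurable_fun_ltr => //; exact: measurable_pair_dist3.
  by apply: measurable_powR_comp; exact: measurable_pair_dist3.
have b0 z : 0 <= b z by rewrite /b; case: ifPn => // _; exact: powR_ge0.
have bg w : (\int[vol]_y (b (w, y) * g y)%:E <= G%:E)%E.
  rewrite /G fineK//; apply: le_trans (Mub w); rewrite [leRHS]integral_mkcond.
  have md : measurable_fun setT (fun y => dist3 w y) by exact: measurable_fun_dist3.
  apply: ge0_le_integral => //.
  - by move=> y _; rewrite lee_fin mulr_ge0.
  - by apply/measurable_EFinP/measurable_funM => //; exact: measurable_fun_pair2.
  - apply/(measurable_restrictT _ _).1; first exact: measurable_lt_cst.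
    apply/measurable_funTS/measurable_EFinP/measurable_funM => //.
    exact: measurable_powR_comp.
  move=> y _; rewrite patchE /b /=.
  have [h|h] := boolP (dist3 w y < 1); last by rewrite memNset ?mul0r//; exact/negP.
  rewrite mem_set// lee_fin mulrC ler_wpM2l//.
  have [->|d0] := eqVneq (dist3 w y) 0.
    by rewrite powR0 ?powR_ge0// pnatr_eq0.
  by apply: ger_powR => //; rewrite lt_def d0 dist3_ge0 ltW.
have binv y : (\int[vol]_w (b (w, y))%:E = (4 * pi / n.+3%:R)%:E)%E.
  rewrite -(integral_ball_dist_exp n y) [RHS]integral_mkcond; apply: eq_integral => w _.
  rewrite patchE /b /= powR_mulrn ?dist3_ge0//.
  have [h|h] := boolP (dist3 w y < 1); first by rewrite mem_set.
  by rewrite memNset//; exact/negP.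
pose k0 : R := 4 * pi / n.+3%:R.
have k0p : 0 < k0 by rewrite divr_gt0// mulr_gt0// pi_gt0.
pose E3 : R := 4 * pi * Gamma 3 / c `^ 3.
exists (k0^-1 * (expR c * (G * E3))) => x.
have me : measurable_fun setT (fun y => expR (- (c * dist3 x y))).
  apply: (measurableT_comp (measurable_expR_scale c)).
  exact: measurable_fun_dist3.
have meg : measurable_fun setT (fun y => expR (- (c * dist3 x y)) * g y).
  exact: measurable_funM.
(* Moving the exponential from [y] to a point [w] at distance below 1 costs at most the factor
   [expR c]. Integrating first in [w] recovers the target times the mass [k0]; integrating first in
   [y] gives the local bound [G] times the integral of the exponential. *)
pose f (z : T * T) : \bar R := (expR c * expR (- (c * dist3 x z.1)) * (b z * g z.2))%:E.
have mf : measurable_fun setT f.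
  apply/measurable_EFinP/measurable_funM.
    by apply: measurable_funM => //; exact: (measurableT_comp me).
  by apply: measurable_funM => //; exact: (measurableT_comp mg).
have f0 z : (0 <= f z)%E by rewrite lee_fin !mulr_ge0 ?expR_ge0.
have lower : (k0%:E * \int[vol]_y (expR (- (c * dist3 x y)) * g y)%:E <=
    \int[vol]_y \int[vol]_w f (w, y))%E.
  rewrite -ge0_integralZl//; last 3 first.
  - exact/measurable_EFinP.
  - by move=> y _; rewrite lee_fin mulr_ge0 ?expR_ge0.
  - by rewrite lee_fin ltW.
  apply: ge0_le_integral => //.
  - by move=> y _; apply: mule_ge0; rewrite lee_fin ?(ltW k0p)// mulr_ge0 ?expR_ge0.
  - by apply: emeasurable_funM => //; exact/measurable_EFinP.
  - exact: (measurable_fun_fubini_tonelli_G f).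
  move=> y _; rewrite muleC /k0 -(binv y) -ge0_integralZl//; last 3 first.
  - by apply/measurable_EFinP; exact: measurable_fun_pair1.
  - by move=> w _; rewrite lee_fin.
  - by rewrite lee_fin mulr_ge0 ?expR_ge0.
  apply: ge0_le_integral => //.
  - by move=> w _; apply: mule_ge0; rewrite lee_fin// mulr_ge0 ?expR_ge0.
  - apply: emeasurable_funM => //.
    by apply/measurable_EFinP; exact: measurable_fun_pair1.
  - exact: measurable_fun_pair1.
  move=> w _; rewrite -EFinM lee_fin -[leLHS]mulrA [g y * _]mulrC.
  have [h|h] := boolP (dist3 w y < 1); last first.
    by rewrite /b /= (negbTE h) mul0r !mulr0.
  rewrite ler_wpM2r ?mulr_ge0// -expRD ler_expR.
  have := dist3_triangle x y w; rewrite (dist3C y w).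
  by have := c0; nra.
have upper : (\int[vol]_w \int[vol]_y f (w, y) <= (expR c * (G * E3))%:E)%E.
  apply: (@le_trans _ _ (\int[vol]_w ((expR c * G)%:E * (expR (- (c * dist3 x w)))%:E))%E).
    apply: ge0_le_integral => //.
    - by move=> w _; apply: integral_ge0.
    - exact: (measurable_fun_fubini_tonelli_F f).
    - by apply: emeasurable_funM => //; exact/measurable_EFinP.
    move=> w _; rewrite /f/=.
    under eq_integral => y _ do rewrite EFinM.
    rewrite ge0_integralZl; last 4 first.
    - by [].
    - by apply/measurable_EFinP/measurable_funM => //; exact: measurable_fun_pair2.
    - by move=> y _; rewrite lee_fin mulr_ge0.
    - by rewrite lee_fin mulr_ge0 ?expR_ge0.
    rewrite -[leRHS]EFinM mulrAC [leRHS]EFinM.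
    by rewrite lee_wpmul2l ?lee_fin ?mulr_ge0 ?expR_ge0.
  rewrite ge0_integralZl; last 4 first.
  - by [].
  - exact/measurable_EFinP.
  - by move=> w _; rewrite lee_fin expR_ge0.
  - by rewrite lee_fin mulr_ge0 ?expR_ge0 ?fine_ge0.
  under eq_integral do rewrite dist3C.
  by rewrite integral_expR_dist// -/E3 -EFinM [X in (_ <= X%:E)%E]mulrA.
rewrite (fubini_tonelli f)// in upper.
rewrite EFinM lee_pdivlMl//.
exact: le_trans upper.
Qed.

End Yukawa.

Lemma integral_powR_eq0 d (X : measurableType d) (R : realType)
    (mu : {measure set X -> \bar R}) (F : X -> R) (s : R) :
  s != 0 -> measurable_fun setT F -> (forall x, 0 <= F x) ->
  (\int[mu]_x (F x `^ s)%:E = 0)%E <-> {ae mu, forall x, F x = 0}.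
Proof.
move=> s0 mF F0.
have mFs : measurable_fun setT (fun x => (F x `^ s)%:E).
  by apply/measurable_EFinP; exact: measurable_powR_comp.
rewrite -(_ : \int[mu]_x `|(F x `^ s)%:E| = \int[mu]_x (F x `^ s)%:E)%E; last first.
  by apply: eq_integral => x _; rewrite gee0_abs// lee_fin powR_ge0.
rewrite (ae_eq_integral_abs _ measurableT mFs); split.
  by apply: filterS => x /(_ I) [] /eqP; rewrite powR_eq0 s0 andbT => /eqP.
by apply: filterS => x Fx0 _; rewrite Fx0 powR0.
Qed.

(** * The lower bound for fixed points with the Yukawa kernel *)

Section YukawaFixpoint.
Context {R : realType}.
Local Notation T := (space3 R).
Local Notation vol := (@vol R).

Definition yukawa_kernel (alpha : R) (z : T * T) : R := yukawa alpha (dist3 z.1 z.2).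

Lemma measurable_yukawa_kernel alpha : measurable_fun setT (yukawa_kernel alpha).
Proof. exact: (measurableT_comp (measurable_yukawa alpha) measurable_pair_dist3). Qed.

Lemma yukawa_kernel_ge0 alpha z : 0 <= yukawa_kernel alpha z.
Proof. by rewrite yukawa_ge0 ?dist3_ge0. Qed.

(* The integral over space of the [m]-th power of the Yukawa kernel. *)
Definition yukawa_moment (alpha m : R) : R :=
  (4 * pi) `^ (- m) * (4 * pi * Gamma (3 - m) / (m * alpha) `^ (3 - m)).

Lemma yukawa_moment_gt0 alpha m : 0 < alpha -> 0 < m < 3 -> 0 < yukawa_moment alpha m.
Proof.
move=> a0 /andP[m0 m3]; have pi4 : 0 < 4 * pi :> R by rewrite mulr_gt0// pi_gt0.
rewrite mulr_gt0 ?powR_gt0// divr_gt0 ?powR_gt0 ?mulr_gt0 ?Gamma_gt0 ?pi_gt0//.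
by rewrite subr_gt0.
Qed.

Lemma integral_yukawa_kernel1 alpha m (x : T) : 0 < alpha -> 0 < m < 3 ->
  (\int[vol]_y (yukawa_kernel alpha (x, y) `^ m)%:E = (yukawa_moment alpha m)%:E)%E.
Proof.
move=> a0 m03; rewrite /yukawa_moment -(integral_yukawa_powR x a0 m03).
by apply: eq_integral => y _; rewrite /yukawa_kernel/= dist3C.
Qed.

Lemma integral_yukawa_kernel2 alpha m (y : T) : 0 < alpha -> 0 < m < 3 ->
  (\int[vol]_x (yukawa_kernel alpha (x, y) `^ m)%:E = (yukawa_moment alpha m)%:E)%E.
Proof. by move=> a0 m03; rewrite integral_yukawa_powR. Qed.

(** The integrability of the kernel at its singularity; with [r = gamma + 3/2] the hypothesis is
    [gamma > 0]. *)
Lemma conjugate_lt3 (r : R) : 3 / 2 < r -> 0 < r / (r - 1) < 3.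
Proof. by move=> r32; rewrite divr_gt0 ?ltr_pdivrMr//; lra. Qed.

(** If [p] is at least the exponent conjugate to [2 r], the kernel bound is applied with [P = p];
    otherwise the bootstrap first places [F] in that conjugate space, which becomes [P]. Positivity
    of the integral passes between exponents because it only says that [F] does not vanish almost
    everywhere. *)
Lemma yukawa_fixpoint_bound (A F : T -> R) (p p' r alpha N D : R) :
  1 < p -> p^-1 + p'^-1 = 1 -> 3 / 2 < r -> p <= 2 * r -> 0 < alpha ->
  measurable_fun setT A -> (forall x, 0 <= A x) ->
  measurable_fun setT F -> (forall x, 0 <= F x) ->
  (forall x, \int[vol]_y (expR (- (alpha / 2 * p' * dist3 x y)) * A y `^ p')%:E <= D%:E)%E ->
  (\int[vol]_x (A x `^ (2 * r))%:E = N%:E)%E ->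
  (0 < \int[vol]_x (F x `^ p)%:E)%E -> (\int[vol]_x (F x `^ p)%:E < +oo)%E ->
  {ae vol, forall x, ((F x)%:E <= (A x)%:E *
     potential (yukawa_kernel alpha) (fun y => A y * F y)%R x)%E} ->
  1 <= N * yukawa_moment alpha (r / (r - 1)) `^ (r - 1).
Proof.
move=> p1 pp' r32 p2r a0 mA A0 mF F0 kD AN I0 Ioo FU.
have r1 : 1 < r by lra.
have rc3 := conjugate_lt3 r32.
set M := yukawa_moment _ _.
have M0 : 0 < M by exact: yukawa_moment_gt0.
have N0 : 0 <= N.
  by rewrite -lee_fin -AN; apply: integral_ge0 => x _; rewrite lee_fin powR_ge0.
have [P [P1 P2r P2r' J0 Joo]] : exists P, [/\ 1 < P, P <= 2 * r, P <= (P - 1) * (2 * r),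
    (0 < \int[vol]_x (F x `^ P)%:E)%E & (\int[vol]_x (F x `^ P)%:E < +oo)%E].
  have [pr|pr] := leP p ((p - 1) * (2 * r)); first by exists p.
  pose P := 2 * r / (2 * r - 1); exists P.
  have r20 : 0 < 2 * r - 1 by lra.
  have pP : p < P by rewrite /P ltr_pdivlMr//; lra.
  have Joo : (\int[vol]_x (F x `^ P)%:E < +oo)%E.
    (* The decay is shared equally: [k1] keeps the singularity and half of the decay, [k2] the other
       half, which makes [A^p'] integrable. *)
    pose k1 := yukawa_kernel (alpha / 2).
    pose k2 (z : T * T) := expR (- (alpha / 2 * dist3 z.1 z.2)).
    apply: (@kernel_bootstrap R k1 k2 A F p p' r (yukawa_moment (alpha / 2) (r / (r - 1))) N D) => //.
    - exact: measurable_yukawa_kernel.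
    - by move=> z; exact: yukawa_kernel_ge0.
    - exact: (measurableT_comp (measurable_expR_scale _) measurable_pair_dist3).
    - by move=> z; exact: expR_ge0.
    - by move=> y; rewrite integral_yukawa_kernel2// divr_gt0.
    - move=> x; apply: le_trans (kD x); rewrite le_eqVlt; apply/orP; left; apply/eqP.
      apply: eq_integral => y _; rewrite /k2/= -expRM; congr (expR _ * _)%:E.
      by rewrite mulNr mulrAC.
    - by rewrite AN.
    apply: filterS FU => x; rewrite (_ : yukawa_kernel alpha = (fun z => k1 z * k2 z))//.
    apply/funext => z; rewrite /k1 /k2 /yukawa_kernel /yukawa [RHS]mulrAC -expRD.
    by congr (expR _ / _); lra.
  split => //.
  - by rewrite (lt_trans p1).
  - by rewrite /P ler_pdivrMr//; nra.
  - have -> : P - 1 = (2 * r - 1)^-1 by rewrite /P; field; rewrite gt_eqF.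
    by rewrite mulrC.
  rewrite lt_def integral_ge0 ?andbT; last by move=> x _; rewrite lee_fin powR_ge0.
  have P0 : P != 0 by rewrite gt_eqF// (lt_trans _ pP)// (lt_trans _ p1).
  have p0 : p != 0 by rewrite gt_eqF// (lt_trans _ p1).
  apply: contraTN I0 => /eqP/(integral_powR_eq0 _ P0 mF F0) F00; rewrite -leNgt.
  by rewrite (integral_powR_eq0 _ p0 mF F0).2.
have bound (N' : R) : 0 < N' -> N <= N' -> 1 <= N' * M `^ (r - 1).
  move=> N'0 NN'.
  apply: (@kernel_fixpoint_bound R (yukawa_kernel alpha) A F r P M N') => //.
  - exact: measurable_yukawa_kernel.
  - by move=> z; exact: yukawa_kernel_ge0.
  - by move=> x; rewrite integral_yukawa_kernel1.
  - by move=> x; rewrite integral_yukawa_kernel2.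
  - by rewrite AN lee_fin.
(* The kernel bound wants a positive upper bound for the integral. If [N = 0], the value
   [1/(2 M^(r - 1))] is admissible and yields the contradiction [1 <= 1/2]. *)
have [N00|Nn0] := eqVneq N 0; last by apply: bound => //; rewrite lt_def Nn0.
have Mr : 0 < M `^ (r - 1) by rewrite powR_gt0.
have := bound ((2 * M `^ (r - 1))^-1).
rewrite invr_gt0 mulr_gt0// N00 invr_ge0 ltW ?mulr_gt0// => /(_ isT isT).
by rewrite invfM -mulrA mulVf ?gt_eqF//; lra.
Qed.

End YukawaFixpoint.

(** * Regularised fundamental solutions *)

Section Flat.
Context {R : realType}.

(* The family is closed under differentiation (see [is_derive_flat]), which gives
   smoothness of [flat 0] at [0] without iterated derivatives. *)
Definition flat (n : nat) (t : R) : R :=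
  if 0 < t then t^-1 ^+ n * expR (- t^-1) else 0.

Lemma flat_ge0 n t : 0 <= flat n t.
Proof.
rewrite /flat; case: ifPn => // t0.
by rewrite mulr_ge0 ?expR_ge0 ?exprn_ge0 ?invr_ge0 ?ltW.
Qed.

(** With [u = 1/t] this is [u^n / n! <= exp u], a single term of the exponential series. *)
Lemma flat_le_fact n t : flat n t <= n`!%:R.
Proof.
rewrite /flat; case: ifPn => [t0|_]; last exact: ler0n.
have u0 : 0 <= t^-1 by rewrite invr_ge0 ltW.
rewrite expRN ler_pdivrMr ?expR_gt0//.
case: n => [|n]; first by rewrite expr0 fact0 mul1r -expR0 ler_expR.
rewrite -ler_pdivrMl ?ltr0n ?fact_gt0// mulrC.
by apply: le_trans (expR_ge1Dxn n u0); rewrite lerDr.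
Qed.

Lemma flat_shift n t : flat n t = flat n.+1 t * t.
Proof.
rewrite /flat; case: ifPn => [t0|_]; last by rewrite mul0r.
transitivity (t^-1 ^+ n * expR (- t^-1) * (t^-1 * t)).
  by rewrite mulVf ?mulr1// gt_eqF.
by rewrite exprS; ring.
Qed.

Lemma is_derive_flat n (t : R) :
  is_derive t 1 (flat n) (flat n.+2 t - n%:R * flat n.+1 t).
Proof.
have [t0|t0|->] := ltgtP t 0.
- have [-> ->] : flat n.+2 t = 0 /\ flat n.+1 t = 0 by rewrite /flat !ltNge (ltW t0).
  rewrite mulr0 subr0; apply: (@near_eq_is_derive _ _ _ (cst 0)).
    near=> u; rewrite /flat ltNge (ltW _)//; near: u; exact: lt_nbhsl.
- pose E (v : R) := v ^+ n * expR (- v).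
  have dV : is_derive t 1 (fun u : R => u^-1) (- t ^- 2).
    have := @is_deriveV R id t 1 1 (lt0r_neq0 t0) (is_derive_id _ _).
    by rewrite /GRing.scale/= mulr1.
  have dE (v : R) : is_derive v 1 E (n%:R * v ^+ n.-1 * expR (- v) - v ^+ n * expR (- v)).
    have XE : (id : R -> R) ^+ n = (fun t => t ^+ n).
      by apply/funext => u; rewrite exprfctE.
    have dX := @is_deriveX R R id n v 1 1 (is_derive_id _ _).
    rewrite XE /GRing.scale/= mulr1 in dX.
    have dexp : is_derive v 1 (fun v : R => expR (- v)) (- expR (- v)).
      by apply: is_derive_eq; rewrite mulrN1.
    have := is_deriveM dX dexp; rewrite /GRing.scale/= => h.
    by apply: is_derive_eq; rewrite /GRing.scale/=; ring.
  apply: (@near_eq_is_derive _ _ _ (E \o (fun u : R => u^-1))).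
    near=> u; rewrite /flat /E /= ifT//; near: u; exact: lt_nbhsr.
  apply: is_derive_eq (is_derive1_comp (dE _) dV) _.
  rewrite /flat t0 -exprVn; case: n {E dE} => [|n].
    by rewrite /= !expr0; ring.
  by rewrite /= !exprS; ring.
- have [-> ->] : flat n.+2 0 = 0 /\ flat n.+1 0 = 0 by rewrite /flat ltxx.
  (* At 0 the difference quotient of [flat n] is [flat n.+1], by [flat_shift]; one more shift bounds
     this by [(n + 2)! |z|], which tends to 0. *)
  rewrite mulr0 subr0; apply/is_derive1_caratheodory; exists (flat n.+1); split.
  + by move=> z; rewrite [flat n 0]/flat ltxx !subr0 -flat_shift.
  + have flat0 : flat n.+1 0 = 0 by rewrite /flat ltxx.
    apply/cvgrPdist_le => e e0; near=> z; rewrite flat0 sub0r normrN.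
    rewrite ger0_norm ?flat_ge0// flat_shift.
    apply: (@le_trans _ _ ((n.+2)`!%:R * `|z|)).
      rewrite [leLHS](_ : _ = flat n.+2 z * `|z|).
        by rewrite ler_wpM2r// flat_le_fact.
      by rewrite /flat; case: ifPn => z0; [rewrite gtr0_norm|rewrite !mul0r].
    rewrite -ler_pdivlMl ?ltr0n ?fact_gt0//.
    near: z; apply/nbhs_ballP; exists ((n.+2)`!%:R^-1 * e) => /=.
      by rewrite mulr_gt0// invr_gt0 ltr0n fact_gt0.
    by move=> z; rewrite /ball/= sub0r normrN; exact: ltW.
  + by rewrite /flat ltxx.
Unshelve. all: by end_near. Qed.

End Flat.

(** * Smoothness of functions of the regularised distance *)

Section DirectionalDerivatives.
Context {R : realType} {V : normedModType R}.

Lemma is_derive_line (f : V -> R) (x v : V) (d : R) :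
  is_derive x v f d <-> is_derive (0 : R) 1 (fun t : R => f (t *: v + x)) d.
Proof.
have dE : 'D_v f x = 'D_1 (fun t : R => f (t *: v + x)) (0 : R).
  rewrite /derive; set g1 := fun h => h^-1 *: _; set g2 := fun h => h^-1 *: _.
  suff -> : g1 = g2 by [].
  apply/funext => h; rewrite /g1 /g2 /=.
  have -> : h *: (1 : R) = h by rewrite /GRing.scale/= mulr1.
  by rewrite scale0r add0r addr0.
split=> [[df <-]|[df <-]].
  by rewrite dE; exact: (DeriveDef ((derivable1P f x v).1 df)).
by rewrite -dE; exact: (DeriveDef ((derivable1P f x v).2 df)).
Qed.

Lemma is_derive_comp1 (h : R -> R) (s : V -> R) (x v : V) (h' d : R) :
  is_derive x v s d -> is_derive (s x) 1 h h' -> is_derive x v (h \o s) (h' * d).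
Proof.
move=> /is_derive_line ds dh; apply/is_derive_line.
have dh0 : is_derive ((fun t : R => s (t *: v + x)) 0) 1 h h'.
  by rewrite scale0r add0r.
exact: (is_derive1_comp dh0 ds).
Qed.

End DirectionalDerivatives.

Section TestFunctions.
Context {R : realType}.
Local Notation E := (R * R * R)%type.

Definition coord3 (i : 'I_3) (y : E) : R :=
  if i == 0 then y.1.1 else if i == 1 then y.1.2 else y.2.

Lemma coord3_basis (i j : 'I_3) : coord3 i (basis3 j) = (i == j)%:R :> R.
Proof.
by rewrite /coord3 /basis3; case: i => -[|[|[|//]]] ?; case: j => -[|[|[|//]]] ?.
Qed.

Lemma is_derive_coord3 (i : 'I_3) (x v : E) : is_derive x v (coord3 i) (coord3 i v).
Proof.
apply/is_derive_line.
rewrite (_ : (fun t => _) = (fun t : R => t * coord3 i v + coord3 i x)).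
  by apply: is_derive_eq; rewrite /GRing.scale/=; ring.
by apply/funext => t; rewrite /coord3; case: ifP => // _; case: ifP.
Qed.

Lemma continuous_coord3 (i : 'I_3) : continuous (coord3 i).
Proof.
have [i0|i0] := boolP (i == 0).
  rewrite (_ : coord3 i = fst \o fst); last by apply/funext => z; rewrite /coord3 i0.
  by move=> y; exact: (@continuous_comp _ _ _ fst fst _ cvg_fst cvg_fst).
have [i1|i1] := boolP (i == 1); last first.
  rewrite (_ : coord3 i = snd); first by move=> y; exact: cvg_snd.
  by apply/funext => z; rewrite /coord3 (negbTE i0) (negbTE i1).
rewrite (_ : coord3 i = snd \o fst); last first.
  by apply/funext => z; rewrite /coord3 (negbTE i0) i1.
move=> y; exact: (@continuous_comp _ _ _ fst snd _ cvg_fst cvg_snd).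
Qed.

Section Class.
Variables (S : (R -> R) -> Prop) (sg : E -> R) (x : E).
Hypothesis S_derive : forall h, S h -> exists2 h', S h' &
  forall s : R, 0 < s -> is_derive s 1 h (h' s).
Hypothesis sg_gt0 : forall y, 0 < sg y.
Hypothesis sg_continuous : continuous sg.
Hypothesis sg_derive : forall i y,
  is_derive y (basis3 i) sg (2 * (coord3 i y - coord3 i x)).

(* A class of functions on space containing its own partial derivatives; its
   members are therefore smooth. *)
Inductive radial_class : (E -> R) -> Prop :=
| radial_cst c : radial_class (fun=> c)
| radial_coord3 i : radial_class (coord3 i)
| radial_add f g : radial_class f -> radial_class g -> radial_class (fun y => f y + g y)
| radial_mul f g : radial_class f -> radial_class g -> radial_class (fun y => f y * g y)
| radial_comp h : S h -> radial_class (fun y => h (sg y)).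

Lemma radial_class_continuous f : radial_class f -> continuous f.
Proof.
elim=> [c|i|{}f g _ cf _ cg|{}f g _ cf _ cg|h /S_derive[h' _ dh]] y.
- exact: cvg_cst.
- exact: continuous_coord3.
- by apply: cvgD; [exact: cf|exact: cg].
- by apply: cvgM; [exact: cf|exact: cg].
- apply: (@continuous_comp _ _ _ sg h); first exact: sg_continuous.
  apply/differentiable_continuous/derivable1_diffP.
  by case: (dh _ (sg_gt0 y)).
Qed.

Lemma radial_class_derive f i : radial_class f -> exists2 g, radial_class g &
  forall y, is_derive y (basis3 i) f (g y).
Proof.
elim=> [c|j|{}f g _ [f' Cf' df] _ [g' Cg' dg]|
    {}f g Cf [f' Cf' df] Cg [g' Cg' dg]|h /S_derive[h' Sh' dh]].
- by exists (fun=> 0); [exact: radial_cst|move=> y; exact: is_derive_cst].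
- exists (fun=> coord3 j (basis3 i)); first exact: radial_cst.
  by move=> y; exact: is_derive_coord3.
- exists (fun y => f' y + g' y); first exact: radial_add.
  by move=> y; exact: is_deriveD.
- exists (fun y => f y * g' y + g y * f' y).
    by apply: radial_add; exact: radial_mul.
  by move=> y; exact: is_deriveM.
- exists (fun y => h' (sg y) * (2 * (coord3 i y + - coord3 i x))).
    apply: radial_mul; first exact: radial_comp.
    apply: radial_mul; first exact: radial_cst.
    by apply: radial_add; [exact: radial_coord3|exact: radial_cst].
  by move=> y; exact: (is_derive_comp1 (sg_derive _ _) (dh _ (sg_gt0 _))).
Qed.

Lemma radial_class_smooth f : radial_class f -> smooth f.
Proof.
move=> Cf s; suff Cs : radial_class (iter_partial s f).
  split; first exact: radial_class_continuous.
  by move=> i y; have [g _ /(_ y)[]] := radial_class_derive i Cs.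
elim: s => [//|i s Cs] /=; have [g Cg dg] := radial_class_derive i Cs.
rewrite (_ : partial i _ = g)//; apply/funext => y.
by rewrite /partial; case: (dg y).
Qed.

End Class.
End TestFunctions.

(** * Radial profile of the fundamental solution, and its cutoff *)

Section YukawaProfile.
Context {R : realType}.
Variables (a b : R).

(* The real part of [(p - i q) exp (- (a - i b) rho)]; [rot1], [rot2] multiply
   [p - i q] by [a - i b], so that differentiating stays inside the family. *)
Definition dexp (p q rho : R) : R :=
  expR (- (a * rho)) * (p * cos (b * rho) + q * sin (b * rho)).

Definition rot1 (p q : R) : R := a * p - b * q.
Definition rot2 (p q : R) : R := a * q + b * p.

Lemma is_derive_dexp p q (rho : R) :
  is_derive rho 1 (dexp p q) (- dexp (rot1 p q) (rot2 p q) rho).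
Proof.
have dl (c : R) : is_derive rho 1 (fun t => c * t) c.
  by apply: is_derive_eq; rewrite /GRing.scale/= mulr1.
have de : is_derive rho 1 (fun t => expR (- (a * t))) (- a * expR (- (a * rho))).
  have dn : is_derive rho 1 (fun t => - (a * t)) (- a).
    exact: is_deriveN (dl a).
  have := @is_derive1_comp _ expR (fun t => - (a * t)) _ _ _ (is_derive_expR _) dn.
  by rewrite mulrC.
have dc : is_derive rho 1 (fun t => cos (b * t)) (- b * sin (b * rho)).
  have := @is_derive1_comp _ cos (fun t => b * t) _ _ _ (is_derive_cos _) (dl b).
  by rewrite mulrC mulrN mulNr.
have ds : is_derive rho 1 (fun t => sin (b * t)) (b * cos (b * rho)).
  have := @is_derive1_comp _ sin (fun t => b * t) _ _ _ (is_derive_sin _) (dl b).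
  by rewrite mulrC.
have dpq : is_derive rho 1 (fun t => p * cos (b * t) + q * sin (b * t))
    (p * (- b * sin (b * rho)) + q * (b * cos (b * rho))).
  exact: is_deriveD (is_deriveZ p dc) (is_deriveZ q ds).
have := is_deriveM de dpq; rewrite /GRing.scale/= => h.
by apply: (is_derive_eq h); rewrite /dexp /rot1 /rot2; ring.
Qed.

(* In the variable [s = rho ^+ 2], [prof0] is the fundamental solution
   [exp (- (a - i b) rho) / (4 pi rho)] (real part, after multiplication by
   [p - i q]); [prof1] and [prof2] are its derivatives in [s]. *)
Definition prof0 (p q s : R) : R := dexp p q (Num.sqrt s) / Num.sqrt s / (4 * pi).
Definition prof1 (p q s : R) : R :=
  - (dexp (rot1 p q) (rot2 p q) (Num.sqrt s) / Num.sqrt s ^+ 2 +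
     dexp p q (Num.sqrt s) / Num.sqrt s ^+ 3) / (8 * pi).
Definition prof2 (p q s : R) : R :=
  (dexp (rot1 (rot1 p q) (rot2 p q)) (rot2 (rot1 p q) (rot2 p q)) (Num.sqrt s) /
     Num.sqrt s ^+ 3 +
   3 * dexp (rot1 p q) (rot2 p q) (Num.sqrt s) / Num.sqrt s ^+ 4 +
   3 * dexp p q (Num.sqrt s) / Num.sqrt s ^+ 5) / (16 * pi).

Lemma is_derive_exprV (n : nat) (rho : R) : rho != 0 ->
  is_derive rho 1 (fun t : R => (t ^+ n)^-1) (- n%:R / rho ^+ n.+1).
Proof.
move=> rho0.
have XE : (id : R -> R) ^+ n = (fun t => t ^+ n).
  by apply/funext => u; rewrite exprfctE.
have dX := @is_deriveX R R id n rho 1 1 (is_derive_id _ _).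
rewrite XE /GRing.scale/= mulr1 in dX.
have := @is_deriveV _ (fun t => t ^+ n) _ _ _ (expf_neq0 n rho0) dX; rewrite /GRing.scale/= => h.
apply: (is_derive_eq h).
by case: n {XE dX h} => [|n] /=; rewrite ?exprS; field; rewrite ?expf_neq0 ?rho0.
Qed.

Lemma is_derive_sqrt_comp (G : R -> R) (g s : R) : 0 < s ->
  is_derive (Num.sqrt s) 1 G g ->
  is_derive s 1 (fun s => G (Num.sqrt s)) (g / (2 * Num.sqrt s)).
Proof. by move=> s0 dG; exact: (is_derive1_comp dG (is_derive1_sqrt s0)). Qed.

Lemma is_derive_prof0 p q (s : R) : 0 < s -> is_derive s 1 (prof0 p q) (prof1 p q s).
Proof.
move=> s0; have r0 : Num.sqrt s != 0 by rewrite gt_eqF ?sqrtr_gt0.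
have pi0 : (pi : R) != 0 by rewrite gt_eqF ?pi_gt0.
have dV := is_derive_exprV 1 r0.
have dG := is_deriveM (is_derive_dexp p q (Num.sqrt s)) dV.
have := is_deriveZ (4 * pi)^-1 (is_derive_sqrt_comp s0 dG).
rewrite /GRing.scale/= => h.
have -> : prof0 p q = fun s => (4 * pi)^-1 * (dexp p q (Num.sqrt s) * (Num.sqrt s ^+ 1)^-1).
  by apply/funext => t; rewrite /prof0 mulrC.
apply: (is_derive_eq h); rewrite /prof1.
move: (Num.sqrt s) (pi) r0 pi0 (dexp _ _ _) (dexp _ _ _) => r P r0 P0 u v.
by clear -r0 P0; field; rewrite r0 P0.
Qed.

Lemma is_derive_prof1 p q (s : R) : 0 < s -> is_derive s 1 (prof1 p q) (prof2 p q s).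
Proof.
move=> s0; have r0 : Num.sqrt s != 0 by rewrite gt_eqF ?sqrtr_gt0.
have pi0 : (pi : R) != 0 by rewrite gt_eqF ?pi_gt0.
have dG : is_derive (Num.sqrt s) 1
    (fun r => dexp (rot1 p q) (rot2 p q) r * (r ^+ 2)^-1 + dexp p q r * (r ^+ 3)^-1)
    _ := is_deriveD
  (is_deriveM (is_derive_dexp (rot1 p q) (rot2 p q) (Num.sqrt s)) (is_derive_exprV 2 r0))
  (is_deriveM (is_derive_dexp p q (Num.sqrt s)) (is_derive_exprV 3 r0)).
have := is_deriveZ (- (8 * pi)^-1) (is_derive_sqrt_comp s0 dG).
rewrite /GRing.scale/= => h.
have -> : prof1 p q = fun s => - (8 * pi)^-1 *
   (dexp (rot1 p q) (rot2 p q) (Num.sqrt s) * (Num.sqrt s ^+ 2)^-1 +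
    dexp p q (Num.sqrt s) * (Num.sqrt s ^+ 3)^-1).
  by apply/funext => t; rewrite /prof1 mulNr mulrC mulNr.
apply: (is_derive_eq h); rewrite /prof2.
move: (Num.sqrt s) (pi) r0 pi0 (dexp _ _ _) (dexp _ _ _) (dexp _ _ _) => r P r0 P0 u v w.
by clear -r0 P0; field; rewrite r0 P0.
Qed.

(** In dimension three the Laplacian of a function [F] of [s = |y - x|^2] is [4 s F'' + 6 F']. The
    identity is the radial Helmholtz equation: two rotations multiply [p - i q] by [(a - i b)^2]. *)
Lemma prof_ode p q (s : R) : 0 < s ->
  4 * s * prof2 p q s + 6 * prof1 p q s =
  prof0 (rot1 (rot1 p q) (rot2 p q)) (rot2 (rot1 p q) (rot2 p q)) s.
Proof.
move=> s0; have r0 : Num.sqrt s != 0 by rewrite gt_eqF ?sqrtr_gt0.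
have pi0 : (pi : R) != 0 by rewrite gt_eqF ?pi_gt0.
rewrite /prof0 /prof1 /prof2 -{1}(sqr_sqrtr (ltW s0)).
move: (Num.sqrt s) (pi) r0 pi0 (dexp _ _ _) (dexp _ _ _) (dexp _ _ _) => r P r0 P0 u v w.
by clear -r0 P0; field; rewrite r0 P0.
Qed.

End YukawaProfile.

Section ProfileClass.
Context {R : realType}.
Variables (a b e : R).

(* Equal to [1] at [s = e ^+ 2], the value taken at the singularity, and
   supported in [s <= e ^+ 2 + e ^- 2]. *)
Definition cutoff (s : R) : R := expR 1 * flat 0 (1 + e ^+ 4 - e ^+ 2 * s).
Definition cutoff1 (s : R) : R := - e ^+ 2 * (expR 1 * flat 2 (1 + e ^+ 4 - e ^+ 2 * s)).
Definition cutoff2 (s : R) : R :=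
  e ^+ 4 * (expR 1 * (flat 4 (1 + e ^+ 4 - e ^+ 2 * s) -
                      2 * flat 3 (1 + e ^+ 4 - e ^+ 2 * s))).

Lemma is_derive_flat_line n (s : R) :
  is_derive s 1 (fun s => flat n (1 + e ^+ 4 - e ^+ 2 * s))
    (- e ^+ 2 * (flat n.+2 (1 + e ^+ 4 - e ^+ 2 * s) -
                 n%:R * flat n.+1 (1 + e ^+ 4 - e ^+ 2 * s))).
Proof.
have dl : is_derive s 1 (fun s => 1 + e ^+ 4 - e ^+ 2 * s) (- e ^+ 2).
  have := is_deriveB (is_derive_cst (1 + e ^+ 4) s 1) (is_deriveZ (e ^+ 2) (is_derive_id s 1)).
  by rewrite /GRing.scale/= mulr1 sub0r.
have := @is_derive1_comp _ (flat n) _ _ _ _ (is_derive_flat n _) dl.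
by rewrite mulrC.
Qed.

Lemma is_derive_cutoff (s : R) : is_derive s 1 cutoff (cutoff1 s).
Proof.
have := is_deriveZ (expR 1) (is_derive_flat_line 0 s).
rewrite /GRing.scale/= => h; apply: (is_derive_eq h).
by rewrite /cutoff1 mul0r subr0; ring.
Qed.

Lemma is_derive_cutoff1 (s : R) : is_derive s 1 cutoff1 (cutoff2 s).
Proof.
have := is_deriveZ (- e ^+ 2 * expR 1) (is_derive_flat_line 2 s).
rewrite /GRing.scale/= => h.
have -> : cutoff1 = (fun s => - e ^+ 2 * expR 1 * flat 2 (1 + e ^+ 4 - e ^+ 2 * s)).
  by apply/funext => u; rewrite /cutoff1 mulrA.
by apply: (is_derive_eq h); rewrite /cutoff2; ring.
Qed.

(** These functions are the class [S] required by [radial_class]: they are closed under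
    differentiation on positive arguments, which gives smoothness of the bump, and the same
    induction gives measurability. *)
Inductive profile : (R -> R) -> Prop :=
| profile_cst c : profile (fun=> c)
| profile_id : profile (fun s => s)
| profile_sqrtV : profile (fun s => (Num.sqrt s)^-1)
| profile_dexp p q : profile (fun s => dexp a b p q (Num.sqrt s))
| profile_flat n : profile (fun s => flat n (1 + e ^+ 4 - e ^+ 2 * s))
| profile_add f g : profile f -> profile g -> profile (fun s => f s + g s)
| profile_mul f g : profile f -> profile g -> profile (fun s => f s * g s).

Lemma profile_derive h : profile h -> exists2 h', profile h' &
  forall s : R, 0 < s -> is_derive s 1 h (h' s).
Proof.
elim=> [c| | |p q|n|f g Pf [f' Pf' df] Pg [g' Pg' dg]|f g Pf [f' Pf' df] Pg [g' Pg' dg]].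
- by exists (fun=> 0); [exact: profile_cst|move=> s _; exact: is_derive_cst].
- by exists (fun=> 1); [exact: profile_cst|move=> s _; exact: is_derive_id].
- exists (fun s => - 2^-1 * ((Num.sqrt s)^-1 * ((Num.sqrt s)^-1 * (Num.sqrt s)^-1))).
    by do ![exact: profile_cst|exact: profile_sqrtV|apply: profile_mul].
  move=> s s0; have r0 : Num.sqrt s != 0 by rewrite gt_eqF ?sqrtr_gt0.
  apply: is_derive_eq (is_derive_sqrt_comp s0 (is_derive_exprV 1 r0)) _.
  by move: (Num.sqrt s) r0 => r r0; field.
- exists (fun s => (- 2^-1) * (dexp a b (rot1 a b p q) (rot2 a b p q) (Num.sqrt s) * (Num.sqrt s)^-1)).
    by do ![exact: profile_cst|exact: profile_sqrtV|exact: profile_dexp|apply: profile_mul].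
  move=> s s0; have r0 : Num.sqrt s != 0 by rewrite gt_eqF ?sqrtr_gt0.
  apply: is_derive_eq (is_derive_sqrt_comp s0 (is_derive_dexp a b p q _)) _.
  by move: (dexp _ _ _ _ _) => d; move: (Num.sqrt s) r0 => r r0; field.
- exists (fun s => - e ^+ 2 * (flat n.+2 (1 + e ^+ 4 - e ^+ 2 * s) +
                 - n%:R * flat n.+1 (1 + e ^+ 4 - e ^+ 2 * s))).
    apply: profile_mul; first exact: profile_cst.
    apply: profile_add; first exact: profile_flat.
    by apply: profile_mul; [exact: profile_cst|exact: profile_flat].
  by move=> s _; rewrite mulNr; exact: is_derive_flat_line.
- exists (fun s => f' s + g' s); first exact: profile_add.
  by move=> s s0; have := df s s0; have := dg s s0 => ? ?; exact: is_deriveD.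
- exists (fun s => f s * g' s + g s * f' s).
    by apply: profile_add; exact: profile_mul.
  by move=> s s0; have := df s s0; have := dg s s0 => ? ?; exact: is_deriveM.
Qed.

Lemma profile_measurable h : profile h -> measurable_fun setT h.
Proof.
elim=> [c| | |p q|n|f g _ mf _ mg|f g _ mf _ mg].
- exact: measurable_cst.
- exact: measurable_id.
- exact/measurable_inv_fun/measurable_sqrt_comp.
- apply: (@measurableT_comp _ _ _ _ _ _ (dexp a b p q)).
    apply: continuous_measurable_fun => t.
    by apply/differentiable_continuous/derivable1_diffP; case: (is_derive_dexp a b p q t).
  exact: measurable_sqrt_comp.
- apply: continuous_measurable_fun => t.
  by apply/differentiable_continuous/derivable1_diffP; case: (is_derive_flat_line n t).
- exact: measurable_funD.
- exact: measurable_funM.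
Qed.

Definition bump0 p q (s : R) : R := cutoff s * prof0 a b p q s.
Definition bump1 p q (s : R) : R := cutoff1 s * prof0 a b p q s + cutoff s * prof1 a b p q s.
Definition bump2 p q (s : R) : R :=
  cutoff2 s * prof0 a b p q s + 2 * cutoff1 s * prof1 a b p q s + cutoff s * prof2 a b p q s.

Lemma profile_bump0 p q : profile (bump0 p q).
Proof.
rewrite (_ : bump0 p q = fun s => (expR 1 * flat 0 (1 + e ^+ 4 - e ^+ 2 * s)) *
   (dexp a b p q (Num.sqrt s) * (Num.sqrt s)^-1 * (4 * pi)^-1))//.
by do ![exact: profile_cst|exact: profile_sqrtV|exact: profile_dexp|
        exact: profile_flat|apply: profile_mul].
Qed.

Lemma is_derive_bump0 p q (s : R) : 0 < s ->
  is_derive s 1 (bump0 p q) (bump1 p q s).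
Proof.
move=> s0; have h := is_deriveM (is_derive_cutoff s) (is_derive_prof0 a b p q s0).
by apply: (is_derive_eq h); rewrite /bump1 /GRing.scale/=; ring.
Qed.

Lemma is_derive_bump1 p q (s : R) : 0 < s ->
  is_derive s 1 (bump1 p q) (bump2 p q s).
Proof.
move=> s0; have h := is_deriveD (is_deriveM (is_derive_cutoff1 s) (is_derive_prof0 a b p q s0))
  (is_deriveM (is_derive_cutoff s) (is_derive_prof1 a b p q s0)).
by apply: (is_derive_eq h); rewrite /bump2 /GRing.scale/=; ring.
Qed.

End ProfileClass.

Section TestFunctionPartial.
Context {R : realType}.
Local Notation E := (R * R * R)%type.

(** The complement of a compact set is open, so outside it the function vanishes on a neighbourhood
    and so does its derivative; the same compact set serves. *)
Lemma test_function_partial (i : 'I_3) (f : E -> R) :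
  test_function f -> test_function (partial i f).
Proof.
move=> [sf [K cK f0]]; split.
  by move=> s; have := sf (rcons s i); rewrite /iter_partial foldr_rcons.
exists K => // x Kx.
have oK : open (~` K).
  apply: closed_openC; apply: compact_closed cK.
  exact: (@norm_hausdorff _ E).
rewrite /partial (@near_eq_derive _ _ _ f (cst 0)) ?derive_cst//.
by near=> y; apply: f0; near: y; exact: open_nbhs_nbhs.
Unshelve. all: by end_near. Qed.

End TestFunctionPartial.

Section Bump.
Context {R : realType}.
Local Notation E := (R * R * R)%type.
Variables (a b e : R) (x : E).
Hypothesis e0 : 0 < e.

Definition sqdist (y : E) : R := \sum_(i < 3) (coord3 i y - coord3 i x) ^+ 2 + e ^+ 2.

Lemma sqdist_gt0 y : 0 < sqdist y.
Proof. by rewrite ltr_wpDl ?exprn_gt0// sumr_ge0// => i _; exact: sqr_ge0. Qed.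

Lemma sqdist_continuous : continuous sqdist.
Proof.
rewrite (_ : sqdist = fun y => (coord3 0 y - coord3 0 x) * (coord3 0 y - coord3 0 x) +
  ((coord3 1 y - coord3 1 x) * (coord3 1 y - coord3 1 x) +
   (coord3 2 y - coord3 2 x) * (coord3 2 y - coord3 2 x)) + e ^+ 2); last first.
  apply/funext => y; rewrite /sqdist !big_ord_recl big_ord0 addr0 !expr2.
  by congr (_ * _ + (_ * _ + _ * _) + _).
have c i : continuous (fun y : E => coord3 i y - coord3 i x).
  by move=> y; apply: cvgB; [exact: continuous_coord3|exact: cvg_cst].
have c2 i : continuous (fun y : E => (coord3 i y - coord3 i x) * (coord3 i y - coord3 i x)).
  by move=> y; apply: cvgM; exact: c.
move=> y; apply: cvgD; last exact: cvg_cst.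
by apply: cvgD; [exact: c2|apply: cvgD; exact: c2].
Qed.

Lemma sqdist_derive i y :
  is_derive y (basis3 i) sqdist (2 * (coord3 i y - coord3 i x)).
Proof.
have d j : is_derive y (basis3 i) (fun y : E => (coord3 j y - coord3 j x) ^+ 2)
    (2 * (coord3 j y - coord3 j x) * (j == i)%:R).
  have dl : is_derive y (basis3 i) (fun y : E => coord3 j y - coord3 j x) (j == i)%:R.
    have := is_deriveB (is_derive_coord3 j y (basis3 i)) (is_derive_cst (coord3 j x) y _).
    by rewrite subr0 coord3_basis.
  have := is_deriveM dl dl; rewrite /GRing.scale/= => h.
  rewrite (_ : (fun _ => _) = (fun y : E => coord3 j y - coord3 j x) * (fun y : E => coord3 j y - coord3 j x)).
    by apply: (is_derive_eq h); ring.
  by apply/funext => z; rewrite expr2.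
have h := is_deriveD (is_deriveD (d 0) (is_deriveD (d 1) (d 2))) (is_derive_cst (e ^+ 2) y (basis3 i)).
rewrite (_ : sqdist = (fun y : E => (coord3 0 y - coord3 0 x) ^+ 2) + ((fun y : E => (coord3 1 y - coord3 1 x) ^+ 2) +
   (fun y : E => (coord3 2 y - coord3 2 x) ^+ 2)) + cst (e ^+ 2)); last first.
  apply/funext => z; rewrite /sqdist !big_ord_recl big_ord0 addr0.
  by congr (_ ^+ 2 + (_ ^+ 2 + _ ^+ 2) + _).
apply: (is_derive_eq h).
by case: i {d h} => -[|[|[|//]]] ? /=; rewrite !(mulr0, mulr1, addr0, add0r); congr (_ * (coord3 _ _ - coord3 _ _)); apply/val_inj.
Qed.

Definition bump p q (y : E) : R := bump0 a b e p q (sqdist y).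

Lemma bump_smooth p q : smooth (bump p q).
Proof.
apply: (@radial_class_smooth _ (profile a b e) sqdist x).
- by move=> h Ph; exact: profile_derive.
- exact: sqdist_gt0.
- exact: sqdist_continuous.
- exact: sqdist_derive.
- by apply: radial_comp; exact: profile_bump0.
Qed.

Lemma bump_test p q : test_function (bump p q).
Proof.
split; first exact: bump_smooth.
(* The cutoff vanishes from [s = e^-2 + e^2 = M - 1] on. Inside, each squared coordinate difference
   is at most [M - 1 <= M^2], so a cube of half-side [M] contains the support. *)
pose M := 1 + (e ^+ 2)^-1 + e ^+ 2.
pose I i : set R := [set` `[coord3 i x - M, coord3 i x + M]].
exists ((I 0 `*` I 1) `*` I 2).
  by apply: compact_setX; [apply: compact_setX|]; exact: segment_compact.
move=> y Iy; rewrite /bump /bump0 /cutoff /flat ltNge.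
case: leP; rewrite ?mulr0 ?mul0r// => lt.
exfalso; apply: Iy.
have e2 : 0 < e ^+ 2 by rewrite exprn_gt0.
have sM : sqdist y < M - 1.
  rewrite -(ltr_pM2l e2); move: lt; rewrite subr_gt0 => /lt_le_trans; apply.
    have -> : M - 1 = (e ^+ 2)^-1 + e ^+ 2 by rewrite /M; ring.
  by rewrite mulrDr mulfV ?gt_eqF// -exprD.
have cM i : coord3 i y \in `[coord3 i x - M, coord3 i x + M].
  rewrite in_itv/= -ler_distl -(@ler_pXn2r _ 2)// ?nnegrE ?normr_ge0//; last first.
    by rewrite /M addrAC addr_ge0 ?invr_ge0 ?ltW// addr_gt0.
  rewrite real_normK ?num_real//.
  have : (coord3 i y - coord3 i x) ^+ 2 <= sqdist y.
    rewrite /sqdist (bigD1 i)//= -addrA lerDl addr_ge0 ?(ltW e2)//.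
    by apply: sumr_ge0 => j _; exact: sqr_ge0.
  have : 1 <= M by rewrite /M -addrA lerDl addr_ge0 ?invr_ge0 ?ltW.
  move: sM; clear; move: (sqdist y) (_ ^+ 2) => s u; nra.
by split; [split|]; [exact: (cM 0)|exact: (cM 1)|exact: (cM 2)].
Qed.

Lemma partial_bump p q i :
  partial i (bump p q) = fun y => 2 * (coord3 i y - coord3 i x) * bump1 a b e p q (sqdist y).
Proof.
apply/funext => y; rewrite /partial.
have h := is_derive_comp1 (sqdist_derive i y) (is_derive_bump0 a b e p q (sqdist_gt0 y)).
by rewrite /bump; case: h => _ ->; rewrite mulrC.
Qed.

Lemma partial_partial_bump p q i y : partial i (partial i (bump p q)) y =
  2 * bump1 a b e p q (sqdist y) +
  4 * (coord3 i y - coord3 i x) ^+ 2 * bump2 a b e p q (sqdist y).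
Proof.
rewrite partial_bump /partial.
have dl : is_derive y (basis3 i) (fun y : E => 2 * (coord3 i y - coord3 i x)) 2.
  have := is_deriveZ 2 (is_deriveB (is_derive_coord3 i y (basis3 i)) (is_derive_cst (coord3 i x) y _)).
  by rewrite subr0 coord3_basis eqxx /GRing.scale/= mulr1.
have h := is_deriveM dl (is_derive_comp1 (sqdist_derive i y) (is_derive_bump1 a b e p q (sqdist_gt0 y))).
case: h => _ ->; rewrite /GRing.scale/=; move: (bump1 _ _ _ _ _ _) (bump2 _ _ _ _ _ _) => u v.
by ring.
Qed.

(* The regularised fundamental solution fails the Helmholtz equation by [residue]:
   this is the approximation of the Dirac mass. *)
Definition residue p q (s : R) : R := cutoff e s * prof0 a b
  (rot1 a b (rot1 a b p q) (rot2 a b p q)) (rot2 a b (rot1 a b p q) (rot2 a b p q)) s -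
  (6 * bump1 a b e p q s + 4 * (s - e ^+ 2) * bump2 a b e p q s).

(** The squared coordinate differences add up to [s - e^2], so the second derivatives sum to
    [6 bump1 + 4 (s - e^2) bump2]; by definition [residue] is what separates this from the rotated
    bump. *)
Lemma laplacian_bump p q y :
  \sum_(i < 3) partial i (partial i (bump p q)) y =
  bump (rot1 a b (rot1 a b p q) (rot2 a b p q)) (rot2 a b (rot1 a b p q) (rot2 a b p q)) y -
  residue p q (sqdist y).
Proof.
under eq_bigr do rewrite partial_partial_bump.
rewrite big_split/= sumr_const card_ord -mulr_suml -mulr_sumr /residue /bump /bump0.
have -> : \sum_(i < 3) (coord3 i y - coord3 i x) ^+ 2 = sqdist y - e ^+ 2.
  by rewrite /sqdist addrK.
move: (bump1 _ _ _ _ _ _) (bump2 _ _ _ _ _ _) (cutoff _ _ * _) (_ - e ^+ 2) => u v w s.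
by rewrite -mulr_natr; ring.
Qed.

End Bump.

(** * The residue as an approximate identity *)

Section Lipschitz.
Context {R : realType}.

Lemma lipschitz_of_derive (f f' : R -> R) (K x y : R) : x <= y ->
  (forall t : R, is_derive t 1 f (f' t)) ->
  (forall t, x <= t <= y -> `|f' t| <= K) -> `|f y - f x| <= K * (y - x).
Proof.
rewrite le_eqVlt => /predU1P[->|xy] df bf; first by rewrite !subrr normr0 mulr0.
have cf : {within `[x, y], continuous f}.
  apply: continuous_subspaceT => t.
  by apply/differentiable_continuous/derivable1_diffP; case: (df t).
have [c /[!in_itv]/= cxy ->] := MVT xy (fun t _ => df t) cf.
have yx : 0 <= y - x by rewrite subr_ge0 ltW.
rewrite normrM (ger0_norm yx) (ler_wpM2r yx)// bf//.
by case/andP: cxy => /ltW -> /ltW ->.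
Qed.

Lemma poly1_le_expR (c t : R) : 0 < c -> 0 <= t -> 1 + t <= (1 + c^-1) * expR (c * t).
Proof.
move=> c0 t0; have c1 : 0 < c^-1 by rewrite invr_gt0.
apply: (@le_trans _ _ ((1 + c^-1) * (1 + c * t))).
  have -> : (1 + c^-1) * (1 + c * t) = 1 + t + (c^-1 + c * t) by field; rewrite gt_eqF.
  by rewrite lerDl addr_ge0 ?mulr_ge0// ltW.
by rewrite ler_wpM2l ?expR_ge1Dx// addr_ge0 ?ltW.
Qed.

End Lipschitz.

Section ResidueEstimates.
Context {R : realType}.
Variables (a b : R).
Hypothesis a0 : 0 < a.

Lemma dexp_norm p q (rho : R) :
  `|dexp a b p q rho| <= (`|p| + `|q|) * expR (- (a * rho)).
Proof.
rewrite /dexp normrM (ger0_norm (expR_ge0 _)) mulrC ler_wpM2r ?expR_ge0//.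
apply: (le_trans (ler_normD _ _)); rewrite !normrM lerD// ler_piMr//.
  by rewrite ler_norml cos_geN1 cos_le1.
by rewrite ler_norml sin_geN1 sin_le1.
Qed.

Lemma dexp_lipschitz p q (rho : R) : 0 <= rho ->
  `|dexp a b p q rho - p| <= (`|rot1 a b p q| + `|rot2 a b p q|) * rho.
Proof.
move=> rho0; have d0 : dexp a b p q 0 = p.
  by rewrite /dexp !mulr0 oppr0 expR0 cos0 sin0 mulr1 mulr0 addr0 mul1r.
rewrite -[X in `|_ - X|]d0 -[X in _ <= _ * X]subr0.
apply: (lipschitz_of_derive rho0 (is_derive_dexp a b p q)) => t /andP[t0 _].
rewrite normrN; apply: (le_trans (dexp_norm _ _ _)).
rewrite ler_piMr ?addr_ge0//.
by rewrite -[leRHS]expR0 ler_expR oppr_le0 mulr_ge0// ltW.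
Qed.

(* Minus the Laplacian of [1 / (4 pi Num.sqrt (r ^+ 2 + e ^+ 2))], an approximate
   identity of total mass [1]. *)
Definition approx (e r : R) : R := 3 * e ^+ 2 / (4 * pi * Num.sqrt (r ^+ 2 + e ^+ 2) ^+ 5).

(** The factor left when [4 e^2 prof2] is divided by [approx]. Its value at 0 is [p], so
    [approx * moment] concentrates like [p] times an approximate identity. *)
Definition moment p q (rho : R) : R :=
  dexp a b p q rho + rho * dexp a b (rot1 a b p q) (rot2 a b p q) rho +
  rho ^+ 2 / 3 * dexp a b (rot1 a b (rot1 a b p q) (rot2 a b p q))
                       (rot2 a b (rot1 a b p q) (rot2 a b p q)) rho.

(** The terms of [residue] in which a derivative falls on the cutoff; each carries at least the
    factor [e^2]. *)
Definition bump_error e p q (s : R) : R :=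
  4 * (s - e ^+ 2) * (cutoff2 e s * prof0 a b p q s + 2 * cutoff1 e s * prof1 a b p q s) +
  6 * cutoff1 e s * prof0 a b p q s.

(** By the product rule, the terms without derivatives of the cutoff would cancel by [prof_ode] if
    the coefficient of [prof2] were [4 s]. It is [4 (s - e^2)], so [4 e^2 prof2] remains, and this
    is [approx * moment]. *)
Lemma residueE (e p q r : R) : 0 < e ->
  residue a b e p q (r ^+ 2 + e ^+ 2) =
  approx e r * (cutoff e (r ^+ 2 + e ^+ 2) * moment p q (Num.sqrt (r ^+ 2 + e ^+ 2))) -
  bump_error e p q (r ^+ 2 + e ^+ 2).
Proof.
move=> e0; have s0 : 0 < r ^+ 2 + e ^+ 2 by rewrite ltr_wpDl ?sqr_ge0 ?exprn_gt0.
have r0 : Num.sqrt (r ^+ 2 + e ^+ 2) != 0 by rewrite gt_eqF ?sqrtr_gt0.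
have pi0 : (pi : R) != 0 by rewrite gt_eqF ?pi_gt0.
have m2 : approx e r * moment p q (Num.sqrt (r ^+ 2 + e ^+ 2)) =
    4 * e ^+ 2 * prof2 a b p q (r ^+ 2 + e ^+ 2).
  rewrite /approx /moment /prof2.
  move: (Num.sqrt _) r0 pi0 (dexp _ _ _ _ _) (dexp _ _ _ _ _) (dexp _ _ _ _ _).
  move=> rho rho0 pi0 u v w; move: (pi) pi0 => P P0; clear -rho0 P0.
  by field; rewrite rho0 P0.
rewrite mulrCA m2 /residue -(prof_ode a b p q s0) /bump_error /bump1 /bump2.
move: (cutoff _ _) (cutoff1 _ _) (cutoff2 _ _) (prof0 _ _ _ _ _) (prof1 _ _ _ _ _).
move: (prof2 _ _ _ _ _) => F2 c c1 c2 F F1.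
by ring.
Qed.

Lemma cutoff_start (e : R) : cutoff e (e ^+ 2) = 1.
Proof.
rewrite /cutoff -exprD addrK /flat ltr01 expr0 mul1r invr1 -expRD subrr.
exact: expR0.
Qed.

Lemma cutoff1_norm (e s : R) : `|cutoff1 e s| <= 2 * expR 1 * e ^+ 2.
Proof.
rewrite /cutoff1 normrM normrN (ger0_norm (sqr_ge0 _)) mulrC ler_wpM2r ?sqr_ge0//.
rewrite ger0_norm ?mulr_ge0 ?expR_ge0 ?flat_ge0// mulrC ler_wpM2r ?expR_ge0//.
exact: flat_le_fact.
Qed.

(** The constant is [4! + 2 * 3!], from [flat_le_fact]. *)
Lemma cutoff2_norm (e s : R) : `|cutoff2 e s| <= 36 * expR 1 * e ^+ 4.
Proof.
rewrite /cutoff2 normrM (ger0_norm (exprn_even_ge0 _ _))// mulrC ler_wpM2r ?exprn_even_ge0//.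
rewrite normrM (ger0_norm (expR_ge0 _)) mulrC ler_wpM2r ?expR_ge0//.
apply: (le_trans (ler_normB _ _)).
rewrite normrM !(ger0_norm (flat_ge0 _ _)) (ger0_norm (_ : 0 <= 2))//.
have := @flat_le_fact _ 4 (1 + e ^+ 4 - e ^+ 2 * s).
have := @flat_le_fact _ 3 (1 + e ^+ 4 - e ^+ 2 * s).
move: (flat _ _) (flat _ _) => u v /=.
rewrite (_ : 3 `! = 6)%N// (_ : 4 `! = 24)%N// => u1 v1; lra.
Qed.

Lemma cutoff_ge0 (e s : R) : 0 <= cutoff e s.
Proof. by rewrite mulr_ge0 ?expR_ge0 ?flat_ge0. Qed.

Lemma cutoff_le1 (e s : R) : e ^+ 2 <= s -> cutoff e s <= 1.
Proof.
move=> es; rewrite /cutoff /flat expr0 mul1r; case: ifP => t0; last by rewrite mulr0.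
rewrite -expRD -[leRHS]expR0 ler_expR subr_le0 invf_ge1//.
rewrite -addrA gerDl subr_le0 (_ : e ^+ 4 = e ^+ 2 * e ^+ 2) -?exprD//.
by rewrite exprD (ler_wpM2l (sqr_ge0 e)).
Qed.

Lemma cutoff_near (e s : R) : e ^+ 2 <= s ->
  `|cutoff e s - 1| <= 2 * expR 1 * e ^+ 2 * (s - e ^+ 2).
Proof.
move=> es; rewrite -[X in `|_ - X|](cutoff_start e).
apply: (lipschitz_of_derive es (is_derive_cutoff e)) => t _.
exact: cutoff1_norm.
Qed.

(** One constant for all estimates: it bounds the amplitudes of [dexp] after zero, one and two
    rotations. *)
Definition rot_bound (p q : R) : R :=
  `|p| + `|q| + (`|rot1 a b p q| + `|rot2 a b p q|) +
  (`|rot1 a b (rot1 a b p q) (rot2 a b p q)| + `|rot2 a b (rot1 a b p q) (rot2 a b p q)|).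

Lemma inv_pi_le1 : (pi : R)^-1 <= 1.
Proof. by rewrite invf_le1 ?pi_gt0// (le_trans _ (pi_ge2 R))// ler1n. Qed.

Lemma prof0_norm p q s :
  `|prof0 a b p q s| <= rot_bound p q * expR (- (a * Num.sqrt s)) * (Num.sqrt s)^-1.
Proof.
have i0 := inv_pi_le1; have p0 := pi_gt0 R.
have v0 : 0 <= (Num.sqrt s)^-1 by rewrite invr_ge0 sqrtr_ge0.
have w0 : 0 <= (4 * pi : R)^-1 by rewrite invr_ge0 mulr_ge0// ltW.
rewrite /prof0 [leLHS]normrM (ger0_norm w0) normrM (ger0_norm v0).
apply: (@le_trans _ _ (`|dexp a b p q (Num.sqrt s)| * (Num.sqrt s)^-1)).
  rewrite ler_piMr ?mulr_ge0// invfM.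
  by rewrite mulr_ile1 ?invr_ge0 ?(ltW p0)// invf_le1 ?ler1n.
rewrite ler_wpM2r//; apply: (le_trans (dexp_norm _ _ _)).
by rewrite ler_wpM2r ?expR_ge0// /rot_bound -addrA lerDl !addr_ge0.
Qed.

Lemma prof1_norm p q s :
  `|prof1 a b p q s| <= rot_bound p q * expR (- (a * Num.sqrt s)) *
    ((Num.sqrt s)^-1 ^+ 2 + (Num.sqrt s)^-1 ^+ 3).
Proof.
have i0 := inv_pi_le1; have p0 := pi_gt0 R.
have v0 : 0 <= (Num.sqrt s)^-1 by rewrite invr_ge0 sqrtr_ge0.
rewrite /prof1 mulNr normrN normrM (@ger0_norm _ (8 * pi)^-1); last first.
  by rewrite invr_ge0 mulr_ge0// ltW.
apply: (@le_trans _ _ `|dexp a b (rot1 a b p q) (rot2 a b p q) (Num.sqrt s) / Num.sqrt s ^+ 2 +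
    dexp a b p q (Num.sqrt s) / Num.sqrt s ^+ 3|).
  rewrite ler_piMr// invfM.
  by rewrite mulr_ile1 ?invr_ge0 ?(ltW p0)// invf_le1 ?ler1n.
apply: (le_trans (ler_normD _ _)); rewrite mulrDr -!exprVn [`|_ * _ ^+ 2|]normrM [`|_ * _ ^+ 3|]normrM.
rewrite !(ger0_norm (exprn_ge0 _ v0)).
apply: lerD; rewrite ler_wpM2r ?exprn_ge0//; apply: (le_trans (dexp_norm _ _ _)).
all: rewrite ler_wpM2r ?expR_ge0// /rot_bound.
  by rewrite addrAC lerDr !addr_ge0.
by rewrite -addrA lerDl !addr_ge0.
Qed.

Lemma moment_norm p q (rho : R) : 0 <= rho ->
  `|moment p q rho| <= rot_bound p q * expR (- (a * rho)) * (1 + rho) ^+ 2.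
Proof.
move=> rho0; rewrite /moment /rot_bound.
have := dexp_norm p q rho.
have := dexp_norm (rot1 a b p q) (rot2 a b p q) rho.
have := dexp_norm (rot1 a b (rot1 a b p q) (rot2 a b p q)) (rot2 a b (rot1 a b p q) (rot2 a b p q)) rho.
move: (dexp a b (rot1 _ _ (rot1 _ _ _ _) _) _ _) (dexp a b (rot1 _ _ p q) _ _) (dexp a b p q _) => w v u.
have : 0 <= `|p| + `|q| by rewrite addr_ge0.
have : 0 <= `|rot1 a b p q| + `|rot2 a b p q| by rewrite addr_ge0.
have : 0 <= `|rot1 a b (rot1 a b p q) (rot2 a b p q)| + `|rot2 a b (rot1 a b p q) (rot2 a b p q)|.
  by rewrite addr_ge0.
move: (_ + `|rot2 a b (rot1 a b p q) _|) (_ + `|rot2 a b p q|) (_ + `|q|) => A B C A0 B0 C0.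
have := expR_ge0 (- (a * rho)); move: (expR _) => X X0 wA vB uC.
apply: (@le_trans _ _ (`|u| + rho * `|v| + rho ^+ 2 / 3 * `|w|)).
  apply: (le_trans (ler_normD _ _)); rewrite normrM (ger0_norm (_ : 0 <= rho ^+ 2 / 3)); last first.
    by rewrite mulr_ge0 ?sqr_ge0.
  rewrite lerD2r; apply: (le_trans (ler_normD _ _)).
  by rewrite lerD2l normrM (ger0_norm rho0).
apply: (@le_trans _ _ (C * X + rho * (B * X) + rho ^+ 2 / 3 * (A * X))).
  by rewrite !lerD// ler_wpM2l// mulr_ge0 ?sqr_ge0.
have -> : (C + B + A) * X * (1 + rho) ^+ 2 = C * X + rho * (B * X) + rho ^+ 2 / 3 * (A * X) +
   (C * X * (2 * rho + rho ^+ 2) + B * X * (1 + rho + rho ^+ 2) + A * X * (1 + 2 * rho + rho ^+ 2 * (2 / 3))).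
  by field.
by rewrite lerDl; do ![exact: sqr_ge0|apply: addr_ge0|apply: mulr_ge0|rewrite invr_ge0] => //.
Qed.

Lemma moment_near p q (rho : R) : 0 <= rho -> rho <= 2 ->
  `|moment p q rho - p| <= 3 * rot_bound p q * rho.
Proof.
move=> rho0 rho2; rewrite /moment /rot_bound.
have := dexp_lipschitz p q rho0.
have := dexp_norm (rot1 a b p q) (rot2 a b p q) rho.
have := dexp_norm (rot1 a b (rot1 a b p q) (rot2 a b p q)) (rot2 a b (rot1 a b p q) (rot2 a b p q)) rho.
move: (dexp a b (rot1 _ _ (rot1 _ _ _ _) _) _ _) (dexp a b (rot1 _ _ p q) _ _) (dexp a b p q _) => w v u.
have : 0 <= `|p| + `|q| by rewrite addr_ge0.
have : 0 <= `|rot1 a b p q| + `|rot2 a b p q| by rewrite addr_ge0.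
have : 0 <= `|rot1 a b (rot1 a b p q) (rot2 a b p q)| + `|rot2 a b (rot1 a b p q) (rot2 a b p q)|.
  by rewrite addr_ge0.
move: (_ + `|rot2 a b (rot1 a b p q) _|) (_ + `|rot2 a b p q|) (_ + `|q|) => A B C A0 B0 C0.
have X1 : expR (- (a * rho)) <= 1.
  by rewrite -[leRHS]expR0 ler_expR oppr_le0 mulr_ge0// ltW.
have := expR_ge0 (- (a * rho)); move: (expR _) X1 => X X1 X0 wA vB up.
have {}wA : `|w| <= A by rewrite (le_trans wA)// ler_piMr.
have {}vB : `|v| <= B by rewrite (le_trans vB)// ler_piMr.
have -> : u + rho * v + rho ^+ 2 / 3 * w - p = (u - p) + rho * v + rho ^+ 2 / 3 * w by ring.
apply: (@le_trans _ _ (B * rho + rho * B + rho ^+ 2 / 3 * A)).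
  apply: (le_trans (ler_normD _ _)); apply: lerD.
    apply: (le_trans (ler_normD _ _)); rewrite normrM (ger0_norm rho0) lerD//.
    by rewrite ler_wpM2l.
  have r3 : 0 <= rho ^+ 2 / 3 by rewrite mulr_ge0 ?sqr_ge0.
  by rewrite normrM (ger0_norm r3) ler_wpM2l.
have : 0 <= rho * C by rewrite mulr_ge0.
have : 0 <= rho * B by rewrite mulr_ge0.
have : rho ^+ 2 * A <= 2 * (rho * A) by rewrite expr2 mulrA ler_wpM2r// ler_wpM2r.
have : 0 <= rho * A by rewrite mulr_ge0.
clear; nra.
Qed.

(** Here [v] stands for [1/rho]. Cancelling it against [rho] removes the negative powers, and
    [e v <= 1], a consequence of [e <= rho], absorbs the rest; every term keeps a factor [e]. *)
Lemma error_terms_bound (E Y rho v e S c1 c2 F F1 : R) :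
  0 <= E -> 0 <= Y -> 0 < e -> e <= 1 -> e <= rho -> rho * v = 1 ->
  0 <= S -> S <= rho ^+ 2 ->
  `|c1| <= 2 * E * e ^+ 2 -> `|c2| <= 36 * E * e ^+ 4 ->
  `|F| <= Y * v -> `|F1| <= Y * (v ^+ 2 + v ^+ 3) ->
  `|4 * S * (c2 * F + 2 * c1 * F1) + 6 * c1 * F| <= 144 * E * Y * e * (1 + rho).
Proof.
move=> E0 Y0 e0 e1 er rv S0 Sr bc1 bc2 bF bF1.
have r0 : 0 < rho by exact: lt_le_trans er.
have v0 : 0 <= v by rewrite -(pmulr_rge0 _ r0) rv.
apply: (@le_trans _ _ (4 * rho ^+ 2 * (36 * E * e ^+ 4 * (Y * v) +
   2 * (2 * E * e ^+ 2) * (Y * (v ^+ 2 + v ^+ 3))) + 6 * (2 * E * e ^+ 2) * (Y * v))).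
  apply: (le_trans (ler_normD _ _)); apply: lerD.
    rewrite normrM (@ger0_norm _ (4 * S)) ?mulr_ge0//.
    apply: ler_pM; rewrite ?mulr_ge0 ?ler_wpM2l//.
    apply: (le_trans (ler_normD _ _)); rewrite !normrM (@ger0_norm _ 2)//.
    by rewrite lerD// ler_pM ?mulr_ge0// ler_wpM2l.
  rewrite !normrM (@ger0_norm _ 6)//.
  by rewrite ler_pM ?mulr_ge0// ler_wpM2l.
have -> : 4 * rho ^+ 2 * (36 * E * e ^+ 4 * (Y * v) +
   2 * (2 * E * e ^+ 2) * (Y * (v ^+ 2 + v ^+ 3))) + 6 * (2 * E * e ^+ 2) * (Y * v) =
   E * Y * e * (144 * e ^+ 3 * rho * (rho * v) + 16 * e * (rho * v) ^+ 2 +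
     16 * (rho * v) ^+ 2 * (e * v) + 12 * (e * v)) by ring.
rewrite rv !expr1n !mulr1.
have -> : 144 * E * Y * e * (1 + rho) = E * Y * e * (144 * (1 + rho)) by ring.
rewrite ler_wpM2l ?mulr_ge0 ?(ltW e0)//.
have ev : e * v <= 1 by rewrite -rv ler_wpM2r.
have e3 : e ^+ 3 * rho <= rho.
  by rewrite ler_piMl ?(ltW r0)// exprn_ile1// ltW.
move: (e * v) (e ^+ 3) ev e3 => u w ev e3; nra.
Qed.

Lemma bump_error_norm (e p q s : R) : 0 < e -> e <= 1 -> e ^+ 2 <= s ->
  `|bump_error e p q s| <= 144 * expR 1 *
    (rot_bound p q * expR (- (a * Num.sqrt s))) * e * (1 + Num.sqrt s).
Proof.
move=> e0 e1 es; have s0 : 0 < s by apply: lt_le_trans es; rewrite exprn_gt0.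
apply: (error_terms_bound _ _ e0 e1 _ _ _ _ (cutoff1_norm e s) (cutoff2_norm e s)
  (prof0_norm p q s) (prof1_norm p q s)).
- exact: expR_ge0.
- by rewrite mulr_ge0 ?expR_ge0// !addr_ge0.
- by rewrite -[leLHS](ger0_norm (ltW e0)) -sqrtr_sqr ler_sqrt// ltW.
- by rewrite divff// gt_eqF// sqrtr_gt0.
- by rewrite subr_ge0.
- by rewrite sqr_sqrtr ?(ltW s0)// gerBl sqr_ge0.
Qed.

Lemma approx_ge0 e r : 0 <= approx e r.
Proof.
rewrite /approx divr_ge0//; first by rewrite mulr_ge0 ?sqr_ge0.
by rewrite !mulr_ge0 ?exprn_ge0 ?sqrtr_ge0 ?pi_ge0.
Qed.

(** [1 + rho] is at most a constant times [exp (a rho / 4)]; its square costs half of the decay. *)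
Lemma poly2_le_expR (rho : R) : 0 <= rho ->
  (1 + rho) ^+ 2 * expR (- (a * rho)) <= (1 + (a / 4)^-1) ^+ 2 * expR (- (a / 2 * rho)).
Proof.
move=> rho0; have a4 : 0 < a / 4 by rewrite divr_gt0.
have h := poly1_le_expR a4 rho0.
have -> : expR (- (a / 2 * rho)) = expR (a / 4 * rho) ^+ 2 * expR (- (a * rho)).
  by rewrite -expRM_natl -expRD; congr expR; field.
by rewrite mulrA -exprMn ler_wpM2r ?expR_ge0// ler_pXn2r ?nnegrE ?(le_trans _ h) ?addr_ge0.
Qed.

(** Two regimes: a global bound with half of the decay, used for domination, and near the
    singularity the comparison with [p * approx], whose error has the extra factor [r + e]. There
    [rho <= r + e <= 2], as [moment_near] requires. *)
Lemma residue_estimate (p q : R) : exists2 C, 0 <= C & forall e r : R,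
  0 < e -> e <= 1 -> 0 <= r ->
  `|residue a b e p q (r ^+ 2 + e ^+ 2)| <= C * ((approx e r + e) * expR (- (a / 2 * r))) /\
  (r <= 1 -> `|residue a b e p q (r ^+ 2 + e ^+ 2) - p * approx e r| <=
             C * ((r + e) * approx e r + e)).
Proof.
pose K := rot_bound p q; pose Z := (1 + (a / 4)^-1) ^+ 2; pose E : R := expR 1.
have K0 : 0 <= K by rewrite /K !addr_ge0.
have Z0 : 0 <= Z by exact: sqr_ge0.
have E0 : 0 <= E by exact: expR_ge0.
have E1 : 1 <= E by rewrite -[leLHS]expR0 ler_expR.
exists (144 * E * K * Z + 3 * K) => [|e r e0 e1 r0].
  by do ![exact: K0|exact: Z0|exact: E0|apply: addr_ge0|apply: mulr_ge0].
have s0 : 0 < r ^+ 2 + e ^+ 2 by rewrite ltr_wpDl ?sqr_ge0 ?exprn_gt0.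
have es : e ^+ 2 <= r ^+ 2 + e ^+ 2 by rewrite lerDr sqr_ge0.
have rrho : r <= Num.sqrt (r ^+ 2 + e ^+ 2).
  by rewrite -[leLHS](ger0_norm r0) -sqrtr_sqr ler_sqrt ?(ltW s0)// lerDl sqr_ge0.
have rhore : Num.sqrt (r ^+ 2 + e ^+ 2) <= r + e.
  have re0 : 0 <= r + e by rewrite addr_ge0// ltW.
  rewrite -[leRHS](ger0_norm re0) -sqrtr_sqr ler_sqrt ?sqr_ge0// sqrrD.
  by rewrite addrAC lerDl mulrn_wge0// mulr_ge0// ltW.
have := residueE p q r e0; have := bump_error_norm p q e0 e1 es.
have := cutoff_near es; have := cutoff_le1 es; have := cutoff_ge0 e (r ^+ 2 + e ^+ 2).
rewrite addrK; set rho := Num.sqrt _ in rrho rhore *.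
have rho0 : 0 <= rho by exact: sqrtr_ge0.
set c := cutoff _ _; set err := bump_error _ _ _ _; set L := residue _ _ _ _ _ _.
move=> c0 c1 cn errn ->; have := moment_norm p q rho0.
have := poly2_le_expR rho0; have A0 := approx_ge0 e r.
have xr : expR (- (a / 2 * rho)) <= expR (- (a / 2 * r)).
  by rewrite ler_expR lerN2 ler_wpM2l// divr_ge0// ltW.
have xr1 : expR (- (a / 2 * r)) <= 1.
  by rewrite -[leRHS]expR0 ler_expR oppr_le0 mulr_ge0// divr_ge0// ltW.
have x0 := expR_ge0 (- (a / 2 * r)).
have X0 := expR_ge0 (- (a * rho)).
rewrite -/Z -/K => px mn.
set A := approx e r in A0 *; set m := moment _ _ _ in mn *.
have mp : rho <= 2 -> `|m - p| <= 3 * K * rho by exact: moment_near.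
clearbody A m c err.
have mle : `|m| <= K * Z * expR (- (a / 2 * r)).
  apply: (le_trans mn); rewrite -mulrA -[leRHS]mulrA ler_wpM2l// mulrC (le_trans px)//.
  by rewrite ler_wpM2l.
have errle : `|err| <= 144 * E * K * Z * e * expR (- (a / 2 * r)).
  apply: (le_trans errn); rewrite -/E -/K -/rho.
  have -> : 144 * E * (K * expR (- (a * rho))) * e * (1 + rho) =
    144 * E * K * e * ((1 + rho) * expR (- (a * rho))) by ring.
  have -> : 144 * E * K * Z * e * expR (- (a / 2 * r)) =
    144 * E * K * e * (Z * expR (- (a / 2 * r))) by ring.
  rewrite ler_wpM2l ?mulr_ge0 ?(ltW e0)//.
  apply: (@le_trans _ _ ((1 + rho) ^+ 2 * expR (- (a * rho)))).
    by rewrite ler_wpM2r// ler_eXnr// lerDl.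
  by rewrite (le_trans px)// ler_wpM2l.
rewrite -/E in cn; clearbody K Z E; have e0' := ltW e0.
have E1' : 0 <= E - 1 by rewrite subr_ge0.
split.
  apply: (le_trans (ler_normB _ _)); rewrite !normrM (ger0_norm A0) (ger0_norm c0).
  apply: (@le_trans _ _ (A * (K * Z * expR (- (a / 2 * r))) +
      144 * E * K * Z * e * expR (- (a / 2 * r)))).
    by rewrite lerD// ler_wpM2l// (le_trans _ mle)// ler_piMl.
  rewrite -subr_ge0.
  have -> : (144 * E * K * Z + 3 * K) * ((A + e) * expR (- (a / 2 * r))) -
    (A * (K * Z * expR (- (a / 2 * r))) + 144 * E * K * Z * e * expR (- (a / 2 * r))) =
    expR (- (a / 2 * r)) * (A * K * Z * (E - 1) + 143 * A * E * K * Z + 3 * K * (A + e)) by ring.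
  by do ![assumption|apply: addr_ge0|apply: mulr_ge0] => //.
move=> r1.
have cm : `|c * m - p| <= (2 * E * K * Z + 3 * K) * (r + e).
  have -> : c * m - p = (c - 1) * m + (m - p) by ring.
  apply: (le_trans (ler_normD _ _)); rewrite normrM mulrDl; apply: lerD.
    have m1 : `|m| <= K * Z by rewrite (le_trans mle)// ler_piMr ?mulr_ge0.
    have -> : 2 * E * K * Z * (r + e) = (2 * E * (r + e)) * (K * Z) by ring.
    rewrite ler_pM// (le_trans cn)// -mulrA ler_wpM2l ?mulr_ge0//.
    apply: (@le_trans _ _ r); last by rewrite lerDl ltW.
    apply: (@le_trans _ _ (1 * r)); last by rewrite mul1r.
    apply: ler_pM; rewrite ?sqr_ge0// ?exprn_ile1//.
    by rewrite expr2 ler_piMr.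
  apply: (@le_trans _ _ (3 * K * rho)); last by rewrite ler_wpM2l ?mulr_ge0.
  by apply: mp; rewrite (le_trans rhore)// -[2]/(1 + 1) lerD.
have -> : A * (c * m) - err - p * A = A * (c * m - p) - err by ring.
apply: (le_trans (ler_normB _ _)); rewrite normrM (ger0_norm A0).
apply: (@le_trans _ _ (A * ((2 * E * K * Z + 3 * K) * (r + e)) + 144 * E * K * Z * e)).
  apply: lerD; first by rewrite ler_wpM2l.
  by apply: (le_trans errle); rewrite ler_piMr ?mulr_ge0 ?(ltW e0).
rewrite -subr_ge0.
have -> : (144 * E * K * Z + 3 * K) * ((r + e) * A + e) -
   (A * ((2 * E * K * Z + 3 * K) * (r + e)) + 144 * E * K * Z * e) =
   142 * E * K * Z * (r + e) * A + 3 * K * e by ring.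
by do ![assumption|apply: addr_ge0|apply: mulr_ge0] => //.
Qed.

End ResidueEstimates.

(** * Mass and concentration of the residue *)

Section ApproximateIdentity.
Context {R : realType}.
Variables (a b : R).
Hypothesis a0 : 0 < a.
Local Notation T := (space3 R).
Local Notation mu := (@lebesgue_measure R).

(** The function differentiated is the mass of [approx] in the ball of radius [t]: the flux through
    its boundary of minus the gradient of the regularised Newton kernel. *)
Lemma is_derive_approx (e t : R) : 0 < e ->
  is_derive t 1 (fun t => t ^+ 3 * (Num.sqrt (t ^+ 2 + e ^+ 2) ^+ 3)^-1)
    (approx e t * (4 * pi * t ^+ 2)).
Proof.
move=> e0; have s0 : 0 < t ^+ 2 + e ^+ 2 by rewrite ltr_wpDl ?sqr_ge0 ?exprn_gt0.
have dX n : is_derive t 1 (fun t : R => t ^+ n) (n%:R * t ^+ n.-1).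
  have d := @is_deriveX R R id n t 1 1 (is_derive_id _ _).
  have XE : (id : R -> R) ^+ n = (fun t => t ^+ n).
    by apply/funext => u; rewrite exprfctE.
  by rewrite XE /GRing.scale/= mulr1 in d.
have dq : is_derive t 1 (fun t => t ^+ 2 + e ^+ 2) (2 * t).
  by have := is_deriveD (dX 2%N) (is_derive_cst (e ^+ 2) t 1); rewrite addr0.
have r0 : Num.sqrt (t ^+ 2 + e ^+ 2) != 0 by rewrite gt_eqF ?sqrtr_gt0.
have := is_derive_sqrt_comp s0 (is_derive_exprV 3 r0).
move=> /(fun h => @is_derive1_comp _ _ (fun t => t ^+ 2 + e ^+ 2) _ _ _ h dq) h.
have := is_deriveM (dX 3%N) h; rewrite /GRing.scale/= => {}h.
apply: (is_derive_eq h); rewrite /approx.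
have pi0 : (pi : R) != 0 by rewrite gt_eqF ?pi_gt0.
have es : e ^+ 2 = Num.sqrt (t ^+ 2 + e ^+ 2) ^+ 2 - t ^+ 2.
  by rewrite sqr_sqrtr ?(ltW s0)// addrAC subrr add0r.
move: (Num.sqrt (t ^+ 2 + e ^+ 2)) r0 es => r r0 ->.
move: (pi : R) pi0 => P P0.
by clear -P0 r0; field; rewrite r0 P0.
Qed.

Lemma measurable_approx (e : R) : measurable_fun setT (approx e).
Proof.
apply: measurable_funM => //; apply: measurable_inv_fun; apply: measurable_funM => //.
apply: measurable_funX; apply: measurable_sqrt_comp; exact: measurable_funD.
Qed.

Lemma continuous_approx (e : R) : 0 < e -> continuous (fun t : R => approx e t * (4 * pi * t ^+ 2)).
Proof.
move=> e0 t; have s0 : 0 < t ^+ 2 + e ^+ 2 by rewrite ltr_wpDl ?sqr_ge0 ?exprn_gt0.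
have cs : {for t, continuous (fun t : R => Num.sqrt (t ^+ 2 + e ^+ 2))}.
  apply: (@continuous_comp _ _ _ (fun t : R => t ^+ 2 + e ^+ 2) Num.sqrt).
    by apply: cvgD; [exact: exprn_continuous|exact: cvg_cst].
  exact: sqrt_continuous.
apply: cvgM; last by apply: cvgM; [exact: cvg_cst|exact: exprn_continuous].
apply: cvgM; first exact: cvg_cst.
apply: cvgV.
  by rewrite mulf_neq0 ?expf_neq0 ?gt_eqF ?sqrtr_gt0// mulr_gt0 ?pi_gt0.
apply: cvgM; first exact: cvg_cst.
apply: (@continuous_comp _ _ _ (fun t : R => Num.sqrt (t ^+ 2 + e ^+ 2)) (fun t : R => t ^+ 5)) => //.
exact: exprn_continuous.
Qed.

Lemma integral_approx_ball (e d : R) (y : T) : 0 < e -> 0 < d ->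
  (\int[vol]_(x in [set x | (dist3 x y < d)%R]) (approx e (dist3 x y))%:E =
    ((d / Num.sqrt (d ^+ 2 + e ^+ 2)) ^+ 3)%:E)%E.
Proof.
move=> e0 d0; pose F (t : R) : \bar R := (if t < d then approx e t else 0)%:E.
have mF : measurable_fun setT F.
  apply/measurable_EFinP; apply: measurable_fun_ifT => //.
    exact: measurable_fun_ltr.
  exact: measurable_approx.
have F0 t : (0 <= F t)%E by rewrite lee_fin; case: ifPn => // _; exact: approx_ge0.
transitivity (\int[vol]_x F (dist3 x y))%E.
  rewrite integral_mkcond; apply: eq_integral => x _.
  rewrite patchE /F.
  by have [h|h] := boolP (dist3 x y < d); [rewrite mem_set|rewrite memNset// => h'; move: h; rewrite h'].
rewrite (ge0_integral_radial _ mF F0).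
have mG D : measurable_fun D (fun t : R => (approx e t * (4 * pi * t ^+ 2))%:E).
  apply/measurable_funTS/measurable_EFinP/measurable_funM; first exact: measurable_approx.
  exact: measurable_funM.
have := integral_itv_derive d0 (continuous_approx e0) (fun t => is_derive_approx t e0).
rewrite expr0n/= mul0r subr0 expr_div_n => <-.
rewrite -integral_itv_bndo_bndc; last exact: mG.
rewrite -integral_itv_obnd_cbnd; last exact: mG.
rewrite integral_mkcond [RHS]integral_mkcond; apply: eq_integral => t _.
rewrite !patchE !mem_setE/= !in_itv/= andbT /F.
by case: ifPn => //= t0; case: ifPn => t1; rewrite ?mul0e.
Qed.

Lemma measurable_bumps e p q :
  [/\ measurable_fun setT (bump1 a b e p q), measurable_fun setT (bump2 a b e p q) &
      measurable_fun setT (residue a b e p q)].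
Proof.
have md p1 q1 : measurable_fun setT (fun s : R => dexp a b p1 q1 (Num.sqrt s)).
  exact: (profile_measurable (profile_dexp a b e p1 q1)).
have mf n : measurable_fun setT (fun s : R => flat n (1 + e ^+ 4 - e ^+ 2 * s)).
  exact: (profile_measurable (profile_flat a b e n)).
have ms n : measurable_fun setT (fun s : R => (Num.sqrt s ^+ n)^-1).
  by apply: measurable_inv_fun; apply: measurable_funX; exact: measurable_sqrt_comp.
have m0 p1 q1 : measurable_fun setT (prof0 a b p1 q1).
  apply: measurable_funM => //; apply: measurable_funM => //; exact: (ms 1%N).
have m1 p1 q1 : measurable_fun setT (prof1 a b p1 q1).
  apply: measurable_funM => //.
  by apply: measurableT_comp => //; apply: measurable_funD; apply: measurable_funM.
have m2 p1 q1 : measurable_fun setT (prof2 a b p1 q1).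
  apply: measurable_funM => //.
  by do ![exact: ms|exact: md|apply: measurable_funD|apply: measurable_funM].
have c0 : measurable_fun setT (cutoff e) by apply: measurable_funM.
have c1 : measurable_fun setT (cutoff1 e).
  by apply: measurable_funM => //; apply: measurable_funM.
have c2 : measurable_fun setT (cutoff2 e).
  apply: measurable_funM => //; apply: measurable_funM => //.
  by apply: measurable_funB => //; apply: measurable_funM.
have b1 : measurable_fun setT (bump1 a b e p q).
  by apply: measurable_funD; apply: measurable_funM.
have b2 : measurable_fun setT (bump2 a b e p q).
  apply: measurable_funD; last exact: measurable_funM.
  apply: measurable_funD; first exact: measurable_funM.
  by apply: measurable_funM => //; apply: measurable_funM.
split=> //; apply: measurable_funB; first exact: measurable_funM.
apply: measurable_funD; apply: measurable_funM => //.
by apply: measurable_funM => //; exact: measurable_funB.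
Qed.

Lemma measurable_residue e p q : measurable_fun setT (residue a b e p q).
Proof. by have [] := measurable_bumps e p q. Qed.

(** This fixes the relation [e = eta^3] between the regularisation and the radius of concentration:
    beyond radius [eta], [approx] is of order [e^2 / eta^5 = eta]. *)
Lemma approx_far (eta r : R) : 0 < eta -> eta <= r -> approx (eta ^+ 3) r <= eta.
Proof.
move=> h0 hr; rewrite /approx; have p0 := pi_gt0 R.
have sh : eta ^+ 5 <= Num.sqrt (r ^+ 2 + (eta ^+ 3) ^+ 2) ^+ 5.
  rewrite lerXn2r ?nnegrE ?sqrtr_ge0 ?(ltW h0)// -[leLHS](ger0_norm (ltW h0)) -sqrtr_sqr.
  rewrite ler_sqrt ?addr_ge0 ?sqr_ge0//.
  by rewrite (@le_trans _ _ (r ^+ 2)) ?lerDl ?sqr_ge0// lerXn2r ?nnegrE ?(ltW h0) ?(le_trans (ltW h0)).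
have h5 : 0 < eta ^+ 5 by rewrite exprn_gt0.
have S0 := lt_le_trans h5 sh.
have P0 : 0 < 4 * pi :> R by rewrite mulr_gt0.
rewrite ler_pdivrMr; last exact: mulr_gt0.
apply: (@le_trans _ _ (eta * (4 * pi * eta ^+ 5))); last first.
  by rewrite ler_wpM2l ?(ltW h0)// ler_wpM2l// mulr_ge0// ltW.
have -> : eta * (4 * pi * eta ^+ 5) = 4 * pi * (eta ^+ 3) ^+ 2 by ring.
rewrite ler_wpM2r ?sqr_ge0//; have := pi_ge2 R; lra.
Qed.

(** Inside radius [eta] the factor [r + e] is of order [eta], and outside it [approx] itself is.
    Both errors are thus [eta] times [approx + 1], whose integral over a bounded set is bounded
    uniformly in [eta]. *)
Lemma residue_split (p q : R) : exists2 C, 0 <= C & forall eta r : R,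
  0 < eta -> eta <= 1 -> 0 <= r ->
  `|residue a b (eta ^+ 3) p q (r ^+ 2 + (eta ^+ 3) ^+ 2)| <=
    C * ((approx (eta ^+ 3) r + 1) * expR (- (a / 2 * r))) /\
  `|residue a b (eta ^+ 3) p q (r ^+ 2 + (eta ^+ 3) ^+ 2) -
      (if r < eta then p * approx (eta ^+ 3) r else 0)| <=
    C * (eta * (approx (eta ^+ 3) r + 1)).
Proof.
have [C C0 CP] := residue_estimate b a0 p q.
exists (2 * C) => [|eta r h0 h1 r0]; first by rewrite mulr_ge0.
have e0 : 0 < eta ^+ 3 by rewrite exprn_gt0.
have e1 : eta ^+ 3 <= 1 by rewrite exprn_ile1// ltW.
have eh : eta ^+ 3 <= eta by rewrite exprS ler_piMr ?(ltW h0)// exprn_ile1// ltW.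
have [gl nr] := CP _ _ e0 e1 r0; have A0 := approx_ge0 (eta ^+ 3) r.
have x0 := expR_ge0 (- (a / 2 * r)).
have x1 : expR (- (a / 2 * r)) <= 1.
  by rewrite -[leRHS]expR0 ler_expR oppr_le0 mulr_ge0// divr_ge0// ltW.
split.
  apply: (le_trans gl); rewrite (mulrC 2) -[leRHS]mulrA ler_wpM2l//.
  move: (approx _ _) A0 (expR _) x0 => A A0 X x0; move: (eta ^+ 3) e1 => e e1.
  by clear -A0 x0 e1; nra.
case: ifPn => [rh|]; last first.
  rewrite -leNgt subr0 => rh; have Ah := approx_far h0 rh.
  apply: (le_trans gl); rewrite (mulrC 2) -[leRHS]mulrA ler_wpM2l//.
  apply: (@le_trans _ _ (approx (eta ^+ 3) r + eta ^+ 3)).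
    by rewrite ler_piMr// addr_ge0// ltW.
  move: (approx _ _) A0 Ah => A A0 Ah; move: (eta ^+ 3) eh => e eh.
  by clear -h0 A0 Ah eh; nra.
apply: (le_trans (nr _)); first by rewrite (le_trans (ltW rh)).
rewrite (mulrC 2) -[leRHS]mulrA ler_wpM2l//.
move: (approx _ _) A0 => A A0; move: (eta ^+ 3) eh => e eh.
by clear -rh h0 A0 eh; nra.
Qed.

Lemma measurable_kernel_comp (k : R -> R) (e : R) (y : T) : measurable_fun setT k ->
  measurable_fun setT (fun x : T => k (dist3 x y ^+ 2 + e ^+ 2)).
Proof.
move=> mk; apply: (measurableT_comp mk); apply: measurable_funD => //.
apply: measurable_funX; exact: measurable_fun_dist3.
Qed.

Lemma integral_approx_le1 (e M : R) (D : set T) (y0 y : T) : 0 < e ->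
  measurable D -> (forall x, D x -> dist3 x y0 <= M) ->
  (\int[vol]_(x in D) (approx e (dist3 x y))%:E <= 1)%E.
Proof.
move=> e0 mD DM; pose d := `|M| + dist3 y0 y + 1.
have d0 : 0 < d by rewrite ltr_wpDl// addr_ge0// dist3_ge0.
apply: (@le_trans _ _ (\int[vol]_(x in [set x | (dist3 x y < d)%R]) (approx e (dist3 x y))%:E)%E).
  apply: ge0_subset_integral => //.
  - by apply: measurable_lt_cst; exact: measurable_fun_dist3.
  - apply/measurable_funTS/measurable_EFinP; apply: (measurableT_comp (@measurable_approx e)).
    exact: measurable_fun_dist3.
  - by move=> x _; rewrite lee_fin approx_ge0.
  - move=> x /DM xM /=; apply: (le_lt_trans (dist3_triangle x y0 y)).
    by rewrite /d ltr_pwDr// lerD2r (le_trans xM)// ler_norm.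
rewrite integral_approx_ball// lee_fin exprn_ile1//.
  by rewrite divr_ge0 ?sqrtr_ge0// ltW.
rewrite ler_pdivrMr ?sqrtr_gt0 ?ltr_wpDl ?sqr_ge0 ?exprn_gt0// mul1r.
by rewrite -[leLHS](ger0_norm (ltW d0)) -sqrtr_sqr ler_sqrt ?addr_ge0 ?sqr_ge0// lerDl sqr_ge0.
Qed.

Lemma vol_bounded (M : R) (D : set T) (y0 : T) : measurable D ->
  (forall x, D x -> dist3 x y0 <= M) -> (vol D < +oo)%E.
Proof.
move=> mD DM; have m0 : 0 <= `|M| + 1 by rewrite addr_ge0.
apply: (@le_lt_trans _ _ (vol [set x | dist3 x y0 < `|M| + 1])).
  apply: le_measure; rewrite ?inE//.
    by apply: measurable_lt_cst; exact: measurable_fun_dist3.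
  by move=> x /DM xM /=; rewrite ltr_pwDr// (le_trans xM)// ler_norm.
by rewrite vol_ball// ltry.
Qed.

(** The ratio [u] satisfies [u^2 (1 + eta^4) = 1] and [u <= 1]; bounding [u^3] below by [u^4], the
    square of [1/(1 + eta^4)], avoids the square root. *)
Lemma ratio_cube_near1 (eta : R) : 0 < eta -> eta <= 1 ->
  `|(eta / Num.sqrt (eta ^+ 2 + (eta ^+ 3) ^+ 2)) ^+ 3 - 1| <= 2 * eta.
Proof.
move=> h0 h1; set s := Num.sqrt _.
have S0 : 0 < eta ^+ 2 + (eta ^+ 3) ^+ 2 by rewrite ltr_wpDl ?sqr_ge0// !exprn_gt0.
have s0 : 0 < s by rewrite sqrtr_gt0.
have hs : eta <= s.
  by rewrite -[leLHS](ger0_norm (ltW h0)) -sqrtr_sqr ler_sqrt ?(ltW S0)// lerDl sqr_ge0.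
have u0 : 0 <= eta / s by rewrite divr_ge0 ?ltW.
have u1 : eta / s <= 1 by rewrite ler_pdivrMr// mul1r.
have u2 : (eta / s) ^+ 2 * (1 + eta ^+ 4) = 1.
  rewrite expr_div_n sqr_sqrtr ?(ltW S0)//.
  have -> : eta ^+ 2 + (eta ^+ 3) ^+ 2 = eta ^+ 2 * (1 + eta ^+ 4) by ring.
  have E0 : 0 < 1 + eta ^+ 4 by rewrite ltr_pwDl// exprn_ge0// ltW.
  by rewrite invfM mulrA divff ?mul1r ?mulVf// gt_eqF// exprn_gt0.
have e4 : eta ^+ 4 <= eta by rewrite exprS ler_piMr ?(ltW h0)// exprn_ile1// ltW.
have e40 : 0 <= eta ^+ 4 by rewrite exprn_ge0// ltW.
have u3 : (eta / s) ^+ 4 <= (eta / s) ^+ 3 by rewrite [leLHS]exprS ler_piMl// exprn_ge0.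
have u31 : (eta / s) ^+ 3 <= 1 by rewrite exprn_ile1.
have u4 : (eta / s) ^+ 4 = ((eta / s) ^+ 2) ^+ 2 by rewrite -exprM.
rewrite ler0_norm ?subr_le0// opprB.
rewrite u4 in u3; move: u2 u3 u31; move: (_ ^+ 3) (_ ^+ 2) (sqr_ge0 (eta / s)) e4 e40.
move: (eta ^+ 4) => E c w w0 e4 e40 u2 u3 u31.
have w1 : 1 - E <= w by nra.
have E1 : E <= 1 by lra.
nra.
Qed.

(** The constant depends on neither [eta] nor [y]. The decay in [y] provides the majorant for
    dominated convergence; the last two clauses give the limits [p] inside [D] and 0 outside, for
    points whose [eta]-ball does not meet the boundary. *)
Lemma approximate_identity (p q M : R) (D : set T) (y0 : T) :
  measurable D -> (forall x, D x -> dist3 x y0 <= M) ->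
  exists2 C, 0 <= C & forall (eta : R) (y : T), 0 < eta -> eta <= 1 ->
  let L x := residue a b (eta ^+ 3) p q (dist3 x y ^+ 2 + (eta ^+ 3) ^+ 2) in
  [/\ vol.-integrable D (EFin \o L),
      (\int[vol]_(x in D) `|(L x)%:E| <= (C * expR (- (a / 2 * dist3 y y0)))%:E)%E,
      [set x | dist3 x y < eta] `<=` D -> `|\int[vol]_(x in D) L x - p| <= C * eta &
      D `&` [set x | dist3 x y < eta] = set0 -> `|\int[vol]_(x in D) L x| <= C * eta].
Proof.
move=> mD DM; have [C C0 CP] := residue_split p q.
have volD : vol D \is a fin_num by rewrite ge0_fin_numE// (vol_bounded mD DM).
pose V := fine (vol D); have V0 : 0 <= V by rewrite fine_ge0.
have c0 : 0 <= a / 2 by rewrite divr_ge0// ltW.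
exists (C * (1 + V) * (1 + expR (a / 2 * M)) + 2 * `|p|) => [|eta y h0 h1 L].
  by rewrite !(addr_ge0, mulr_ge0)// expR_ge0.
have e0 : 0 < eta ^+ 3 by rewrite exprn_gt0.
have mL : measurable_fun setT L by apply: measurable_kernel_comp; exact: measurable_residue.
have mA : measurable_fun setT (fun x : T => approx (eta ^+ 3) (dist3 x y)).
  apply: (measurableT_comp (@measurable_approx _)); exact: measurable_fun_dist3.
have iA1 : (\int[vol]_(x in D) (approx (eta ^+ 3) (dist3 x y) + 1)%:E <= (1 + V)%:E)%E.
  under eq_integral do rewrite EFinD.
  rewrite ge0_integralD//; last 2 first.
  - by move=> x _; rewrite lee_fin approx_ge0.
  - exact/measurable_funTS/measurable_EFinP.
  rewrite integral_cst// mul1e EFinD /V fineK// leeD2r// (integral_approx_le1 _ e0 mD DM).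
  exact.
have mA1 : measurable_fun D (fun x : T => (approx (eta ^+ 3) (dist3 x y) + 1)%:E).
  by apply/measurable_funTS/measurable_EFinP; exact: measurable_funD.
have bnd (B : R) (g : T -> R) : 0 <= B -> measurable_fun setT g ->
    (forall x, D x -> `|g x| <= B * (approx (eta ^+ 3) (dist3 x y) + 1)) ->
    (\int[vol]_(x in D) `|(g x)%:E| <= (B * (1 + V))%:E)%E.
  move=> B0 mg gB; apply: (@le_trans _ _ (\int[vol]_(x in D)
      (B%:E * (approx (eta ^+ 3) (dist3 x y) + 1)%:E))%E).
    apply: ge0_le_integral => //.
    - by apply/measurable_funTS/measurable_EFinP/measurableT_comp.
    - exact: measurable_funeM.
  rewrite ge0_integralZl ?lee_fin//; last first.
    by move=> x _; rewrite lee_fin addr_ge0 ?approx_ge0.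
  by rewrite EFinM lee_wpmul2l ?lee_fin.
have int (B : R) (g : T -> R) : 0 <= B -> measurable_fun setT g ->
    (forall x, D x -> `|g x| <= B * (approx (eta ^+ 3) (dist3 x y) + 1)) ->
    vol.-integrable D (EFin \o g).
  move=> B0 mg gB; apply/integrableP; split.
    exact/measurable_funTS/measurable_EFinP.
  exact: le_lt_trans (bnd B g B0 mg gB) (ltry _).
have nrm (B : R) (g : T -> R) : 0 <= B -> measurable_fun setT g ->
    (forall x, D x -> `|g x| <= B * (approx (eta ^+ 3) (dist3 x y) + 1)) ->
    `|\int[vol]_(x in D) g x| <= B * (1 + V).
  move=> B0 mg gB; have ig := int B g B0 mg gB.
  rewrite -lee_fin EFin_normr_Rintegral//; apply: le_trans (bnd B g B0 mg gB).
  by apply: le_abse_integral => //; case/integrableP: ig.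
pose W := expR (a / 2 * M) * expR (- (a / 2 * dist3 y y0)).
have W0 : 0 <= W by rewrite mulr_ge0 ?expR_ge0.
have LW x : D x -> `|L x| <= C * W * (approx (eta ^+ 3) (dist3 x y) + 1).
  move=> Dx; have [/le_trans + _] := CP eta (dist3 x y) h0 h1 (dist3_ge0 x y); apply.
  rewrite -[leRHS]mulrA ler_wpM2l// (mulrC W) ler_wpM2l ?addr_ge0 ?approx_ge0//.
  rewrite /W -expRD ler_expR -mulrN -mulrN -mulrDr ler_wpM2l//.
  have := dist3_triangle y x y0; rewrite (dist3C y x); have := DM _ Dx; lra.
have iL : vol.-integrable D (EFin \o L) by apply: (int (C * W)) => //; rewrite mulr_ge0.
(* The part carrying the mass: [L - G] is of order [eta] in [L_1(D)], and the integral of [G] is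
   explicit when the ball lies in [D]. *)
pose G x := if dist3 x y < eta then p * approx (eta ^+ 3) (dist3 x y) else 0.
have mball : measurable [set x | dist3 x y < eta].
  by apply: measurable_lt_cst; exact: measurable_fun_dist3.
have mG : measurable_fun setT G.
  apply: measurable_fun_ifT => //; last exact: measurable_funM.
  by apply: measurable_fun_ltr => //; exact: measurable_fun_dist3.
have iG : vol.-integrable D (EFin \o G).
  apply: (int `|p|) => // x _; rewrite /G; case: ifP => _; last first.
    by rewrite normr0 mulr_ge0// addr_ge0 ?approx_ge0.
  by rewrite normrM (ger0_norm (approx_ge0 _ _)) ler_wpM2l// lerDl.
have LG : `|\int[vol]_(x in D) (L x - G x)| <= C * eta * (1 + V).
  apply: nrm; [by rewrite mulr_ge0// ltW|exact: measurable_funB|move=> x Dx].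
  have [_ /le_trans] := CP eta (dist3 x y) h0 h1 (dist3_ge0 x y); apply.
  by rewrite -[leRHS]mulrA.
have CV : C * eta * (1 + V) <= C * (1 + V) * (1 + expR (a / 2 * M)) * eta.
  have -> : C * eta * (1 + V) = C * (1 + V) * 1 * eta by ring.
  apply: ler_wpM2r; first exact: ltW.
  by apply: ler_wpM2l; [rewrite mulr_ge0// addr_ge0|rewrite lerDl expR_ge0].
split=> //.
- apply: (le_trans (bnd (C * W) L _ _ LW)) => //; first by rewrite mulr_ge0.
  rewrite lee_fin; have -> : C * W * (1 + V) = C * (1 + V) * expR (a / 2 * M) *
    expR (- (a / 2 * dist3 y y0)) by rewrite /W; ring.
  rewrite ler_wpM2r ?expR_ge0// (le_trans (_ : _ <= C * (1 + V) * (1 + expR (a / 2 * M))))//.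
    by rewrite ler_wpM2l ?mulr_ge0 ?addr_ge0// lerDr.
  by rewrite lerDl mulr_ge0.
- move=> BD; have GE : \int[vol]_(x in D) G x =
      p * (eta / Num.sqrt (eta ^+ 2 + (eta ^+ 3) ^+ 2)) ^+ 3.
    transitivity (\int[vol]_(x in D) ((fun x => p * approx (eta ^+ 3) (dist3 x y)) \_
        [set x | dist3 x y < eta]) x).
      apply: eq_Rintegral => x _; rewrite patchE /G.
      by have [h|h] := boolP (dist3 x y < eta); [rewrite mem_set|rewrite memNset// => h'; move: h; rewrite h'].
    rewrite -Rintegral_mkcondr (setIidr BD) RintegralZl//.
      by rewrite /Rintegral integral_approx_ball.
    apply: integrableS BD _ => //; apply: (int 1) => // x _.
    by rewrite mul1r ger0_norm ?approx_ge0// lerDl.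
  have -> : \int[vol]_(x in D) L x - p = \int[vol]_(x in D) (L x - G x) +
      p * ((eta / Num.sqrt (eta ^+ 2 + (eta ^+ 3) ^+ 2)) ^+ 3 - 1).
    by rewrite RintegralB// GE; ring.
  apply: (le_trans (ler_normD _ _)); rewrite mulrDl; apply: lerD.
    exact: le_trans LG CV.
  rewrite normrM (mulrC 2) -[leRHS]mulrA; apply: ler_wpM2l => //.
  exact: ratio_cube_near1.
- move=> DB; have -> : \int[vol]_(x in D) L x = \int[vol]_(x in D) (L x - G x).
    apply: eq_Rintegral => x /set_mem Dx; rewrite /G; case: ifPn; last by rewrite subr0.
    by move=> xB; exfalso; move: DB; rewrite predeqE => /(_ x)[/(_ (conj Dx xB))].
  apply: (le_trans LG); apply: (le_trans CV).
  by apply: ler_wpM2r; [exact: ltW|rewrite lerDl mulr_ge0].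
Qed.

End ApproximateIdentity.

(** * Integrals over boxes *)

(** The push-forwards under [f] of both measures restricted to [C] agree on an intersection-stable
    generator; finiteness on [C] supplies the finiteness needed for uniqueness. *)
Lemma measure_eq_fiber (R : realType) d d' (T : measurableType d) (X : measurableType d')
    (f : T -> X) (G : set (set X)) (g : (set X)^nat) (C : set T)
    (m1 m2 : {measure set T -> \bar R}) :
  measurable_fun setT f -> measurable C -> (m1 C < +oo)%E ->
  @measurable _ X = <<s G >> -> setI_closed G -> (forall i, G (g i)) ->
  \bigcup_k g k = setT ->
  (forall A, G A -> m1 (f @^-1` A `&` C) = m2 (f @^-1` A `&` C)) ->
  forall A, measurable A -> m1 (f @^-1` A `&` C) = m2 (f @^-1` A `&` C).
Proof.
move=> mf mC fC mG GI Gg gT m12 A mA.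
pose fM := isMeasurableFun.Build _ _ _ _ _ mf.
pose f' : {mfun T >-> X} := HB.pack f fM.
apply: (@measure_unique _ R X G g mG GI Gg gT
  (pushforward (mrestr m1 mC) f') (pushforward (mrestr m2 mC) f')) => //.
move=> k; apply: le_lt_trans fC; rewrite /pushforward /mrestr.
have mgk : measurable (g k) by rewrite mG; exact: sub_sigma_algebra.
apply: le_measure; rewrite ?inE//; apply: measurableI => //.
by rewrite -[X in measurable X]setTI; exact: (measurable_funPT f').
Qed.

Lemma measure_eq_fiber_real (R : realType) d (T : measurableType d)
    (f : T -> measurableTypeR R) (C : set T) (m1 m2 : {measure set T -> \bar R}) :
  measurable_fun setT f -> measurable C -> (m1 C < +oo)%E ->
  (forall x : R, m1 (f @^-1` `]-oo, x[ `&` C) = m2 (f @^-1` `]-oo, x[ `&` C)) ->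
  forall A, measurable A -> m1 (f @^-1` A `&` C) = m2 (f @^-1` A `&` C).
Proof.
move=> mf mC fC m12.
apply: (@measure_eq_fiber _ _ _ _ _ f [set A | exists x : R, A = `]-oo, x[%classic]
  (fun k => `]-oo, k%:R[%classic)) => //.
- exact: RGenInftyO.measurableE.
- move=> _ _ [a ->] [b ->]; exists (Num.min a b).
  by apply/seteqP; split => t /=; rewrite !in_itv/= lt_min => /andP.
- by move=> k; exists k%:R.
- apply/seteqP; split => // t _; exists (Num.trunc `|t|).+1 => //=.
  by rewrite in_itv/= (le_lt_trans (ler_norm t))// truncnS_gt.
- by move=> _ [x ->].
Qed.

Lemma measure_eq_fiber_prod (R : realType) d d1 d2 (T : measurableType d)
    (X : measurableType d1) (Y : measurableType d2)
    (f : T -> (X * Y)%type) (C : set T) (m1 m2 : {measure set T -> \bar R}) :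
  measurable_fun setT f -> measurable C -> (m1 C < +oo)%E ->
  (forall A B, measurable A -> measurable B ->
     m1 (f @^-1` (A `*` B) `&` C) = m2 (f @^-1` (A `*` B) `&` C)) ->
  forall E, measurable E -> m1 (f @^-1` E `&` C) = m2 (f @^-1` E `&` C).
Proof.
move=> mf mC fC m12.
apply: (@measure_eq_fiber _ _ _ _ _ f
  [set A `*` B | A in measurable & B in measurable] (fun=> setT)) => //.
- exact: measurable_prod_measurableType.
- move=> _ _ [A1 mA1 [B1 mB1 <-]] [A2 mA2 [B2 mB2 <-]].
  exists (A1 `&` A2); first exact: measurableI.
  by exists (B1 `&` B2); [exact: measurableI|rewrite setXI].
- by move=> _; exists setT => //; exists setT => //; rewrite setXTT.
- by apply/seteqP; split => // t _; exists 0.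
- by move=> _ [A mA [B mB <-]]; exact: m12.
Qed.

Section Boxes.
Context {R : realType}.
Local Notation T := (space3 R).

Definition box (a b : T) : set T :=
  (`]a.1.1, b.1.1[ `*` `]a.1.2, b.1.2[) `*` `]a.2, b.2[.

Lemma measurable_box (a b : T) : measurable (box a b).
Proof. by apply: measurableX => //; apply: measurableX. Qed.

Definition cube (k : nat) : set T :=
  box (- k%:R, - k%:R, - k%:R) (k%:R, k%:R, k%:R).

Lemma bigcup_cube : \bigcup_k cube k = setT.
Proof.
apply/seteqP; split => // x _.
pose M := Num.max `|x.1.1| (Num.max `|x.1.2| `|x.2|).
exists (Num.trunc M).+1 => //.
have MM : M < (Num.trunc M).+1%:R by exact: truncnS_gt.
have c y : `|y| <= M -> y \in `](- (Num.trunc M).+1%:R), (Num.trunc M).+1%:R[ :> bool.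
  by move=> yM; rewrite in_itv/= -ltr_norml (le_lt_trans yM).
split; [split|]; apply: c; rewrite /M !le_max lexx ?orbT//.
Qed.

(* Boxes are traded for measurable sets one coordinate at a time. *)
Lemma measure_eq_boxes (m1 m2 : {measure set T -> \bar R}) (k : nat) :
  (m1 (cube k) < +oo)%E ->
  (forall a b, m1 (box a b) = m2 (box a b)) ->
  forall E, measurable E -> m1 (E `&` cube k) = m2 (E `&` cube k).
Proof.
move=> fin m12; pose I : set R := [set` `](- k%:R), k%:R[ ].
have cutI (x : R) : `]-oo, x[ `&` I = `](- k%:R), (Num.min x k%:R)[%classic.
  rewrite /I; apply/seteqP; split => t /=; rewrite !in_itv/= lt_min; first by move=> [-> /andP[-> ->]].
  by move=> /andP[-> /andP[-> ->]].
have mI (x y : R) : measurable (`]x, y[%classic : set (measurableTypeR R)) by [].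
have mO (x : R) : measurable (`]-oo, x[ `&` I : set (measurableTypeR R)) by rewrite cutI.
have mAI (A : set (measurableTypeR R)) : measurable A -> measurable (A `&` I : set (measurableTypeR R)).
  by move=> mA; exact: (measurableI _ _ mA (mI _ _)).
have mX (A B C : set (measurableTypeR R)) : measurable A -> measurable B -> measurable C ->
    measurable ((A `*` B) `*` C : set T).
  by move=> mA mB mC; apply: measurableX => //; exact: measurableX.
have finX (A B C : set (measurableTypeR R)) : measurable A -> measurable B -> measurable C ->
    A `<=` I -> B `<=` I -> C `<=` I -> (m1 ((A `*` B) `*` C) < +oo)%E.
  move=> mA mB mC AI BI CI; apply: le_lt_trans fin.
  apply: le_measure; rewrite ?inE; [exact: mX|exact: measurable_box|].
  by move=> [[x y] z] [[/= /AI ? /BI ?] /CI ?].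
have mp1 : measurable_fun setT (fun z : T => z.1.1).
  by apply: (measurableT_comp measurable_fst); exact: measurable_fst.
have mp2 : measurable_fun setT (fun z : T => z.1.2).
  by apply: (measurableT_comp measurable_snd); exact: measurable_fst.
have mp3 : measurable_fun setT (fun z : T => z.2) by exact: measurable_snd.
have mp4 : measurable_fun setT (fun z : T => z.1) by exact: measurable_fst.
have step1 (A : set (measurableTypeR R)) (x2 x3 : R) : measurable A ->
    m1 (((A `&` I) `*` (`]-oo, x2[ `&` I)) `*` (`]-oo, x3[ `&` I)) =
    m2 (((A `&` I) `*` (`]-oo, x2[ `&` I)) `*` (`]-oo, x3[ `&` I)).
  move=> mA; pose C := ((I `*` (`]-oo, x2[ `&` I)) `*` (`]-oo, x3[ `&` I)) : set T.
  have EC (B : set R) : ((B `&` I) `*` (`]-oo, x2[ `&` I)) `*` (`]-oo, x3[ `&` I) =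
      (fun z : T => z.1.1) @^-1` B `&` C.
    apply/seteqP; split => -[[x y] z] /=.
      by move=> [[[? ?] [? ?]] [? ?]].
    by move=> [? [[? [? ?]] [? ?]]].
  have mC : measurable C by apply: mX => //; first [exact: mO|exact: mI|exact: mAI].
  rewrite EC; apply: measure_eq_fiber_real => //.
    by apply: finX => //; try first [exact: mO|exact: mI|exact: mAI]; exact: subIsetr.
  move=> x; rewrite -EC !cutI.
  exact: (m12 (- k%:R, - k%:R, - k%:R) (_, _, _)).
have step2 (A B : set (measurableTypeR R)) (x3 : R) : measurable A -> measurable B ->
    m1 (((A `&` I) `*` (B `&` I)) `*` (`]-oo, x3[ `&` I)) =
    m2 (((A `&` I) `*` (B `&` I)) `*` (`]-oo, x3[ `&` I)).
  move=> mA mB; pose C := (((A `&` I) `*` I) `*` (`]-oo, x3[ `&` I)) : set T.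
  have EC (X : set R) : ((A `&` I) `*` (X `&` I)) `*` (`]-oo, x3[ `&` I) =
      (fun z : T => z.1.2) @^-1` X `&` C.
    apply/seteqP; split => -[[x y] z] /=.
      by move=> [[[? ?] [? ?]] [? ?]].
    by move=> [? [[[? ?] ?] [? ?]]].
  have mC : measurable C by apply: mX => //; first [exact: mO|exact: mI|exact: mAI].
  rewrite EC; apply: measure_eq_fiber_real => //.
    by apply: finX => //; try first [exact: mO|exact: mI|exact: mAI]; exact: subIsetr.
  by move=> x; rewrite -EC; exact: step1.
have step3 (A B C : set (measurableTypeR R)) : measurable A -> measurable B -> measurable C ->
    m1 (((A `&` I) `*` (B `&` I)) `*` (C `&` I)) =
    m2 (((A `&` I) `*` (B `&` I)) `*` (C `&` I)).
  move=> mA mB mC; pose D := (((A `&` I) `*` (B `&` I)) `*` I) : set T.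
  have EC (X : set R) : ((A `&` I) `*` (B `&` I)) `*` (X `&` I) =
      (fun z : T => z.2) @^-1` X `&` D.
    apply/seteqP; split => -[[x y] z] /=.
      by move=> [[[? ?] [? ?]] [? ?]].
    by move=> [? [[[? ?] [? ?]] ?]].
  have mD : measurable D by apply: mX => //; first [exact: mO|exact: mI|exact: mAI].
  rewrite EC; apply: measure_eq_fiber_real => //.
    by apply: finX => //; try first [exact: mO|exact: mI|exact: mAI]; exact: subIsetr.
  by move=> x; rewrite -EC; exact: step2.
have step4 (E : set (measurableTypeR R * measurableTypeR R)) (C : set (measurableTypeR R)) :
    measurable E -> measurable C ->
    m1 ((E `*` C) `&` cube k) = m2 ((E `*` C) `&` cube k).
  move=> mE mC; pose D := ((I `*` I) `*` (C `&` I)) : set T.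
  have EC (X : set (R * R)) : (X `*` C) `&` cube k = (fun z : T => z.1) @^-1` X `&` D.
    apply/seteqP; split => -[[x y] z] /=.
      by move=> [[? ?] [[? ?] ?]].
    by move=> [? [[? ?] [? ?]]].
  have mD : measurable D by apply: mX => //; first [exact: mO|exact: mI|exact: mAI].
  rewrite EC; apply: measure_eq_fiber_prod => //.
    by apply: finX => //; try first [exact: mO|exact: mI|exact: mAI]; exact: subIsetr.
  move=> A B mA mB; rewrite -EC.
  have -> : ((A `*` B) `*` C) `&` cube k = ((A `&` I) `*` (B `&` I)) `*` (C `&` I).
    apply/seteqP; split => -[[x y] z] /=.
      by move=> [[[? ?] ?] [[? ?] ?]].
    by move=> [[[? ?] [? ?]] [? ?]].
  exact: step3.
move=> E mE; have := @measure_eq_fiber_prod R _ _ _ T _ _ id (cube k) m1 m2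
  (@measurable_id _ _ _) (measurable_box _ _) fin step4 E mE.
by rewrite preimage_id.
Qed.

(** The positive and negative parts are densities of two measures that agree on boxes, hence on all
    measurable subsets of a cube. So [u] integrates to 0 over every such subset and vanishes almost
    everywhere on each cube. *)
Lemma ae_eq0_boxes (u : T -> R) :
  (forall a b, vol.-integrable (box a b) (EFin \o u)) -> measurable_fun setT u ->
  (forall a b, (\int[vol]_(x in box a b) (u x)%:E = 0)%E) ->
  {ae vol, forall x, u x = 0}.
Proof.
move=> iu mu u0.
have mp : measurable_fun setT u^\+ by exact: measurable_funrpos.
have mn : measurable_fun setT u^\- by exact: measurable_funrneg.
have p0 x : 0 <= u^\+ x by exact: funrpos_ge0.
have n0 x : 0 <= u^\- x by exact: funrneg_ge0.
pose m1 := density vol mp p0; pose m2 := density vol mn n0.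
have cubeE k : ae_eq vol (cube k) (EFin \o u) (cst 0%E).
  apply: integral_ae_eq => //; [exact: measurable_box|exact: iu|].
  move=> E EC mE; rewrite integral0.
  have iP (A : set T) : measurable A -> vol.-integrable A (EFin \o u) ->
      (\int[vol]_(x in A) (u x)%:E = m1 A - m2 A)%E /\ (m1 A < +oo)%E /\ (m2 A < +oo)%E.
    move=> mA iA; rewrite integralE funerpos funerneg; split=> //.
    have [/integrableP[_] + /integrableP[_]] := (integrable_funrpos mA iA, integrable_funrneg mA iA).
    rewrite /m1 /m2 /density; move=> h1 h2; split.
      by apply: le_lt_trans h1; rewrite le_eqVlt; apply/orP; left; apply/eqP;
        apply: eq_integral => x _; rewrite /= ger0_norm.
    by apply: le_lt_trans h2; rewrite le_eqVlt; apply/orP; left; apply/eqP;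
        apply: eq_integral => x _; rewrite /= ger0_norm.
  have fin0 (x y : \bar R) : (0 <= x)%E -> (0 <= y)%E -> (x < +oo)%E -> (y < +oo)%E ->
      (x - y = 0)%E <-> x = y.
    case: x y => [r| |] [s| |]//= _ _ _ _; rewrite -EFinB.
    by split => -[/eqP]; [rewrite subr_eq0 => /eqP ->|move/eqP ->; rewrite subrr].
  have m12 a b : m1 (box a b) = m2 (box a b).
    have [h [f1 f2]] := iP _ (measurable_box a b) (iu a b).
    by apply/(fin0 _ _ _ _ f1 f2); rewrite ?measure_ge0// -h u0.
  have iE : vol.-integrable E (EFin \o u) by exact: integrableS (measurable_box _ _) mE EC (iu _ _).
  have [-> [f1 f2]] := iP _ mE iE; apply/(fin0 _ _ _ _ f1 f2); rewrite ?measure_ge0//.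
  have [_ [fc _]] := iP _ (measurable_box _ _) (iu (- k%:R, - k%:R, - k%:R) (k%:R, k%:R, k%:R)).
  have := @measure_eq_boxes m1 m2 k fc m12 _ mE.
  by rewrite (setIidl EC).
have : vol.-negligible (\bigcup_k [set x | ~ (cube k x -> (u x)%:E = 0%E)]).
  by apply: negligible_bigcup => k; exact: cubeE.
apply: negligibleS => x /= ux.
have : [set: T] x by [].
rewrite -bigcup_cube => -[k _ kx]; exists k => //= h; apply: ux.
by have := h kx; case.
Qed.

Lemma coord_le_dist3 (x y : T) :
  [/\ `|x.1.1 - y.1.1| <= dist3 x y, `|x.1.2 - y.1.2| <= dist3 x y &
      `|x.2 - y.2| <= dist3 x y].
Proof.
have a0 := sqr_ge0 (x.1.1 - y.1.1); have b0 := sqr_ge0 (x.1.2 - y.1.2).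
have c0 := sqr_ge0 (x.2 - y.2).
by split; rewrite -sqrtr_sqr /dist3 /enorm /= ler_sqrt ?addr_ge0//;
  [rewrite -addrA lerDl addr_ge0|rewrite addrAC lerDr addr_ge0|rewrite lerDr addr_ge0].
Qed.

Lemma vol_planes (c : R) :
  [/\ vol.-negligible [set x : T | x.1.1 = c], vol.-negligible [set x : T | x.1.2 = c] &
      vol.-negligible [set x : T | x.2 = c]].
Proof.
have m1 : measurable ([set c] : set (measurableTypeR R)) by exact: measurable_set1.
have mT : measurable (setT : set (measurableTypeR R)) by [].
have null (A B C : set (measurableTypeR R)) (D : set T) : measurable A -> measurable B -> measurable C ->
    (lebesgue_measure A * lebesgue_measure B * lebesgue_measure C = 0)%E ->
    D `<=` (A `*` B) `*` C -> vol.-negligible D.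
  move=> mA mB mC ABC DA; exists ((A `*` B) `*` C); split => //.
    by apply: measurableX => //; exact: measurableX.
  rewrite /vol product_measure1E//; last exact: measurableX.
  by rewrite /vol2 [X in (X * _)%E]product_measure1E.
split; [apply: (@null [set c] setT setT)|apply: (@null setT [set c] setT)|
        apply: (@null setT setT [set c])] => //;
  rewrite ?lebesgue_measure_set1 ?mul0e ?mule0 ?mul0e//.
Qed.

Lemma same_side (u v w : R) : `|u - v| < `|v - w| -> (u < w) = (v < w) /\ (w < u) = (w < v).
Proof.
have [vw|vw|->] := ltgtP v w.
- rewrite (ltr0_norm (_ : v - w < 0)) ?subr_lt0// ltr_norml => /andP[h1 h2].
  have -> : u < w by lra.
  by split=> //; apply/negbTE; rewrite -leNgt; lra.
- rewrite (gtr0_norm (_ : 0 < v - w)) ?subr_gt0// ltr_norml => /andP[h1 h2].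
  have -> : w < u by lra.
  by split=> //; apply/negbTE; rewrite -leNgt; lra.
- by rewrite subrr normr0 ltNge normr_ge0.
Qed.

(** Off the six null planes carrying the faces a small ball lies on one side of each plane, so one
    of the two limit clauses of [approximate_identity] applies. *)
Lemma box_interior (a b : T) : {ae vol, forall y, exists2 d : R, 0 < d &
  forall x, dist3 x y < d -> (box a b x <-> box a b y)}.
Proof.
have [a1 [a2 a3]] := (vol_planes a.1.1, (vol_planes a.1.2, vol_planes a.2)).
have [b1 [b2 b3]] := (vol_planes b.1.1, (vol_planes b.1.2, vol_planes b.2)).
case: a1 a2 a3 b1 b2 b3 => [a1 _ _] [_ a2 _] [_ _ a3] [b1 _ _] [_ b2 _] [_ _ b3].
have N : vol.-negligible ((([set x : T | x.1.1 = a.1.1] `|` [set x : T | x.1.1 = b.1.1]) `|`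
   ([set x : T | x.1.2 = a.1.2] `|` [set x : T | x.1.2 = b.1.2])) `|`
   ([set x : T | x.2 = a.2] `|` [set x : T | x.2 = b.2])).
  by do ![exact: a1|exact: a2|exact: a3|exact: b1|exact: b2|exact: b3|apply: negligibleU].
apply: negligibleS N => y /=; apply: contra_notP => ny.
have [ne1 [ne2 [ne3 [ne4 [ne5 ne6]]]]] : y.1.1 != a.1.1 /\ y.1.1 != b.1.1 /\
    y.1.2 != a.1.2 /\ y.1.2 != b.1.2 /\ y.2 != a.2 /\ y.2 != b.2.
  by do !split; apply/eqP => e; apply: ny; rewrite e; tauto.
pose d (u v : R) := `|u - v|.
have d0 u v : u != v -> 0 < d u v by rewrite /d normr_gt0 subr_eq0.
pose m := Num.min (Num.min (Num.min (d y.1.1 a.1.1) (d y.1.1 b.1.1))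
                           (Num.min (d y.1.2 a.1.2) (d y.1.2 b.1.2)))
                  (Num.min (d y.2 a.2) (d y.2 b.2)).
exists m; first by rewrite !lt_min !d0.
move=> x; rewrite !lt_min => /andP[/andP[/andP[l1 l2] /andP[l3 l4]] /andP[l5 l6]].
have [c1 c2 c3] := coord_le_dist3 x y.
have [_ s1] := same_side (le_lt_trans c1 l1); have [s2 _] := same_side (le_lt_trans c1 l2).
have [_ s3] := same_side (le_lt_trans c2 l3); have [s4 _] := same_side (le_lt_trans c2 l4).
have [_ s5] := same_side (le_lt_trans c3 l5); have [s6 _] := same_side (le_lt_trans c3 l6).
by rewrite /box /= !in_itv/= s1 s2 s3 s4 s5 s6.
Qed.

Lemma box_bounded (a b : T) : exists M, forall x, box a b x -> dist3 x (0, 0, 0) <= M.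
Proof.
pose M := `|a.1.1| + `|b.1.1| + (`|a.1.2| + `|b.1.2|) + (`|a.2| + `|b.2|).
exists M => x [[/=]]; rewrite !in_itv/= => /andP[h1 h2] /andP[h3 h4] /andP[h5 h6].
have ab (u v w : R) : u < w -> w < v -> `|w| <= `|u| + `|v|.
  move=> uw wv; rewrite ler_norml.
  have := ler_norm v; have := ler_norm (- u); rewrite normrN.
  have := normr_ge0 u; have := normr_ge0 v; lra.
have M0 : 0 <= M by rewrite !addr_ge0.
rewrite /dist3 /enorm/= !subr0 -[leRHS](ger0_norm M0) -sqrtr_sqr ler_sqrt ?sqr_ge0//.
have [[x1 x2] x3] := (ab _ _ _ h1 h2, ab _ _ _ h3 h4, ab _ _ _ h5 h6).
rewrite -(real_normK (num_real x.1.1)) -(real_normK (num_real x.1.2)) -(real_normK (num_real x.2)).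
apply: (@le_trans _ _ ((`|x.1.1| + `|x.1.2| + `|x.2|) ^+ 2)).
  have := normr_ge0 x.1.1; have := normr_ge0 x.1.2; have := normr_ge0 x.2.
  by move: `|x.1.1| `|x.1.2| `|x.2| => u v w u0 v0 w0; nra.
by rewrite ler_pXn2r ?nnegrE ?addr_ge0// !lerD.
Qed.

End Boxes.

(** * Green representation of weak solutions *)

Section Kernels.
Context {R : realType}.
Local Notation T := (space3 R).

Lemma le_1DpowR (p t : R) : 1 <= p -> 0 <= t -> t <= 1 + t `^ p.
Proof.
move=> p1 t0; have [t1|t1] := leP t 1; first by rewrite (le_trans t1)// lerDl powR_ge0.
apply: (@le_trans _ _ (t `^ p)); last by rewrite lerDr.
by rewrite -{1}(powRr1 t0) ler_powR// ltW.
Qed.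

(** In place of Hoelder's inequality: [|u| <= 1 + |u|^p], where the constant is integrable against
    the exponential and the power on its own. *)
Lemma integral_expR_dist_Lp (p c : R) (u : T -> R) (x : T) : 1 <= p -> 0 < c ->
  measurable_fun setT u -> (\int[vol]_y (`|u y| `^ p)%:E < +oo)%E ->
  (\int[vol]_y (expR (- (c * dist3 x y)) * `|u y|)%:E < +oo)%E.
Proof.
move=> p1 c0 mu fu.
have md : measurable_fun setT (fun y : T => dist3 x y) by exact: measurable_fun_dist3.
have me : measurable_fun setT (fun y : T => expR (- (c * dist3 x y))).
  exact: (measurableT_comp (measurable_expR_scale _) md).
have ma : measurable_fun setT (fun y => `|u y|) by exact: measurableT_comp.
have mp : measurable_fun setT (fun y => `|u y| `^ p) by exact: measurable_powR_comp.
apply: (@le_lt_trans _ _ (\int[vol]_y ((expR (- (c * dist3 y x)))%:E + (`|u y| `^ p)%:E))%E).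
  apply: ge0_le_integral => //.
  - by apply/measurable_EFinP/measurable_funM.
  - apply: emeasurable_funD; apply/measurable_EFinP => //.
    by under eq_fun do rewrite dist3C.
  move=> y _; rewrite -EFinD lee_fin (dist3C y x).
  apply: (le_trans (ler_wpM2l (expR_ge0 _) (le_1DpowR p1 (normr_ge0 _)))).
  rewrite mulrDr mulr1 lerD2l ler_piMl ?powR_ge0//.
  by rewrite -[leRHS]expR0 ler_expR oppr_le0 mulr_ge0 ?dist3_ge0// ltW.
rewrite ge0_integralD//.
- by rewrite integral_expR_dist// lte_add_pinfty// ltry.
- by under eq_fun do rewrite dist3C; exact/measurable_EFinP.
- exact/measurable_EFinP.
Qed.

Lemma integrable_mul_kernel (p c K : R) (u k : T -> R) (x : T) : 1 <= p -> 0 < c ->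
  measurable_fun setT u -> (\int[vol]_y (`|u y| `^ p)%:E < +oo)%E ->
  measurable_fun setT k -> (forall y, `|k y| <= K * expR (- (c * dist3 x y))) ->
  vol.-integrable setT (EFin \o (fun y => u y * k y)).
Proof.
move=> p1 c0 mu fu mk kK.
have md : measurable_fun setT (fun y : T => dist3 x y) by exact: measurable_fun_dist3.
have me : measurable_fun setT (fun y : T => expR (- (c * dist3 x y))).
  exact: (measurableT_comp (measurable_expR_scale _) md).
have ma : measurable_fun setT (fun y => `|u y|) by exact: measurableT_comp.
have K0 : 0 <= K by rewrite -(pmulr_lge0 _ (expR_gt0 (- (c * dist3 x x)))) (le_trans _ (kK x)).
apply/integrableP; split; first exact/measurable_EFinP/measurable_funM.
apply: (@le_lt_trans _ _ (K%:E * \int[vol]_y (expR (- (c * dist3 x y)) * `|u y|)%:E)%E).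
  rewrite -ge0_integralZl ?lee_fin//; last first.
    by apply/measurable_EFinP/measurable_funM.
  apply: ge0_le_integral => //.
  - by apply/measurableT_comp => //; exact/measurable_EFinP/measurable_funM.
  - by apply: measurable_funeM; exact/measurable_EFinP/measurable_funM.
  move=> y _; rewrite lee_fin normrM mulrC mulrA.
  by rewrite ler_wpM2r.
by rewrite lte_mul_pinfty ?lee_fin//; exact: (integral_expR_dist_Lp _ p1).
Qed.

End Kernels.

Section BumpKernels.
Context {R : realType}.
Local Notation T := (space3 R).
Variables (a b : R).
Hypothesis a0 : 0 < a.

Definition bumpk e p q (x y : T) : R := bump0 a b e p q (dist3 x y ^+ 2 + e ^+ 2).
Definition resk e p q (x y : T) : R := residue a b e p q (dist3 x y ^+ 2 + e ^+ 2).

Lemma sqdist_dist3 (e : R) (x y : T) : sqdist e x y = dist3 x y ^+ 2 + e ^+ 2.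
Proof.
rewrite /sqdist /dist3 /enorm sqr_sqrtr ?addr_ge0 ?sqr_ge0//.
rewrite !big_ord_recl big_ord0 addr0 /coord3 /=.
by ring.
Qed.

Lemma dist3_le_sqrt (e : R) (x y : T) : dist3 x y <= Num.sqrt (dist3 x y ^+ 2 + e ^+ 2).
Proof.
rewrite -[leLHS](ger0_norm (dist3_ge0 x y)) -sqrtr_sqr ler_sqrt ?addr_ge0 ?sqr_ge0//.
by rewrite lerDl sqr_ge0.
Qed.

(** The lower bound [d] on the regularised distance is kept free: the true distance gives a
    domination by the Yukawa kernel uniform in [e], and [d = e] gives a bound without singularity
    for fixed [e]. *)
Lemma bumpk_norm e p q (x y : T) (d : R) : 0 < e -> 0 < d ->
  d <= Num.sqrt (dist3 x y ^+ 2 + e ^+ 2) ->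
  `|bumpk e p q x y| <= (`|p| + `|q|) * (expR (- (a * dist3 x y)) / (4 * pi * d)).
Proof.
move=> e0 d0; rewrite /bumpk /bump0 /prof0; have := dist3_le_sqrt e x y.
have es : e ^+ 2 <= dist3 x y ^+ 2 + e ^+ 2 by rewrite lerDr sqr_ge0.
have := cutoff_le1 es; have := cutoff_ge0 e (dist3 x y ^+ 2 + e ^+ 2).
move: (cutoff _ _) (Num.sqrt _) => c r c0 c1 xr dr; have p0 := pi_gt0 R.
have r0 : 0 < r by exact: lt_le_trans dr.
have b0 : 0 <= (4 * pi * r)^-1 by rewrite invr_ge0 !mulr_ge0// ltW.
rewrite normrM (ger0_norm c0) -mulrA -invfM (mulrC r) normrM (ger0_norm b0).
apply: (@le_trans _ _ (`|dexp a b p q r| / (4 * pi * r))).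
  by rewrite ler_piMl// mulr_ge0.
rewrite [leRHS]mulrA; apply: ler_pM => //.
  apply: (le_trans (dexp_norm _ _ _ _ _)); rewrite ler_wpM2l ?addr_ge0//.
  by rewrite ler_expR lerN2 ler_wpM2l// ltW.
have P0 : 0 < 4 * pi :> R by rewrite mulr_gt0.
by rewrite lef_pV2 ?posrE ?(mulr_gt0 P0)// ler_wpM2l// ltW.
Qed.

Lemma bumpk_yukawa e p q (x y : T) : 0 < e -> 0 < dist3 x y ->
  `|bumpk e p q x y| <= (`|p| + `|q|) * yukawa a (dist3 x y).
Proof. by move=> e0 d0; apply: bumpk_norm => //; exact: dist3_le_sqrt. Qed.

Lemma bumpk_expR e p q (x y : T) : 0 < e ->
  `|bumpk e p q x y| <= ((`|p| + `|q|) / (4 * pi * e)) * expR (- (a / 2 * dist3 x y)).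
Proof.
move=> e0; have p0 := pi_gt0 R.
have er : e <= Num.sqrt (dist3 x y ^+ 2 + e ^+ 2).
  by rewrite -[leLHS](ger0_norm (ltW e0)) -sqrtr_sqr ler_sqrt ?addr_ge0 ?sqr_ge0// lerDr sqr_ge0.
apply: (le_trans (bumpk_norm p q e0 e0 er)).
have P0 : 0 < 4 * pi * e by rewrite !mulr_gt0.
rewrite -[leRHS]mulrA ler_wpM2l ?addr_ge0// mulrC ler_wpM2l ?invr_ge0 ?(ltW P0)//.
rewrite ler_expR lerN2 ler_wpM2r ?dist3_ge0// ler_pdivrMr// ler_peMr ?(ltW a0)//.
by rewrite ler1n.
Qed.

Lemma resk_expR (e p q : R) : 0 < e -> e <= 1 ->
  exists K, forall x y : T, `|resk e p q x y| <= K * expR (- (a / 2 * dist3 x y)).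
Proof.
move=> e0 e1; have [C C0 CP] := residue_estimate b a0 p q.
exists (C * (approx e 0 + e)) => x y.
have [/le_trans + _] := CP e (dist3 x y) e0 e1 (dist3_ge0 x y); apply.
rewrite -[leRHS]mulrA ler_wpM2l// ler_wpM2r ?expR_ge0// lerD2r.
have p0 := pi_gt0 R; have P0 : 0 < 4 * pi :> R by rewrite mulr_gt0.
rewrite /approx expr0n/= add0r.
have s0 : 0 < Num.sqrt (e ^+ 2) by rewrite sqrtr_gt0 exprn_gt0.
have ss : Num.sqrt (e ^+ 2) <= Num.sqrt (dist3 x y ^+ 2 + e ^+ 2).
  by rewrite ler_sqrt ?addr_ge0 ?sqr_ge0// lerDr sqr_ge0.
apply: ler_wpM2l; first by rewrite mulr_ge0 ?sqr_ge0.
rewrite lef_pV2 ?posrE.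
- by rewrite ler_wpM2l ?(ltW P0)// lerXn2r ?nnegrE ?sqrtr_ge0.
- by rewrite (mulr_gt0 P0)// exprn_gt0// (lt_le_trans s0).
- by rewrite (mulr_gt0 P0)// exprn_gt0.
Qed.

Lemma measurable_bumpk e p q d (X : measurableType d) (f g : X -> T) :
  measurable_fun setT f -> measurable_fun setT g ->
  measurable_fun setT (fun z => bumpk e p q (f z) (g z)).
Proof.
move=> mf mg; apply: (measurableT_comp (profile_measurable (profile_bump0 a b e p q))).
by apply: measurable_funD => //; apply: measurable_funX; exact: measurable_fun_dist3.
Qed.

Lemma measurable_resk e p q d (X : measurableType d) (f g : X -> T) :
  measurable_fun setT f -> measurable_fun setT g ->
  measurable_fun setT (fun z => resk e p q (f z) (g z)).
Proof.
move=> mf mg; apply: (measurableT_comp (measurable_residue a b e p q)).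
by apply: measurable_funD => //; apply: measurable_funX; exact: measurable_fun_dist3.
Qed.

Lemma bumpk_linear e (p q : R) x y :
  bumpk e p q x y = p * bumpk e 1 0 x y + q * bumpk e 0 1 x y.
Proof.
rewrite /bumpk /bump0 /prof0 /dexp; move: (cutoff _ _) (Num.sqrt _) => c r.
move: (expR _) (cos _) (sin _) (4 * pi)^-1 (r^-1) => X C S w v.
by ring.
Qed.

Lemma laplacian_bumpk e (p q : R) x y : 0 < e ->
  \sum_(i < 3) partial i (partial i (bump a b e x p q)) y =
  ((a ^+ 2 - b ^+ 2) * p - (2 * a * b) * q) * bumpk e 1 0 x y +
  ((a ^+ 2 - b ^+ 2) * q + (2 * a * b) * p) * bumpk e 0 1 x y - resk e p q x y.
Proof.
move=> e0; rewrite laplacian_bump// /resk -sqdist_dist3; congr (_ - _).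
rewrite /bump sqdist_dist3 -/(bumpk _ _ _ _ _) bumpk_linear.
by rewrite /rot1 /rot2; congr (_ * _ + _ * _); ring.
Qed.

(* The real part of [- Delta w = h + (l1 + i l2) w] for [w = w1 + i w2], tested
   only against regularised fundamental solutions. *)
Definition weak_helmholtz (l1 l2 : R) (w1 w2 h1 : T -> R) :=
  forall (e p q : R) (x : T), 0 < e ->
    (\int[vol]_y (w1 y * \sum_(i < 3) partial i (partial i (bump a b e x p q)) y) =
     - \int[vol]_y ((h1 y + l1 * w1 y - l2 * w2 y) * bump a b e x p q y))%R.

(** The real part of the complex equation tested against the complex bump: the first equation uses
    the pair [1 0], the second [0 1]. Since [(a - i b)^2] is minus the spectral parameter, the terms
    in [a^2 - b^2] cancel within each equation and the cross terms in [2 a b] between the two. *)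
Lemma helmholtz_representation (p e : R) (w1 w2 h1 h2 : T -> R) (x : T) :
  1 <= p -> 0 < e -> e <= 1 ->
  measurable_fun setT w1 -> measurable_fun setT w2 ->
  measurable_fun setT h1 -> measurable_fun setT h2 ->
  (\int[vol]_y (`|w1 y| `^ p)%:E < +oo)%E -> (\int[vol]_y (`|w2 y| `^ p)%:E < +oo)%E ->
  (\int[vol]_y (`|h1 y| `^ p)%:E < +oo)%E -> (\int[vol]_y (`|h2 y| `^ p)%:E < +oo)%E ->
  weak_helmholtz (b ^+ 2 - a ^+ 2) (2 * a * b) w1 w2 h1 ->
  weak_helmholtz (b ^+ 2 - a ^+ 2) (2 * a * b) w2 (fun y => - w1 y) h2 ->
  (\int[vol]_y (w1 y * resk e 1 0 x y) - \int[vol]_y (w2 y * resk e 0 1 x y) =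
   \int[vol]_y (h1 y * bumpk e 1 0 x y) - \int[vol]_y (h2 y * bumpk e 0 1 x y))%R.
Proof.
move=> p1 e0 e1 mw1 mw2 mh1 mh2 iw1 iw2 ih1 ih2 weak1 weak2.
have a2 : 0 < a / 2 by rewrite divr_gt0.
have ib (u : T -> R) s t : measurable_fun setT u -> (\int[vol]_y (`|u y| `^ p)%:E < +oo)%E ->
    vol.-integrable setT (EFin \o (fun y => u y * bumpk e s t x y)).
  move=> mu iu; apply: (integrable_mul_kernel (x := x) p1 a2 mu iu).
    by apply: (@measurable_bumpk e s t _ _ (fun=> x) id).
  by move=> y; exact: bumpk_expR.
have ir (u : T -> R) s t : measurable_fun setT u -> (\int[vol]_y (`|u y| `^ p)%:E < +oo)%E ->
    vol.-integrable setT (EFin \o (fun y => u y * resk e s t x y)).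
  move=> mu iu; have [K KP] := resk_expR s t e0 e1.
  apply: (integrable_mul_kernel (x := x) p1 a2 mu iu) (KP x).
  by apply: (@measurable_resk e s t _ _ (fun=> x) id).
pose I (u : T -> R) (k : T -> T -> R) : R := (\int[vol]_y (u y * k x y))%R.
have lin (A B C : R) (f g h : T -> R) :
    vol.-integrable setT (EFin \o f) -> vol.-integrable setT (EFin \o g) ->
    vol.-integrable setT (EFin \o h) ->
    (\int[vol]_y (A * f y + B * g y + C * h y) =
     A * \int[vol]_y f y + B * \int[vol]_y g y + C * \int[vol]_y h y)%R.
  move=> If Ig Ih.
  have sc r f' : vol.-integrable setT (EFin \o f') ->
      vol.-integrable setT (EFin \o (fun y => r * f' y)).
    move=> If'; rewrite (_ : _ \o _ = (fun y => r%:E * (f' y)%:E)%E).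
      exact: integrableZl.
    by apply/funext => y /=; rewrite EFinM.
  have ad f' g' : vol.-integrable setT (EFin \o f') -> vol.-integrable setT (EFin \o g') ->
      vol.-integrable setT (EFin \o (fun y => f' y + g' y)).
    move=> If' Ig'; rewrite (_ : _ \o _ = (fun y => (f' y)%:E + (g' y)%:E)%E).
      exact: integrableD.
    by apply/funext => y /=; rewrite EFinD.
  rewrite RintegralD//; [|by apply: ad; exact: sc|exact: sc].
  rewrite RintegralD//; [|exact: sc|exact: sc].
  by rewrite !RintegralZl.
have expand (u v g : T -> R) (s t l1 l2 : R) :
    measurable_fun setT u -> (\int[vol]_y (`|u y| `^ p)%:E < +oo)%E ->
    measurable_fun setT v -> (\int[vol]_y (`|v y| `^ p)%:E < +oo)%E ->
    measurable_fun setT g -> (\int[vol]_y (`|g y| `^ p)%:E < +oo)%E ->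
    weak_helmholtz l1 l2 u v g ->
    ((a ^+ 2 - b ^+ 2) * s - (2 * a * b) * t) * I u (bumpk e 1 0) +
    ((a ^+ 2 - b ^+ 2) * t + (2 * a * b) * s) * I u (bumpk e 0 1) - I u (resk e s t) =
    - (I g (bumpk e s t) + l1 * I u (bumpk e s t) - l2 * I v (bumpk e s t)).
  move=> mu iu mv iv mg ig weak.
  have := weak e s t x e0.
  under eq_Rintegral do rewrite laplacian_bumpk//.
  rewrite (_ : (fun y => _) = (fun y =>
    ((a ^+ 2 - b ^+ 2) * s - (2 * a * b) * t) * (u y * bumpk e 1 0 x y) +
    ((a ^+ 2 - b ^+ 2) * t + (2 * a * b) * s) * (u y * bumpk e 0 1 x y) +
    (-1) * (u y * resk e s t x y))); last by apply/funext => y; ring.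
  rewrite lin; [|exact: ib|exact: ib|exact: ir].
  rewrite -!/(I _ _) mulN1r => ->.
  under eq_Rintegral do rewrite /bump sqdist_dist3 -/(bumpk _ _ _ _ _).
  rewrite (_ : (fun y => _) = (fun y => 1 * (g y * bumpk e s t x y) +
    l1 * (u y * bumpk e s t x y) + (- l2) * (v y * bumpk e s t x y))); last first.
    by apply/funext => y; ring.
  rewrite lin; [|exact: ib|exact: ib|exact: ib].
  by rewrite -!/(I _ _) mul1r mulNr.
have E1 := expand _ _ _ 1 0 _ _ mw1 iw1 mw2 iw2 mh1 ih1 weak1.
have mw1' : measurable_fun setT (fun y => - w1 y) by exact: measurableT_comp.
have iw1' : (\int[vol]_y (`|- w1 y| `^ p)%:E < +oo)%E.
  apply: le_lt_trans iw1; rewrite le_eqVlt; apply/orP; left; apply/eqP.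
  apply: eq_integral => y _.
  by rewrite normrN.
have E2 := expand _ _ _ 0 1 _ _ mw2 iw2 mw1' iw1' mh2 ih2 weak2.
rewrite -!/(I _ _).
have IN : I (fun y => - w1 y) (bumpk e 0 1) = - I w1 (bumpk e 0 1).
  rewrite /I -mulN1r -RintegralZl//; last exact: ib.
  by apply: eq_Rintegral => y _; ring.
rewrite IN in E2; move: E1 E2; rewrite !(mulr0, mulr1, subr0, addr0, sub0r, add0r).
move: (I _ _) (I _ _) (I _ _) (I _ _) (I _ _) (I _ _) (I _ _) (I _ _).
by move=> *; lra.
Qed.

End BumpKernels.

(** * Removing the regularisation, after integration over a box *)

Section ResidueLimit.
Context {R : realType}.
Local Notation T := (space3 R).
Local Notation vv := (@vol R \x @vol R)%E.
Variables (a b : R).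
Hypothesis a0 : 0 < a.

(** The cube matches [e = eta^3] in [approximate_identity], with [eta = 1/(n + 1)]. *)
Definition scale (n : nat) : R := (n.+1%:R)^-1 ^+ 3.

Lemma invS_gt0 (n : nat) : 0 < n.+1%:R^-1 :> R.
Proof. by rewrite invr_gt0. Qed.

Lemma invS_le1 (n : nat) : n.+1%:R^-1 <= 1 :> R.
Proof. by rewrite invf_le1// ler1n. Qed.

Lemma scale_gt0 n : 0 < scale n.
Proof. by rewrite exprn_gt0// invS_gt0. Qed.

Lemma scale_le1 n : scale n <= 1.
Proof. by rewrite exprn_ile1 ?invS_le1// ltW// invS_gt0. Qed.

(** Fubini moves the box integral onto the residue. Its value [J n y] tends to [p] inside the box
    and to 0 outside, off the faces, and decays in [y] uniformly in [n]. *)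
Lemma box_integral_residue (P p q : R) (w : T -> R) (s t : T) : 1 <= P ->
  measurable_fun setT w -> (\int[vol]_y (`|w y| `^ P)%:E < +oo)%E ->
  (forall n, vol.-integrable (box s t)
     (EFin \o (fun x => \int[vol]_y (w y * resk a b (scale n) p q x y))%R)) /\
  (\int[vol]_(x in box s t) (\int[vol]_y (w y * resk a b (scale n) p q x y))%R%:E)%E @[n --> \oo] -->
  (\int[vol]_(x in box s t) (p * w x)%:E)%E.
Proof.
move=> P1 mw iw; set D := box s t.
have mD : measurable D by exact: measurable_box.
have mI : measurable_fun setT (\1_D : T -> R) by exact: measurable_indic.
have a2 : 0 < a / 2 by rewrite divr_gt0.
have [M DM] := box_bounded s t.
have [C C0 CP] := approximate_identity b a0 p q mD DM.
have ik n x : vol.-integrable setT (EFin \o (fun y => w y * resk a b (scale n) p q x y)).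
  have [K KP] := resk_expR b a0 p q (scale_gt0 n) (scale_le1 n).
  apply: (integrable_mul_kernel (x := x) P1 a2 mw iw) (KP x).
  by apply: (@measurable_resk _ a b (scale n) p q _ _ (fun=> x) id).
pose F n (z : T * T) : \bar R := (\1_D z.1 * (w z.2 * resk a b (scale n) p q z.1 z.2))%:E.
have mF n : measurable_fun setT (F n).
  apply/measurable_EFinP; apply: measurable_funM.
    by apply: (measurableT_comp mI); exact: measurable_fst.
  apply: measurable_funM; first by apply: (measurableT_comp mw); exact: measurable_snd.
  by apply: measurable_resk; [exact: measurable_fst|exact: measurable_snd].
pose W y := (C * expR (- (a / 2 * dist3 y ((0, 0), 0))) * `|w y|)%:E.
have W0 y : (0 <= W y)%E by rewrite lee_fin !mulr_ge0 ?expR_ge0.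
have md : measurable_fun setT (fun y : T => dist3 y ((0, 0), 0)) by exact: measurable_fun_dist3.
have mW : measurable_fun setT W.
  apply/measurable_EFinP; apply: measurable_funM; last exact: measurableT_comp.
  by apply: measurable_funM => //; exact: (measurableT_comp (measurable_expR_scale _) md).
have iW : vol.-integrable setT W.
  apply/integrableP; split=> //.
  under eq_integral => y _ do rewrite gee0_abs// /W -mulrA EFinM.
  rewrite ge0_integralZl ?lee_fin//; last first.
    apply/measurable_EFinP; apply: measurable_funM; last exact: measurableT_comp.
    exact: (measurableT_comp (measurable_expR_scale _) md).
  rewrite lte_mul_pinfty ?lee_fin//.
  have := integral_expR_dist_Lp ((0, 0), 0) P1 a2 mw iw.
  by under eq_integral do rewrite dist3C.
have GW n y : (\int[vol]_x `|F n (x, y)| <= W y)%E.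
  have [_ LC _ _] := CP _ y (invS_gt0 n) (invS_le1 n).
  rewrite [leLHS](_ : _ = `|w y|%:E * \int[vol]_(x in D) `|(resk a b (scale n) p q x y)%:E|)%E.
    by rewrite /W mulrC EFinM; apply: lee_wpmul2l.
  rewrite -ge0_integralZl//; last first.
    apply/measurable_funTS/measurableT_comp => //; apply/measurable_EFinP.
    by apply: (@measurable_resk _ a b (scale n) p q _ _ id (fun=> y)).
  rewrite [RHS]integral_mkcond; apply: eq_integral => x _.
  rewrite patchE /F/= indicE; case: ifPn => xD.
    by rewrite mul1r normrM EFinM.
  by rewrite mul0r normr0.
have iF n : vv.-integrable setT (F n).
  apply/integrableP; split=> //.
  rewrite (fubini_tonelli2 (fun z => `|F n z|%E))//; last exact: measurableT_comp.
  move/integrableP: iW => [_]; apply: le_lt_trans.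
  apply: ge0_le_integral => //.
  - by move=> y _; exact: integral_ge0.
  - apply: (measurable_fun_fubini_tonelli_G (fun z => `|F n z|%E)) => //.
    exact: measurableT_comp.
  - exact: measurableT_comp.
  by move=> y _; rewrite gee0_abs//; exact: GW.
have FE n x : fubini_F vol (F n) x =
    (\1_D x * \int[vol]_y (w y * resk a b (scale n) p q x y))%R%:E.
  rewrite /fubini_F /F/= indicE; case: (x \in D).
    under eq_integral do rewrite mul1r.
    by rewrite mul1r [RHS]fineK//; exact: integrable_fin_num (ik n x).
  under eq_integral do rewrite mul0r.
  by rewrite mul0r integral0.
have mk0 (f : T -> R) : (\int[vol]_(x in D) (f x)%:E = \int[vol]_x (\1_D x * f x)%:E)%E.
  rewrite integral_mkcond; apply: eq_integral => x _.
  by rewrite patchE indicE; case: ifP => _; rewrite ?mul1r ?mul0r.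
split=> [n|].
  apply/integrable_mkcond => //.
  rewrite (_ : _ \_ _ = fubini_F vol (F n)); first exact: integrable_fubini_F.
  apply/funext => x; rewrite FE patchE indicE.
  by case: ifP => _; rewrite ?mul1r ?mul0r.
pose J n y := (\int[vol]_(x in D) resk a b (scale n) p q x y)%R.
have GE n y : fubini_G vol (F n) y = (w y * J n y)%:E.
  have [iL _ _ _] := CP _ y (invS_gt0 n) (invS_le1 n).
  rewrite /fubini_G /F/= -mk0 /J -RintegralZl//.
  rewrite /Rintegral fineK//; apply: integrable_fin_num => //.
  rewrite (_ : (fun _ => _) = (fun x => (w y)%:E * (resk a b (scale n) p q x y)%:E)%E).
    exact: integrableZl.
  by apply/funext => x; rewrite EFinM.
have -> : (fun n => \int[vol]_(x in D) (\int[vol]_y (w y * resk a b (scale n) p q x y))%R%:E)%E =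
    (fun n => \int[vol]_y (w y * J n y)%:E)%E.
  apply/funext => n; rewrite mk0.
  under eq_integral do rewrite -FE.
  rewrite integral12_prod_meas1// -integral21_prod_meas1//.
  by apply: eq_integral => y _; rewrite GE.
rewrite mk0.
under [X in _ --> X]eq_integral do rewrite mulrA (mulrC _ (w _)).
have [|||||_ _] := @dominated_convergence _ _ _ (@vol R) setT measurableT
  (fun n y => (w y * J n y)%:E) (fun y => (w y * (\1_D y * p))%:E) W.
- by move=> n; under eq_fun do rewrite -GE; exact: measurable_fubini_G.
- apply/measurable_EFinP; apply: measurable_funM => //.
  exact: measurable_funM.
- have := box_interior s t; apply: filterS => y [d d0 dP] _.
  apply: cvg_EFin; first exact: nearW.
  apply: cvgM; first exact: cvg_cst.
  have C1 : 0 < C + 1 by rewrite ltr_wpDl.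
  apply/cvgrPdist_le => e e0; near=> n.
  have nd : n.+1%:R^-1 < d.
    by near: n; exact: (near_infty_natSinv_lt (PosNum d0)).
  have ne : n.+1%:R^-1 < e / (C + 1).
    by near: n; exact: (near_infty_natSinv_lt (PosNum (divr_gt0 e0 C1))).
  have Ce : C * n.+1%:R^-1 <= e.
    apply: (@le_trans _ _ ((C + 1) * n.+1%:R^-1)).
      by rewrite ler_wpM2r ?ltW ?invS_gt0// ltrDl.
    by rewrite mulrC -ler_pdivlMr// ltW.
  have [_ _ Jin Jout] := CP _ y (invS_gt0 n) (invS_le1 n).
  apply: le_trans Ce; rewrite distrC indicE; have [yD|yD] := boolP (y \in D).
    rewrite mul1r; apply: Jin => x /= xy.
    by apply/(dP x); [exact: lt_trans xy nd|exact: set_mem].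
  rewrite mul0r subr0; apply: Jout; apply/seteqP; split => // x [Dx /= xy].
  have := (dP x (lt_trans xy nd)).1 Dx; move: yD; rewrite notin_setE.
  exact.
- exact: iW.
- apply/aeW => y n _; rewrite -GE; apply: le_trans (GW n y).
  apply: le_abse_integral => //.
  by apply: (measurableT_comp (mF n)); exact: measurable_pair2.
by [].
Unshelve. all: by end_near. Qed.

End ResidueLimit.

Section BumpLimit.
Context {R : realType}.
Local Notation T := (space3 R).
Variables (a b : R).
Hypothesis a0 : 0 < a.

(** The limit of [bumpk], without shift or cutoff. The pairs [1 0] and [0 1] give the real and
    imaginary parts of [exp (- (a - i b) d) / (4 pi d)] at distance [d]. *)
Definition greenk p q (x y : T) : R := prof0 a b p q (dist3 x y ^+ 2).

Lemma measurable_greenk p q d (X : measurableType d) (f g : X -> T) :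
  measurable_fun setT f -> measurable_fun setT g ->
  measurable_fun setT (fun z => greenk p q (f z) (g z)).
Proof.
move=> mf mg; have P : profile a b 0 (prof0 a b p q).
  rewrite (_ : prof0 a b p q = fun s =>
    dexp a b p q (Num.sqrt s) * (Num.sqrt s)^-1 * (4 * pi)^-1)//.
  by do ![exact: profile_cst|exact: profile_sqrtV|exact: profile_dexp|apply: profile_mul].
apply: (measurableT_comp (profile_measurable P)).
by apply: measurable_funX; exact: measurable_fun_dist3.
Qed.

Lemma scale_sqr_cvg0 : (@scale R n ^+ 2) @[n --> \oo] --> (0 : R).
Proof.
have h : (n.+1%:R^-1 : R) @[n --> \oo] --> (0 : R) by exact: cvg_harmonic.
rewrite [X in _ --> X](_ : _ = (0 * 0 * 0) * (0 * 0 * 0) :> R); last by rewrite !mul0r.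
rewrite (_ : (fun n => _) = (fun n => (n.+1%:R^-1 * n.+1%:R^-1 * n.+1%:R^-1) *
  (n.+1%:R^-1 * n.+1%:R^-1 * n.+1%:R^-1) : R)).
  by apply: cvgM; apply: cvgM => //; apply: cvgM.
by apply/funext => n; rewrite /scale; ring.
Qed.

Lemma bumpk_cvg p q (x y : T) : 0 < dist3 x y ->
  bumpk a b (scale n) p q x y @[n --> \oo] --> greenk p q x y.
Proof.
move=> d0; rewrite -[X in _ --> X]mul1r /bumpk /bump0.
set s := fun n => dist3 x y ^+ 2 + @scale R n ^+ 2.
have scvg : s n @[n --> \oo] --> dist3 x y ^+ 2.
  rewrite -[X in _ --> X]addr0; apply: cvgD; first exact: cvg_cst.
  exact: scale_sqr_cvg0.
apply: cvgM; last first.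
  have s0 : 0 < dist3 x y ^+ 2 by rewrite exprn_gt0.
  have cp : {for dist3 x y ^+ 2, continuous (prof0 a b p q)}.
    apply/differentiable_continuous/derivable1_diffP.
    by case: (is_derive_prof0 a b p q s0).
  exact: (cvg_comp _ _ scvg cp).
apply/cvgrPdist_le => eps eps0; near=> n.
have es : @scale R n ^+ 2 <= s n by rewrite lerDr sqr_ge0.
rewrite distrC; apply: le_trans (cutoff_near es) _.
rewrite /s addrK -mulrA mulrCA.
near: n.
pose c := 2 * expR 1 * dist3 x y ^+ 2 : R.
have : (@scale R n ^+ 2 * c) @[n --> \oo] --> (0 : R).
  by rewrite -[X in _ --> X](mul0r c); apply: cvgM; [exact: scale_sqr_cvg0|exact: cvg_cst].
move/cvgrPdist_le => /(_ _ eps0); apply: filterS => n.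
rewrite sub0r normrN => h; apply: le_trans (le_trans (ler_norm _) h).
by rewrite /c.
Unshelve. all: by end_near. Qed.

(** A coordinate plane through [x] is null and contains the exceptional point. *)
Lemma ae_dist3_gt0 (x : T) : {ae vol, forall y, 0 < dist3 x y}.
Proof.
have [N _ _] := vol_planes x.1.1; apply: negligibleS N => y /= h.
apply: contrapT => yx; apply: h.
have [+ _ _] := coord_le_dist3 x y; apply: lt_le_trans.
by rewrite normr_gt0 subr_eq0; apply/eqP => e; exact: yx.
Qed.

Lemma measurable_partial_integral (f : T * T -> \bar R) : measurable_fun setT f ->
  measurable_fun setT (fun x => \int[@vol R]_y f (x, y))%E.
Proof.
move=> mf.
rewrite (_ : (fun x => _) = (fun x => \int[@vol R]_y f^\+ (x, y) - \int[@vol R]_y f^\- (x, y))%E).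
  apply: emeasurable_funB.
    apply: (measurable_fun_fubini_tonelli_F (funepos f)) => //.
    exact: measurable_funepos.
  apply: (measurable_fun_fubini_tonelli_F (funeneg f)) => //.
  exact: measurable_funeneg.
apply/funext => x; rewrite [LHS]integralE.
by congr (_ - _)%E; apply: eq_integral => y _; rewrite ?funeposE ?funenegE.
Qed.

(** On pairs, the indicator times [|h|] is at most the indicator plus [|h|^P]; the kernel has
    bounded mass in either variable, so both parts integrate to something finite. *)
Lemma box_integral_potential (P : R) (h : T -> R) (s t : T) : 1 <= P ->
  measurable_fun setT h -> (\int[vol]_y (`|h y| `^ P)%:E < +oo)%E ->
  (\int[vol]_(x in box s t) potential (yukawa_kernel a) (fun y => `|h y|%R) x < +oo)%E.
Proof.
move=> P1 mh ih; set D := box s t; set k := yukawa_kernel a.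
have mD : measurable D by exact: measurable_box.
have mk : measurable_fun setT k by exact: measurable_yukawa_kernel.
have k0 z : 0 <= k z by exact: yukawa_kernel_ge0.
have mI : measurable_fun setT (\1_D : T -> R) by exact: measurable_indic.
have ma : measurable_fun setT (fun y => `|h y|) by exact: measurableT_comp.
have mp : measurable_fun setT (fun y => `|h y| `^ P) by exact: measurable_powR_comp.
have m13 : 0 < (1 : R) < 3 by rewrite ltr01 ltr1n.
have K1 x : (\int[vol]_y (k (x, y))%:E <= (yukawa_moment a 1)%:E)%E.
  rewrite -(integral_yukawa_kernel1 x a0 m13).
  by rewrite le_eqVlt; apply/orP; left; apply/eqP; apply: eq_integral => y _; rewrite powRr1.
have K2 y : (\int[vol]_x (k (x, y))%:E <= (yukawa_moment a 1)%:E)%E.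
  rewrite -(integral_yukawa_kernel2 y a0 m13).
  by rewrite le_eqVlt; apply/orP; left; apply/eqP; apply: eq_integral => x _; rewrite powRr1.
have mk1 (g : T -> R) : measurable_fun setT g ->
    measurable_fun setT (fun z : T * T => (k z * g z.1)%:E).
  move=> mg; apply/measurable_EFinP/measurable_funM => //.
  by apply: (measurableT_comp mg); exact: measurable_fst.
have mk2 (g : T -> R) : measurable_fun setT g ->
    measurable_fun setT (fun z : T * T => (k z * g z.2)%:E).
  move=> mg; apply/measurable_EFinP/measurable_funM => //.
  by apply: (measurableT_comp mg); exact: measurable_snd.
have mpot : measurable_fun setT (potential k (fun y => `|h y|)).
  exact: measurable_potential.
have I0 x : 0 <= \1_D x :> R by rewrite indicE.
apply: (@le_lt_trans _ _ (\int[vol]_x ((\1_D x)%:E * potential k (fun y => `|h y|%R) x))%E).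
  rewrite integral_mkcond le_eqVlt; apply/orP; left; apply/eqP; apply: eq_integral => x _.
  by rewrite patchE indicE; case: ifP => _; rewrite ?mul1e ?mul0e.
rewrite (integral_mul_potential mk k0 mI I0 ma)//.
apply: (@le_lt_trans _ _ (\int[@vol R \x @vol R]_z ((k z * \1_D z.1)%:E + (k z * `|h z.2| `^ P)%:E))%E).
  apply: ge0_le_integral => //.
  - by move=> z _; rewrite lee_fin; apply: mulr_ge0 => //; exact: mulr_ge0.
  - apply/measurable_EFinP/measurable_funM.
      by apply: (measurableT_comp mI); exact: measurable_fst.
    by apply: measurable_funM => //; apply: (measurableT_comp ma); exact: measurable_snd.
  - by apply: emeasurable_funD; [exact: (mk1 _ mI)|exact: (mk2 _ mp)].
  move=> z _; rewrite -EFinD lee_fin -mulrDr mulrCA ler_wpM2l//.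
  rewrite indicE; case: (z.1 \in D); rewrite ?mul1r ?mul0r ?add0r ?powR_ge0//.
  exact: le_1DpowR.
rewrite ge0_integralD//; last 4 first.
- by move=> z _; rewrite lee_fin mulr_ge0.
- exact: (mk1 _ mI).
- by move=> z _; rewrite lee_fin mulr_ge0 ?powR_ge0.
- exact: (mk2 _ mp).
have M0 : 0 <= yukawa_moment a 1 by rewrite ltW// yukawa_moment_gt0.
apply: lte_add_pinfty.
  apply: le_lt_trans (integral_pair_kernel1 mk k0 mI I0 K1) _.
  rewrite lte_mul_pinfty ?lee_fin// integral_indic// setIT.
  have [M DM] := box_bounded s t; exact: vol_bounded mD DM.
apply: le_lt_trans (integral_pair_kernel2 mk k0 mp _ K2) _; first by move=> x; exact: powR_ge0.
by rewrite lte_mul_pinfty ?lee_fin.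
Qed.

(** Dominated convergence is used twice: in [y] at almost every [x] of the box, where the Yukawa
    potential of [|h|] is finite, then in [x] with that potential as majorant. *)
Lemma box_integral_bump (P p q : R) (h : T -> R) (s t : T) : 1 <= P ->
  measurable_fun setT h -> (\int[vol]_y (`|h y| `^ P)%:E < +oo)%E ->
  [/\ forall n, vol.-integrable (box s t)
        (EFin \o (fun x => \int[vol]_y (h y * bumpk a b (scale n) p q x y))%R),
      vol.-integrable (box s t) (EFin \o (fun x => \int[vol]_y (h y * greenk p q x y))%R) &
      (\int[vol]_(x in box s t) (\int[vol]_y (h y * bumpk a b (scale n) p q x y))%R%:E)%E
        @[n --> \oo] -->
      (\int[vol]_(x in box s t) (\int[vol]_y (h y * greenk p q x y))%R%:E)%E].
Proof.
move=> P1 mh ih; set D := box s t; set k := yukawa_kernel a.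
have mD : measurable D by exact: measurable_box.
have a2 : 0 < a / 2 by rewrite divr_gt0.
have mk : measurable_fun setT k by exact: measurable_yukawa_kernel.
have k0 z : 0 <= k z by exact: yukawa_kernel_ge0.
have ma : measurable_fun setT (fun y => `|h y|) by exact: measurableT_comp.
have ik n x : vol.-integrable setT (EFin \o (fun y => h y * bumpk a b (scale n) p q x y)).
  apply: (integrable_mul_kernel (x := x) P1 a2 mh ih).
    by apply: (@measurable_bumpk _ a b (scale n) p q _ _ (fun=> x) id).
  by move=> y; apply: bumpk_expR => //; exact: scale_gt0.
pose f n x : \bar R := (\int[vol]_y (h y * bumpk a b (scale n) p q x y)%:E)%E.
pose g x : \bar R := (\int[vol]_y (h y * greenk p q x y)%:E)%E.
pose U x : \bar R := ((`|p| + `|q|)%:E * potential k (fun y => `|h y|%R) x)%E.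
have mpair (l : T -> T -> R) : measurable_fun setT (fun z : T * T => l z.1 z.2) ->
    measurable_fun setT (fun x => \int[@vol R]_y (h y * l x y)%:E)%E.
  move=> ml; apply: (measurable_partial_integral (f := fun z => (h z.2 * l z.1 z.2)%:E)).
  apply/measurable_EFinP/measurable_funM => //.
  by apply: (measurableT_comp mh); exact: measurable_snd.
have mf n : measurable_fun setT (f n).
  apply: mpair; apply: measurable_bumpk; [exact: measurable_fst|exact: measurable_snd].
have mg : measurable_fun setT g.
  apply: mpair; apply: measurable_greenk; [exact: measurable_fst|exact: measurable_snd].
have mpot : measurable_fun setT (potential k (fun y => `|h y|)).
  exact: measurable_potential.
have mU : measurable_fun setT U by exact: measurable_funeM.
have pot0 x : (0 <= potential k (fun y => `|h y|%R) x)%E.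
  by apply: integral_ge0 => y _; rewrite lee_fin mulr_ge0.
have pq0 : 0 <= `|p| + `|q| by rewrite addr_ge0.
have U0 x : (0 <= U x)%E by rewrite mule_ge0 ?lee_fin.
have iU : vol.-integrable D U.
  apply/integrableP; split; first exact: measurable_funTS.
  under eq_integral do rewrite gee0_abs//.
  rewrite ge0_integralZl ?lee_fin//; last exact: measurable_funTS.
  by rewrite lte_mul_pinfty ?lee_fin ?integral_ge0//; exact: (box_integral_potential _ _ P1 mh ih).
have fU n x : (`|f n x| <= U x)%E.
  have /integrableP[mi _] := ik n x.
  apply: (le_trans (le_abse_integral _ _ mi)) => //.
  rewrite /U /potential -ge0_integralZl ?lee_fin//; last 2 first.
  - apply/measurable_EFinP/measurable_funM => //; exact: measurable_fun_pair2.
  - by move=> y _; rewrite lee_fin mulr_ge0.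
  apply: ae_ge0_le_integral => //.
  - exact: measurableT_comp.
  - by move=> y _; apply: mule_ge0; rewrite lee_fin// mulr_ge0.
  - apply: measurable_funeM; apply/measurable_EFinP/measurable_funM => //; exact: measurable_fun_pair2.
  apply: filterS (ae_dist3_gt0 x) => y xy _; rewrite -EFinM lee_fin normrM mulrC mulrA ler_wpM2r//.
  by apply: bumpk_yukawa => //; exact: scale_gt0.
have fg : {ae vol, forall x, D x -> f ^~ x @ \oo --> g x}.
  have := integrable_ae mD iU; apply: filterS => x /[apply] Ux.
  have mbx n : measurable_fun setT (fun y => (h y * bumpk a b (scale n) p q x y)%:E).
    by apply/measurable_EFinP; case/integrableP: (ik n x) => /measurable_EFinP.
  have mkx : measurable_fun setT (fun y => (k (x, y) * `|h y|)%:E).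
    by apply/measurable_EFinP/measurable_funM => //; exact: measurable_fun_pair2.
  have [|||||//] := @dominated_convergence _ _ _ (@vol R) setT measurableT
    (fun n y => (h y * bumpk a b (scale n) p q x y)%:E) (fun y => (h y * greenk p q x y)%:E)
    (fun y => (`|p| + `|q|)%:E * (k (x, y) * `|h y|)%:E)%E.
  - exact: mbx.
  - apply/measurable_EFinP/measurable_funM => //.
    by apply: (@measurable_greenk p q _ _ (fun=> x) id).
  - apply: filterS (ae_dist3_gt0 x) => y xy _; apply: cvg_EFin; first exact: nearW.
    by apply: cvgM; [exact: cvg_cst|exact: bumpk_cvg].
  - apply/integrableP; split; first exact: measurable_funeM.
    have g0 y : (0 <= (`|p| + `|q|)%:E * (k (x, y) * `|h y|)%:E)%E.
      by apply: mule_ge0; rewrite lee_fin// mulr_ge0.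
    under eq_integral => y _ do rewrite (gee0_abs (g0 y)).
    rewrite ge0_integralZl ?lee_fin//; last by move=> y _; rewrite lee_fin mulr_ge0.
    by move: Ux; rewrite (ge0_fin_numE (U0 x)).
  - apply: filterS (ae_dist3_gt0 x) => y xy n _.
    rewrite -EFinM lee_fin normrM mulrC mulrA ler_wpM2r//.
    by apply: bumpk_yukawa => //; exact: scale_gt0.
have [|||||ig _ cvg] := @dominated_convergence _ _ _ (@vol R) D mD f g U.
- by move=> n; exact: measurable_funTS.
- exact: measurable_funTS.
- exact: fg.
- exact: iU.
- by apply: aeW => x n _; exact: fU.
have fE n x : (\int[vol]_y (h y * bumpk a b (scale n) p q x y))%R%:E = f n x.
  by rewrite fineK//; exact: integrable_fin_num (ik n x).
(* The real-valued integral reads infinite values as 0. This only decreases the modulus, and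
   integrability makes the inner integral finite almost everywhere. *)
have fin_le (x : \bar R) : (`|(fine x)%:E| <= `|x|)%E by case: x => [r| |] //=; rewrite ?normr0 ?leey.
have mfg : measurable_fun setT (fun x => (fine (g x))%:E).
  by apply/measurable_EFinP; exact: (measurableT_comp (fine_measurable _)).
split=> [n||].
- apply: le_integrable iU => //.
    rewrite (_ : _ \o _ = f n); last by apply/funext => x /=; rewrite fE.
    exact: measurable_funTS.
  by move=> x _; rewrite (gee0_abs (U0 x)); apply: le_trans (fU n x); rewrite -fE.
- apply: le_integrable ig => //; first exact: measurable_funTS.
  by move=> x _; exact: fin_le.
- under eq_fun do under eq_integral do rewrite fE.
  rewrite (_ : (\int[vol]_(x in D) _)%E = (\int[vol]_(x in D) g x)%E)//.
  apply: ae_eq_integral => //; [exact: measurable_funTS|exact: measurable_funTS|].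
  have := integrable_ae mD ig; apply: filterS => x /[apply] gx.
  by rewrite /Rintegral -/(g x) fineK.
Qed.

End BumpLimit.

Section GreenRepresentation.
Context {R : realType}.
Local Notation T := (space3 R).

(** When the positive or the negative part has infinite integral, both sides take the default value
    0; otherwise signs are exchanged between the two parts. *)
Lemma RintegralN_total d (X : measurableType d) (m : {measure set X -> \bar R}) (D : set X) (f : X -> R) :
  (\int[m]_(x in D) - f x = - \int[m]_(x in D) f x)%R.
Proof.
rewrite /Rintegral (integralE _ _ (fun x => (- f x)%:E)) (integralE _ _ (fun x => (f x)%:E)).
rewrite (_ : (fun x => (- f x)%:E) = (\- (EFin \o f))%E)//.
rewrite funeposN funenegN.
have : (0 <= \int[m]_(x in D) (EFin \o f)^\+ x)%E by apply: integral_ge0 => x _; exact: funepos_ge0.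
have : (0 <= \int[m]_(x in D) (EFin \o f)^\- x)%E by apply: integral_ge0 => x _; exact: funeneg_ge0.
move: (\int[m]_(x in D) _)%E (\int[m]_(x in D) _)%E => [u| |] [v| |] //= _ _; rewrite ?oppr0//.
by rewrite opprB.
Qed.

Lemma integrable_box_Lp (P : R) (w : T -> R) (s t : T) : 1 <= P ->
  measurable_fun setT w -> (\int[vol]_y (`|w y| `^ P)%:E < +oo)%E ->
  vol.-integrable (box s t) (EFin \o w).
Proof.
move=> P1 mw iw; have mD : measurable (box s t) by exact: measurable_box.
have ma : measurable_fun setT (fun y => `|w y|) by exact: measurableT_comp.
have mp : measurable_fun setT (fun y => `|w y| `^ P) by exact: measurable_powR_comp.
apply/integrableP; split; first exact/measurable_funTS/measurable_EFinP.
apply: (@le_lt_trans _ _ (\int[vol]_(x in box s t) (1%:E + (`|w x| `^ P)%:E))%E).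
  apply: ge0_le_integral => //.
  - exact/measurable_funTS/measurable_EFinP.
  - by apply/measurable_funTS/emeasurable_funD => //; exact/measurable_EFinP.
  by move=> x _; rewrite -EFinD lee_fin le_1DpowR.
rewrite ge0_integralD//; last exact/measurable_funTS/measurable_EFinP.
have [M DM] := box_bounded s t.
rewrite integral_cst// mul1e lte_add_pinfty ?(vol_bounded mD DM)//.
apply: le_lt_trans iw; apply: ge0_subset_integral => //.
exact/measurable_EFinP.
Qed.

Variables (a b : R).
Hypothesis a0 : 0 < a.

Definition green (h : T -> R) p q (x : T) : R := (\int[vol]_y (h y * greenk a b p q x y))%R.

Lemma measurable_green h p q : measurable_fun setT h -> measurable_fun setT (green h p q).
Proof.
move=> mh; apply: (measurableT_comp (fine_measurable _)) => //.
apply: (measurable_partial_integral (f := fun z => (h z.2 * greenk a b p q z.1 z.2)%:E)).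
apply/measurable_EFinP/measurable_funM.
  by apply: (measurableT_comp mh); exact: measurable_snd.
by apply: measurable_greenk; [exact: measurable_fst|exact: measurable_snd].
Qed.

(* Both sides have the same integral over every box. *)
Lemma helmholtz_green (P : R) (w1 w2 h1 h2 : T -> R) : 1 <= P ->
  measurable_fun setT w1 -> measurable_fun setT w2 ->
  measurable_fun setT h1 -> measurable_fun setT h2 ->
  (\int[vol]_y (`|w1 y| `^ P)%:E < +oo)%E -> (\int[vol]_y (`|w2 y| `^ P)%:E < +oo)%E ->
  (\int[vol]_y (`|h1 y| `^ P)%:E < +oo)%E -> (\int[vol]_y (`|h2 y| `^ P)%:E < +oo)%E ->
  weak_helmholtz a b (b ^+ 2 - a ^+ 2) (2 * a * b) w1 w2 h1 ->
  weak_helmholtz a b (b ^+ 2 - a ^+ 2) (2 * a * b) w2 (fun y => - w1 y) h2 ->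
  {ae vol, forall x, w1 x = green h1 1 0 x - green h2 0 1 x}.
Proof.
move=> P1 mw1 mw2 mh1 mh2 iw1 iw2 ih1 ih2 weak1 weak2.
pose u x := w1 x - (green h1 1 0 x - green h2 0 1 x).
suff : {ae vol, forall x, u x = 0}.
  by apply: filterS => x /eqP; rewrite /u subr_eq0 => /eqP.
have dec s t := box_integral_bump b a0 1 0 s t P1 mh1 ih1.
have dec2 s t := box_integral_bump b a0 0 1 s t P1 mh2 ih2.
have iD f g (D : set T) : measurable D -> vol.-integrable D (EFin \o f) ->
    vol.-integrable D (EFin \o g) -> vol.-integrable D (EFin \o (fun x => f x - g x)).
  move=> mD If Ig; rewrite (_ : _ \o _ = (fun y => (f y)%:E - (g y)%:E)%E).
    exact: integrableB.
  by apply/funext => y /=; rewrite EFinB.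
have iu s t : vol.-integrable (box s t) (EFin \o u).
  have mD := measurable_box s t.
  have [_ i1 _] := dec s t; have [_ i2 _] := dec2 s t.
  by apply: (iD) => //; [exact: (integrable_box_Lp _ _ P1)|exact: iD].
apply: ae_eq0_boxes => //.
  by do 2 apply: measurable_funB => //; exact: measurable_green.
move=> s t; have mD := measurable_box s t.
have iw := integrable_box_Lp s t P1 mw1 iw1.
have [j1 i1 c1] := dec s t; have [j2 i2 c2] := dec2 s t.
have [k1 d1] := box_integral_residue b a0 1 0 s t P1 mw1 iw1.
have [k2 d2] := box_integral_residue b a0 0 1 s t P1 mw2 iw2.
have e2 : (\int[vol]_(x in box s t) (0 * w2 x)%:E = 0)%E.
  by apply: integral0_eq => x _; rewrite mul0r.
have e1 : (\int[vol]_(x in box s t) (1 * w1 x)%:E = \int[vol]_(x in box s t) (w1 x)%:E)%E.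
  by apply: eq_integral => x _; rewrite mul1r.
rewrite e1 in d1; rewrite e2 in d2.
have fw : (\int[vol]_(x in box s t) (w1 x)%:E)%E \is a fin_num by exact: integrable_fin_num iw.
have f1 : (\int[vol]_(x in box s t) (green h1 1 0 x)%:E)%E \is a fin_num by exact: integrable_fin_num i1.
have f2 : (\int[vol]_(x in box s t) (green h2 0 1 x)%:E)%E \is a fin_num by exact: integrable_fin_num i2.
have L := @cvgeB _ _ eventually_filter _ _ _ _ _ (fin_num_adde_defr _ fw) d1 d2.
have L' := @cvgeB _ _ eventually_filter _ _ _ _ _ (fin_num_adde_defr _ f1) c1 c2.
have E : (\int[vol]_(x in box s t) (w1 x)%:E =
    \int[vol]_(x in box s t) (green h1 1 0 x)%:E - \int[vol]_(x in box s t) (green h2 0 1 x)%:E)%E.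
  have XY n : (\int[vol]_(x in box s t) (\int[vol]_y (w1 y * resk a b (scale n) 1 0 x y))%R%:E -
      \int[vol]_(x in box s t) (\int[vol]_y (w2 y * resk a b (scale n) 0 1 x y))%R%:E =
      \int[vol]_(x in box s t) (\int[vol]_y (h1 y * bumpk a b (scale n) 1 0 x y))%R%:E -
      \int[vol]_(x in box s t) (\int[vol]_y (h2 y * bumpk a b (scale n) 0 1 x y))%R%:E)%E.
    rewrite -(integralB_EFin mD (k1 n) (k2 n)) -(integralB_EFin mD (j1 n) (j2 n)).
    apply: eq_integral => x _; rewrite -!EFinB.
    by rewrite (helmholtz_representation a0 x P1 (scale_gt0 n) (scale_le1 n) mw1 mw2 mh1 mh2 iw1 iw2 ih1 ih2 weak1 weak2).
  move: L; rewrite (funext XY) => L.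
  rewrite -[LHS]sube0; exact: (cvg_unique (@ereal_hausdorff R) L L').
transitivity (\int[vol]_(x in box s t) (w1 x)%:E -
   \int[vol]_(x in box s t) (green h1 1 0 x - green h2 0 1 x)%:E)%E.
  by rewrite -integralB_EFin//; exact: iD.
rewrite [X in (_ - X)%E]integralB_EFin//.
by rewrite -E subee.
Qed.

Lemma greenk_norm (x y : T) :
  greenk a b 1 0 x y ^+ 2 + greenk a b 0 1 x y ^+ 2 = yukawa a (dist3 x y) ^+ 2.
Proof.
rewrite /greenk /prof0 /dexp /yukawa sqrtr_sqr (ger0_norm (dist3_ge0 _ _)) !mul1r !mul0r addr0 add0r.
have := cos2Dsin2 (b * dist3 x y); rewrite [(4 * pi * _)^-1]invfM.
move: (expR _) (cos _) (sin _) (dist3 x y)^-1 (4 * pi)^-1 => X C S v w CS.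
have -> : (X * C * v * w) ^+ 2 + (X * S * v * w) ^+ 2 = (C ^+ 2 + S ^+ 2) * (X * (w * v)) ^+ 2 by ring.
by rewrite CS mul1r.
Qed.

(** The left side is the real part of [conj w * (h k)] for complex numbers; the difference of the
    squares is the square of its imaginary part. *)
Lemma cauchy_schwarz4 (w1 w2 h1 h2 k1 k2 k : R) : 0 <= k -> k1 ^+ 2 + k2 ^+ 2 = k ^+ 2 ->
  w1 * (h1 * k1 - h2 * k2) + w2 * (h2 * k1 + h1 * k2) <=
  Num.sqrt (w1 ^+ 2 + w2 ^+ 2) * (k * Num.sqrt (h1 ^+ 2 + h2 ^+ 2)).
Proof.
move=> k0 kk; apply: le_trans (ler_norm _) _.
have e0 : 0 <= w1 ^+ 2 + w2 ^+ 2 by rewrite addr_ge0 ?sqr_ge0.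
have e1 : 0 <= h1 ^+ 2 + h2 ^+ 2 by rewrite addr_ge0 ?sqr_ge0.
have -> : Num.sqrt (w1 ^+ 2 + w2 ^+ 2) * (k * Num.sqrt (h1 ^+ 2 + h2 ^+ 2)) =
    Num.sqrt ((w1 ^+ 2 + w2 ^+ 2) * (k ^+ 2 * (h1 ^+ 2 + h2 ^+ 2))).
  by rewrite sqrtrM// sqrtrM ?sqr_ge0// sqrtr_sqr (ger0_norm k0).
rewrite -sqrtr_sqr ler_sqrt; last by rewrite !mulr_ge0 ?sqr_ge0.
rewrite -kk -subr_ge0.
have -> : (w1 ^+ 2 + w2 ^+ 2) * ((k1 ^+ 2 + k2 ^+ 2) * (h1 ^+ 2 + h2 ^+ 2)) -
  (w1 * (h1 * k1 - h2 * k2) + w2 * (h2 * k1 + h1 * k2)) ^+ 2 =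
  (w1 * (h2 * k1 + h1 * k2) - w2 * (h1 * k1 - h2 * k2)) ^+ 2 by ring.
exact: sqr_ge0.
Qed.

(* The modulus of [w1 + i w2] is estimated by integrating its scalar product with
   itself, so that no complex-valued triangle inequality for integrals is needed. *)
Lemma green_bound (h1 h2 : T -> R) (w1 w2 : R) (x : T) :
  measurable_fun setT h1 -> measurable_fun setT h2 ->
  w1 = green h1 1 0 x - green h2 0 1 x ->
  w2 = green h2 1 0 x + green h1 0 1 x ->
  ((Num.sqrt (w1 ^+ 2 + w2 ^+ 2))%:E <=
   potential (yukawa_kernel a) (fun y => Num.sqrt (h1 y ^+ 2 + h2 y ^+ 2)) x)%E.
Proof.
move=> mh1 mh2 w1E w2E; set U := potential _ _ _.
pose H y := Num.sqrt (h1 y ^+ 2 + h2 y ^+ 2).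
have mH : measurable_fun setT H.
  by apply: measurable_sqrt_comp; apply: measurable_funD; exact: measurable_funX.
have mk : measurable_fun setT (fun y => yukawa_kernel a (x, y)).
  by apply: measurable_fun_pair2; exact: measurable_yukawa_kernel.
have k0 z : 0 <= yukawa_kernel a z by exact: yukawa_kernel_ge0.
have U0 : (0 <= U)%E by apply: integral_ge0 => y _; rewrite lee_fin mulr_ge0 ?sqrtr_ge0.
have [Uoo|] := ltP U +oo%E; last by rewrite leye_eq => /eqP ->; rewrite leey.
have iU : vol.-integrable setT (EFin \o (fun y => yukawa_kernel a (x, y) * H y)).
  apply/integrableP; split; first exact/measurable_EFinP/measurable_funM.
  rewrite (_ : (\int[vol]_y _)%E = U)//; apply: eq_integral => y _.
  by rewrite gee0_abs// lee_fin mulr_ge0 ?sqrtr_ge0.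
have hH1 y : `|h1 y| <= H y by rewrite -sqrtr_sqr ler_sqrt ?addr_ge0 ?sqr_ge0// lerDl sqr_ge0.
have hH2 y : `|h2 y| <= H y by rewrite -sqrtr_sqr ler_sqrt ?addr_ge0 ?sqr_ge0// lerDr sqr_ge0.
have kY p q y : (p = 1 /\ q = 0) \/ (p = 0 /\ q = 1) ->
    `|greenk a b p q x y| <= yukawa_kernel a (x, y).
  rewrite -[leRHS]ger0_norm// -(sqrtr_sqr (yukawa_kernel _ _)) -sqrtr_sqr.
  rewrite /yukawa_kernel/= -greenk_norm ler_sqrt ?addr_ge0 ?sqr_ge0//.
  by move=> [[-> ->]|[-> ->]]; rewrite ?lerDl ?lerDr sqr_ge0.
have ik (h : T -> R) p q : (p = 1 /\ q = 0) \/ (p = 0 /\ q = 1) ->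
    measurable_fun setT h -> (forall y, `|h y| <= H y) ->
    vol.-integrable setT (EFin \o (fun y => h y * greenk a b p q x y)).
  move=> pq mh hH; apply: le_integrable iU => //.
    apply/measurable_EFinP/measurable_funM => //.
    by apply: (@measurable_greenk _ a b p q _ _ (fun=> x) id).
  move=> y _; have kH : 0 <= yukawa_kernel a (x, y) * H y.
    by apply: mulr_ge0; [exact: k0|exact: sqrtr_ge0].
  rewrite lee_fin normrM mulrC (ger0_norm kH).
  by apply: ler_pM => //; exact: kY.
have p10 : ((1 : R) = 1 /\ (0 : R) = 0) \/ ((1 : R) = 0 /\ (0 : R) = 1) by left.
have p01 : ((0 : R) = 1 /\ (1 : R) = 0) \/ ((0 : R) = 0 /\ (1 : R) = 1) by right.
pose f1 y := h1 y * greenk a b 1 0 x y - h2 y * greenk a b 0 1 x y.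
pose f2 y := h2 y * greenk a b 1 0 x y + h1 y * greenk a b 0 1 x y.
have i11 := ik _ _ _ p10 mh1 hH1; have i22 := ik _ _ _ p01 mh2 hH2.
have i21 := ik _ _ _ p10 mh2 hH2; have i12 := ik _ _ _ p01 mh1 hH1.
have if1 : vol.-integrable setT (EFin \o f1).
  rewrite (_ : _ \o _ = (fun y => (h1 y * greenk a b 1 0 x y)%:E - (h2 y * greenk a b 0 1 x y)%:E)%E).
    exact: integrableB.
  by apply/funext => y /=; rewrite EFinB.
have if2 : vol.-integrable setT (EFin \o f2).
  rewrite (_ : _ \o _ = (fun y => (h2 y * greenk a b 1 0 x y)%:E + (h1 y * greenk a b 0 1 x y)%:E)%E).
    exact: integrableD.
  by apply/funext => y /=; rewrite EFinD.
have W1 : w1 = (\int[vol]_y f1 y)%R by rewrite RintegralB.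
have W2 : w2 = (\int[vol]_y f2 y)%R by rewrite RintegralD.
have sc r f' : vol.-integrable setT (EFin \o f') ->
    vol.-integrable setT (EFin \o (fun y => r * f' y)).
  move=> If'; rewrite (_ : _ \o _ = (fun y => r%:E * (f' y)%:E)%E).
    exact: integrableZl.
  by apply/funext => y /=; rewrite EFinM.
pose N := Num.sqrt (w1 ^+ 2 + w2 ^+ 2).
have N0 : 0 <= N by exact: sqrtr_ge0.
have UE : U = (\int[vol]_y (yukawa_kernel a (x, y) * H y))%R%:E.
  by rewrite fineK//; exact: integrable_fin_num iU.
have NN : N ^+ 2 <= N * fine U.
  rewrite /N sqr_sqrtr ?addr_ge0 ?sqr_ge0// -/N.
  have -> : w1 ^+ 2 + w2 ^+ 2 = (\int[vol]_y (w1 * f1 y + w2 * f2 y))%R.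
    rewrite RintegralD//; [|exact: sc|exact: sc].
    by rewrite !RintegralZl// -W1 -W2 -!expr2.
  rewrite UE/= -RintegralZl//; apply: le_Rintegral => //.
  - rewrite (_ : _ \o _ = (fun y => (w1 * f1 y)%:E + (w2 * f2 y)%:E)%E).
      by apply: integrableD => //; exact: sc.
    by apply/funext => y /=; rewrite EFinD.
  - exact: sc.
  move=> y _; rewrite /f1 /f2.
  by apply: cauchy_schwarz4 => //; rewrite greenk_norm.
rewrite -/N; have -> : U = (fine U)%:E by rewrite UE.
rewrite lee_fin; have [->|Nn0] := eqVneq N 0; first by rewrite fine_ge0.
by move: NN; rewrite expr2 ler_pM2l// lt_def Nn0.
Qed.

(** The representation formula gives real parts only. Applied to [- i w], that is to the pair
    [w2, - w1] with data [h2, - h1], it gives the imaginary part as well. *)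
Lemma helmholtz_bound (P : R) (w1 w2 h1 h2 : T -> R) : 1 <= P ->
  measurable_fun setT w1 -> measurable_fun setT w2 ->
  measurable_fun setT h1 -> measurable_fun setT h2 ->
  (\int[vol]_y (`|w1 y| `^ P)%:E < +oo)%E -> (\int[vol]_y (`|w2 y| `^ P)%:E < +oo)%E ->
  (\int[vol]_y (`|h1 y| `^ P)%:E < +oo)%E -> (\int[vol]_y (`|h2 y| `^ P)%:E < +oo)%E ->
  weak_helmholtz a b (b ^+ 2 - a ^+ 2) (2 * a * b) w1 w2 h1 ->
  weak_helmholtz a b (b ^+ 2 - a ^+ 2) (2 * a * b) w2 (fun y => - w1 y) h2 ->
  {ae vol, forall x, ((Num.sqrt (w1 x ^+ 2 + w2 x ^+ 2))%:E <=
     potential (yukawa_kernel a) (fun y => Num.sqrt (h1 y ^+ 2 + h2 y ^+ 2)) x)%E}.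
Proof.
move=> P1 mw1 mw2 mh1 mh2 iw1 iw2 ih1 ih2 weak1 weak2.
have neg (f : T -> R) : measurable_fun setT f -> (\int[vol]_y (`|f y| `^ P)%:E < +oo)%E ->
    measurable_fun setT (fun y => - f y) /\ (\int[vol]_y (`|- f y| `^ P)%:E < +oo)%E.
  move=> mf jf; split; first exact: measurableT_comp.
  apply: le_lt_trans jf; rewrite le_eqVlt; apply/orP; left; apply/eqP.
  by apply: eq_integral => y _; rewrite normrN.
have [mw1' iw1'] := neg _ mw1 iw1; have [mh1' ih1'] := neg _ mh1 ih1.
have weak3 : weak_helmholtz a b (b ^+ 2 - a ^+ 2) (2 * a * b) (fun y => - w1 y)
    (fun y => - w2 y) (fun y => - h1 y).
  move=> e p q x e0; set phi := bump a b e x p q.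
  transitivity (\int[vol]_y - (w1 y * \sum_(i < 3) partial i (partial i phi) y))%R.
    by apply: eq_Rintegral => y _; rewrite mulNr.
  rewrite RintegralN_total weak1// -RintegralN_total; congr (- _).
  by apply: eq_Rintegral => y _; rewrite /phi; ring.
have := helmholtz_green P1 mw1 mw2 mh1 mh2 iw1 iw2 ih1 ih2 weak1 weak2.
have := helmholtz_green P1 mw2 mw1' mh2 mh1' iw2 iw1' ih2 ih1' weak2 weak3.
apply: filterS2 => x e2 e1; apply: (green_bound mh1 mh2 e1).
rewrite e2; congr (_ + _); rewrite /green -RintegralN_total.
by apply: eq_Rintegral => y _; rewrite mulNr opprK.
Qed.

End GreenRepresentation.

(** * Pointwise domination of the resolvent *)

Section ResolventBound.
Context {R : realType}.
Local Notation T := (space3 R).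
Local Notation E := (R * R * R)%type.

Lemma test_function_expR_bound (c : R) (x : T) (f : E -> R) : test_function f ->
  exists K, forall y : T, `|f y| <= K * expR (- (c * dist3 x y)).
Proof.
move=> [sf [K cK f0]].
(* Continuous on the compact support, hence bounded there by its maximum, which is the constant
   [K]. *)
pose g (y : E) := `|f y| * expR (c * Num.sqrt (sqdist 0 x y)).
have gE (y : T) : g y = `|f y| * expR (c * dist3 x y).
  rewrite /g sqdist_dist3 expr0n addr0 sqrtr_sqr.
  by rewrite (ger0_norm (dist3_ge0 x y)).
have cg : continuous g.
  move=> y; apply: cvgM.
    by apply: cvg_norm; have [cf _] := sf [::]; exact: cf.
  apply: (@continuous_comp _ _ _ (fun y => c * Num.sqrt (sqdist 0 x y)) expR); last exact: continuous_expR.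
  apply: cvgM; first exact: cvg_cst.
  apply: (@continuous_comp _ _ _ (sqdist 0 x) Num.sqrt); last exact: sqrt_continuous.
  exact: sqdist_continuous.
have fg (M : R) : (forall y, K y -> g y <= M) -> 0 <= M ->
    forall y : T, `|f y| <= M * expR (- (c * dist3 x y)).
  move=> gM M0 y; have [Ky|Ky] := pselect (K y); last first.
    by rewrite f0// normr0 mulr_ge0 ?expR_ge0.
  by rewrite expRN ler_pdivlMr ?expR_gt0// -gE; exact: gM.
have [K0|/set0P Kn0] := eqVneq K set0.
  by exists 0; apply: fg => // y; rewrite K0.
have [m _ gm] := compact_EVT_max Kn0 cK (continuous_subspaceT cg).
exists (g m); apply: fg; last by rewrite mulr_ge0 ?expR_ge0.
by move=> y Ky; apply: gm; rewrite inE.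
Qed.

Variables (a b : R).
Hypothesis a0 : 0 < a.

Lemma measurable_coord3 (i : 'I_3) : measurable_fun setT (fun y : T => coord3 i y).
Proof.
rewrite /coord3; case: (i == 0); last case: (i == 1).
- by apply: (measurableT_comp measurable_fst); exact: measurable_fst.
- by apply: (measurableT_comp measurable_snd); exact: measurable_fst.
- exact: measurable_snd.
Qed.

Lemma measurable_sqdist (e : R) (x : T) : measurable_fun setT (fun y : T => sqdist e x y).
Proof.
under eq_fun do rewrite sqdist_dist3.
by apply: measurable_funD => //; apply: measurable_funX; exact: measurable_fun_dist3.
Qed.

Lemma integrable_mul_bump (P e p q : R) (u : T -> R) (x : T) : 1 <= P -> 0 < e ->
  measurable_fun setT u -> (\int[vol]_y (`|u y| `^ P)%:E < +oo)%E ->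
  vol.-integrable setT (EFin \o (fun y => u y * bump a b e x p q y)) /\
  forall i, vol.-integrable setT
    (EFin \o (fun y => u y * partial i (partial i (bump a b e x p q)) y)).
Proof.
move=> P1 e0 mu iu; have tb := bump_test a b x e0 p q.
have ms := measurable_sqdist e x; have [m1 m2 _] := measurable_bumps a b e p q.
split=> [|i].
  have [K KP] := test_function_expR_bound 1 x tb.
  apply: (integrable_mul_kernel (x := x) P1 (@ltr01 R) mu iu) KP.
  exact: (measurableT_comp (profile_measurable (profile_bump0 a b e p q))).
have [K KP] := test_function_expR_bound 1 x (test_function_partial i (test_function_partial i tb)).
apply: (integrable_mul_kernel (x := x) P1 (@ltr01 R) mu iu) KP.
rewrite (_ : partial _ _ = (fun y : T => 2 * bump1 a b e p q (sqdist e x y) +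
  4 * (coord3 i y - coord3 i x) ^+ 2 * bump2 a b e p q (sqdist e x y))); last first.
  by apply/funext => y; rewrite partial_partial_bump.
apply: measurable_funD; apply: measurable_funM => //.
- exact: (measurableT_comp m1).
- apply: measurable_funM => //; apply: measurable_funX; apply: measurable_funB => //.
  exact: measurable_coord3.
- exact: (measurableT_comp m2).
Qed.

Lemma cLnorm_powR (p : R) (u : field3 R) : p != 0 ->
  (\int[vol]_y (cabs (u y) `^ p)%:E = cLnorm p u `^ p)%E.
Proof.
move=> p0; rewrite /cLnorm (poweR_Lnorm _ _ p0); apply: eq_integral => y _.
by rewrite /= (ger0_norm (cabs_ge0 _)).
Qed.

Lemma cLnorm_lty (p : R) (u : field3 R) : p != 0 -> inLp p u ->
  (\int[vol]_y (cabs (u y) `^ p)%:E < +oo)%E.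
Proof. by move=> p0 [_ uoo]; rewrite cLnorm_powR// poweR_lty. Qed.

Lemma inLp_re_im (p : R) (u : field3 R) : 1 <= p -> inLp p u ->
  [/\ measurable_fun setT (fun y => complex.Re (u y)),
      measurable_fun setT (fun y => complex.Im (u y)),
      (\int[vol]_y (`|complex.Re (u y)| `^ p)%:E < +oo)%E &
      (\int[vol]_y (`|complex.Im (u y)| `^ p)%:E < +oo)%E].
Proof.
move=> p1 ip; have p0 : p != 0 by rewrite gt_eqF// (lt_le_trans ltr01).
have oo := cLnorm_lty p0 ip; case: ip => -[mr mi] _.
have mc : measurable_fun setT (fun y => (cabs (u y) `^ p)%:E).
  by apply/measurable_EFinP/measurable_powR_comp; exact: measurable_cabs (conj mr mi).
have bnd (f : T -> R) : measurable_fun setT f -> (forall y, `|f y| <= cabs (u y)) ->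
    (\int[vol]_y (`|f y| `^ p)%:E < +oo)%E.
  move=> mf fu; apply: le_lt_trans oo; apply: ge0_le_integral.
  - exact: measurableT.
  - by move=> y _; rewrite lee_fin powR_ge0.
  - by apply/measurable_EFinP/measurable_powR_comp; exact: measurableT_comp.
  - exact: mc.
  - move=> y _; rewrite lee_fin ge0_ler_powR ?nnegrE ?cabs_ge0 ?(le_trans ler01 p1)//.
split; [exact: mr|exact: mi|apply: bnd mr _|apply: bnd mi _] => y.
  by rewrite cabsE -sqrtr_sqr ler_sqrt ?addr_ge0 ?sqr_ge0// lerDl sqr_ge0.
by rewrite cabsE -sqrtr_sqr ler_sqrt ?addr_ge0 ?sqr_ge0// lerDr sqr_ge0.
Qed.

(** The two derivatives are removed from the bump one at a time, the first being a test function
    again by [test_function_partial]; the two minus signs cancel. *)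
Lemma weak_helmholtz_real (p : R) (l1 l2 : R) (u1 u2 m1 : T -> R) (d1 d2 : 'I_3 -> T -> R) :
  1 <= p ->
  measurable_fun setT u1 -> (\int[vol]_y (`|u1 y| `^ p)%:E < +oo)%E ->
  (forall i, measurable_fun setT (d2 i) /\ (\int[vol]_y (`|d2 i y| `^ p)%:E < +oo)%E) ->
  measurable_fun setT u2 -> measurable_fun setT m1 ->
  (forall i phi, test_function phi ->
    (\int[vol]_y (u1 y * partial i phi y) = - \int[vol]_y (d1 i y * phi y))%R) ->
  (forall i phi, test_function phi ->
    (\int[vol]_y (d1 i y * partial i phi y) = - \int[vol]_y (d2 i y * phi y))%R) ->
  {ae vol, forall y, m1 y + l1 * u1 y - l2 * u2 y = - \sum_(i < 3) d2 i y} ->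
  weak_helmholtz a b l1 l2 u1 u2 m1.
Proof.
move=> p1 mu1 iu1 d2P mu2 mm1 w1 w2 eqn e P q x e0.
have tb := bump_test a b x e0 P q.
have ms : measurable_fun setT (fun y : T => bump a b e x P q y).
  apply: (measurableT_comp (profile_measurable (profile_bump0 a b e P q))).
  exact: measurable_sqdist.
have [ib i2] := integrable_mul_bump P q x p1 e0 mu1 iu1.
have id2 i : vol.-integrable setT (EFin \o (fun y => d2 i y * bump a b e x P q y)).
  by have [md jd] := d2P i; have [] := integrable_mul_bump P q x p1 e0 md jd.
have sum3 (f : 'I_3 -> T -> R) : (forall i, vol.-integrable setT (EFin \o f i)) ->
    (\int[vol]_y (\sum_(i < 3) f i y) = \sum_(i < 3) \int[vol]_y f i y)%R.
  move=> If; under eq_Rintegral do rewrite !big_ord_recl big_ord0 addr0.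
  rewrite !big_ord_recl big_ord0 addr0 RintegralD//; first by rewrite RintegralD.
  rewrite (_ : _ \o _ = (fun y => (f (lift ord0 ord0) y)%:E + (f (lift ord0 (lift ord0 ord0)) y)%:E)%E).
    by apply: integrableD => //; exact: If.
  by apply/funext => y /=; rewrite EFinD.
under eq_Rintegral do rewrite mulr_sumr.
rewrite sum3//.
under eq_bigr => i _ do rewrite (w1 i _ (test_function_partial i tb)) (w2 i _ tb) opprK.
rewrite -sum3// -RintegralN_total.
rewrite /Rintegral; congr fine; apply: ae_eq_integral => //.
- apply/measurable_EFinP.
  have m3 i : measurable_fun setT (fun y => d2 i y * bump a b e x P q y).
    by have [md _] := d2P i; exact: measurable_funM.
  under eq_fun do rewrite !big_ord_recl big_ord0 addr0.
  by do 2 apply: measurable_funD => //.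
- apply/measurable_EFinP/measurableT_comp => //.
  apply: measurable_funM => //; apply: measurable_funB.
    by apply: measurable_funD => //; exact: measurable_funM.
  exact: measurable_funM.
apply: filterS eqn => y + _; rewrite -mulr_suml => ->.
by rewrite mulNr opprK.
Qed.

Lemma weak_partial_re_im (i : 'I_3) (u v : field3 R) (phi : E -> R) :
  weak_partial i u v -> test_function phi ->
  (\int[vol]_y (complex.Re (u y) * partial i phi y) =
    - \int[vol]_y (complex.Re (v y) * phi y))%R /\
  (\int[vol]_y (complex.Im (u y) * partial i phi y) =
    - \int[vol]_y (complex.Im (v y) * phi y))%R.
Proof.
move=> uv tphi; have := uv phi tphi; rewrite /cintegral => -[re im].
have ReZ (z : R[i]) (r : R) : complex.Re (z * r%:C%C) = complex.Re z * r.
  by case: z => x y /=; rewrite mulr0 subr0.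
have ImZ (z : R[i]) (r : R) : complex.Im (z * r%:C%C) = complex.Im z * r.
  by case: z => x y /=; rewrite mulr0 add0r.
split.
  transitivity (\int[vol]_y complex.Re (u y * (partial i phi y)%:C%C))%R.
    by apply: eq_Rintegral => y _; rewrite ReZ.
  by rewrite re; congr (- _); apply: eq_Rintegral => y _; rewrite ReZ.
transitivity (\int[vol]_y complex.Im (u y * (partial i phi y)%:C%C))%R.
  by apply: eq_Rintegral => y _; rewrite ImZ.
by rewrite im; congr (- _); apply: eq_Rintegral => y _; rewrite ImZ.
Qed.

(** The spectral parameter is the square of [b + i a]. The real and imaginary parts of [w] satisfy
    real equations coupled through [2 a b], the second being the first one written for [- i w]. *)
Lemma resolvent_bound (p : R) (lam : R[i]) (w m : field3 R) d1 d2 :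
  1 < p -> lam = ((b ^+ 2 - a ^+ 2) +i* (2 * a * b))%C ->
  W2_with_derivatives p w d1 d2 -> inLp p m ->
  {ae vol, forall x, m x + lam * w x = - \sum_(i < 3) d2 i i x} ->
  {ae vol, forall x, ((cabs (w x))%:E <= potential (yukawa_kernel a) (fun y => cabs (m y)) x)%E}.
Proof.
move=> p1 lamE [iw dw dd] im eqn; have p1' := ltW p1.
have [mw1 mw2 iw1 iw2] := inLp_re_im p1' iw.
have [mm1 mm2 im1 im2] := inLp_re_im p1' im.
have i2 i := inLp_re_im p1' (dd i i).1.
have neg (f : T -> R) : measurable_fun setT f -> measurable_fun setT (fun y => - f y).
  by move=> mf; exact: measurableT_comp.
have weak1 : weak_helmholtz a b (b ^+ 2 - a ^+ 2) (2 * a * b)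
    (fun y => complex.Re (w y)) (fun y => complex.Im (w y)) (fun y => complex.Re (m y)).
  apply: (weak_helmholtz_real (p := p) (d1 := fun i y => complex.Re (d1 i y))
    (d2 := fun i y => complex.Re (d2 i i y)) p1' mw1 iw1 _ mw2 mm1).
  - by move=> i; have [? _ ? _] := i2 i.
  - by move=> i phi tphi; have [] := weak_partial_re_im (dw i).2 tphi.
  - by move=> i phi tphi; have [] := weak_partial_re_im (dd i i).2 tphi.
  apply: filterS eqn => y /(congr1 (@complex.Re R)); rewrite lamE.
  rewrite raddfN raddf_sum raddfD/= => <-.
  by case: (w y) => x1 x2 /=; ring.
have weak2 : weak_helmholtz a b (b ^+ 2 - a ^+ 2) (2 * a * b)
    (fun y => complex.Im (w y)) (fun y => - complex.Re (w y)) (fun y => complex.Im (m y)).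
  apply: (weak_helmholtz_real (p := p) (d1 := fun i y => complex.Im (d1 i y))
    (d2 := fun i y => complex.Im (d2 i i y)) p1' mw2 iw2 _ (neg _ mw1) mm2).
  - by move=> i; have [_ ? _ ?] := i2 i.
  - by move=> i phi tphi; have [] := weak_partial_re_im (dw i).2 tphi.
  - by move=> i phi tphi; have [] := weak_partial_re_im (dd i i).2 tphi.
  apply: filterS eqn => y /(congr1 (@complex.Im R)); rewrite lamE.
  rewrite raddfN raddf_sum raddfD/= => <-.
  by case: (w y) => x1 x2 /=; ring.
have := helmholtz_bound a0 p1' mw1 mw2 mm1 mm2 iw1 iw2 im1 im2 weak1 weak2.
apply: filterS => x; rewrite cabsE => /le_trans; apply.
by rewrite (_ : (fun y => cabs (m y)) = (fun y =>
  Num.sqrt (complex.Re (m y) ^+ 2 + complex.Im (m y) ^+ 2)))//; apply/funext => y; rewrite cabsE.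
Qed.

End ResolventBound.

(** * From approximate to exact fixed points *)

(** Young's inequality for [l A] and [d / l] with [l = tau^(1/p')]: the coefficient of the
    uncontrolled power [A^p'] is prescribed, at the price of a large [mu]. *)
Lemma young_epsilon (R : realType) (p p' tau : R) : 1 < p -> p^-1 + p'^-1 = 1 -> 0 < tau ->
  exists2 mu : R, 0 < mu & forall A d : R, 0 <= A -> 0 <= d ->
    A * d <= tau * A `^ p' + mu * d `^ p.
Proof.
move=> p1 pp' t0; have p0 : 0 < p by lra.
have pV1 : p^-1 < 1 by rewrite invf_lt1.
have pV0 : 0 < p^-1 by rewrite invr_gt0.
have p'V0 : 0 < p'^-1 by lra.
have p'0 : 0 < p' by rewrite -invr_gt0.
have p'V1 : p'^-1 < 1 by lra.
pose l := tau `^ p'^-1; have l0 : 0 < l by rewrite powR_gt0.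
exists (l^-1 `^ p); first by rewrite powR_gt0 ?invr_gt0.
move=> A d A0 d0.
have -> : A * d = (l * A) * (l^-1 * d) by rewrite mulrACA mulfV ?mul1r// gt_eqF.
have lA : 0 <= l * A by rewrite mulr_ge0// ltW.
have ld : 0 <= l^-1 * d by rewrite mulr_ge0// invr_ge0 ltW.
have p'p : p'^-1 + p^-1 = 1 by rewrite addrC.
apply: (le_trans (conjugate_powR lA ld p'0 p0 p'p)).
rewrite powRM ?(ltW l0)// powRM ?invr_ge0 ?(ltW l0)//.
have -> : l `^ p' = tau by rewrite /l -powRrM mulVf ?powRr1 ?(ltW t0)// gt_eqF.
by apply: lerD; rewrite ler_piMr ?mulr_ge0 ?powR_ge0 ?(ltW t0) ?(ltW pV1) ?(ltW p'V1).
Qed.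

(* The quotients by [1 + A] keep the defect of the fixed-point inequality
   meaningful when the potential [G] is infinite. *)
Lemma defect_le (R : realType) (F A s : R) (G t : \bar R) : 0 <= A ->
  0 <= s -> (0 <= G)%E -> (0 <= t)%E -> (F%:E <= s%:E + A%:E * (G + t))%E ->
  (maxe 0 ((F / (1 + A))%:E - (A / (1 + A))%:E * G) <= s%:E + t)%E.
Proof.
move=> A0 s0; have A1 : 0 < 1 + A by rewrite ltr_pwDl.
case: t => [t| |] //; last by move=> _ _ _; rewrite addey// leey.
case: G => [G| |] //.
  move=> G0 t0; rewrite -EFinD -EFinM -EFinD !lee_fin => FA.
  rewrite !lee_fin in G0 t0; rewrite ge_max -EFinD !lee_fin addr_ge0//=.
  rewrite mulrAC -mulrBl ler_pdivrMr//; nra.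
move=> _ t0; rewrite lee_fin in t0; rewrite addye// ge_max -EFinD lee_fin addr_ge0//=.
have [->|An0] := eqVneq A 0.
  by rewrite !mul0r !mul0e adde0 sube0 addr0 divr1 !lee_fin => /le_trans; apply; rewrite lerDl.
move=> _; rewrite gt0_muley; last by rewrite lte_fin divr_gt0// lt_def An0.
by rewrite addeNy leNye.
Qed.

Lemma defect_eq0 (R : realType) (F A : R) (G : \bar R) : 0 <= A -> (0 <= G)%E ->
  (maxe 0 ((F / (1 + A))%:E - (A / (1 + A))%:E * G) = 0)%E -> (F%:E <= A%:E * G)%E.
Proof.
move=> A0 G0 /eqP; rewrite eq_le => /andP[+ _]; rewrite ge_max => /andP[_].
have A1 : 0 < 1 + A by rewrite ltr_pwDl.
case: G G0 => [G| |] // G0.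
  by rewrite -!EFinM -EFinB !lee_fin mulrAC -mulrBl pmulr_lle0 ?invr_gt0// subr_le0.
have [->|An0] := eqVneq A 0; first by rewrite mul0r !mul0e sube0 addr0 divr1.
by move=> _; rewrite gt0_muley ?leey// lte_fin lt_def An0.
Qed.

Section AlmostFixpoint.
Context {R : realType}.
Local Notation T := (space3 R).

Lemma potentialD (k : T * T -> R) (f g : T -> R) (x : T) :
  measurable_fun setT k -> (forall z, 0 <= k z) ->
  measurable_fun setT f -> (forall x, 0 <= f x) ->
  measurable_fun setT g -> (forall x, 0 <= g x) ->
  (potential k (fun y => f y + g y)%R x = potential k f x + potential k g x)%E.
Proof.
move=> mk k0 mf f0 mg g0; rewrite /potential.
have mkx : measurable_fun setT (fun y => k (x, y)) by exact: measurable_fun_pair2.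
rewrite -ge0_integralD//.
- by apply: eq_integral => y _; rewrite -EFinD mulrDr.
- by move=> y _; rewrite lee_fin mulr_ge0.
- exact/measurable_EFinP/measurable_funM.
- by move=> y _; rewrite lee_fin mulr_ge0.
- exact/measurable_EFinP/measurable_funM.
Qed.

(** By the triangle inequality the weight passes from [x] to [y] at the cost of half of the kernel's
    decay; the remaining kernel with [alpha / 2] has finite mass. *)
Lemma weighted_potential (alpha : R) (g : T -> R) (y0 : T) : 0 < alpha ->
  measurable_fun setT g -> (forall x, 0 <= g x) ->
  (\int[vol]_x ((expR (- (alpha / 2 * dist3 x y0)))%:E * potential (yukawa_kernel alpha) g x) <=
   (yukawa_moment (alpha / 2) 1)%:E * \int[vol]_y (expR (- (alpha / 2 * dist3 y y0)) * g y)%:E)%E.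
Proof.
move=> a0 mg g0; have a2 : 0 < alpha / 2 by rewrite divr_gt0.
have mw : measurable_fun setT (fun y : T => expR (- (alpha / 2 * dist3 y y0))).
  apply: (measurableT_comp (measurable_expR_scale _)).
  exact: measurable_fun_dist3.
have mwg : measurable_fun setT (fun y => expR (- (alpha / 2 * dist3 y y0)) * g y).
  exact: measurable_funM.
have wg0 y : 0 <= expR (- (alpha / 2 * dist3 y y0)) * g y by rewrite mulr_ge0 ?expR_ge0.
have k0 b (z : T * T) : 0 <= yukawa_kernel b z by exact: yukawa_kernel_ge0.
have mk b := @measurable_yukawa_kernel R b.
have K2 y : (\int[vol]_x (yukawa_kernel (alpha / 2) (x, y))%:E <= (yukawa_moment (alpha / 2) 1)%:E)%E.
  rewrite -(integral_yukawa_kernel2 y a2 (_ : 0 < 1 < 3)) ?ltr01 ?ltr1n//.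
  by rewrite le_eqVlt; apply/orP; left; apply/eqP; apply: eq_integral => x _; rewrite powRr1.
rewrite (integral_mul_potential (mk alpha) (k0 alpha) mw _ mg g0); last by move=> x; exact: expR_ge0.
apply: le_trans (integral_pair_kernel2 (mk (alpha / 2)) (k0 _) mwg wg0 K2).
apply: ge0_le_integral => //.
- by move=> z _; rewrite lee_fin mulr_ge0 ?expR_ge0// mulr_ge0.
- apply/measurable_EFinP/measurable_funM.
    by apply: (measurableT_comp mw); exact: measurable_fst.
  by apply: measurable_funM => //; apply: (measurableT_comp mg); exact: measurable_snd.
- apply/measurable_EFinP/measurable_funM => //.
  by apply: (measurableT_comp mwg); exact: measurable_snd.
move=> -[x y] _; rewrite lee_fin /= mulrA [leRHS]mulrA ler_wpM2r// /yukawa_kernel /yukawa/=.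
rewrite mulrA [leRHS]mulrAC -!expRD ler_wpM2r//.
  by rewrite invr_ge0 !mulr_ge0 ?pi_ge0 ?dist3_ge0.
rewrite ler_expR; have := dist3_triangle y x y0; rewrite (dist3C y x).
by move: (dist3 x y) (dist3 y y0) (dist3 x y0) => u v w; nra.
Qed.

(* The defect of the limit inequality, integrated against the weight
   [exp (- alpha / 2 |x - y0|)], is at most every positive number; the weight
   absorbs the fact that [A] is only locally in [L_p']. *)
Lemma almost_fixpoint (p p' alpha D : R) (A F : T -> R) (y0 : T) :
  1 < p -> p^-1 + p'^-1 = 1 -> 0 < alpha ->
  measurable_fun setT A -> (forall x, 0 <= A x) ->
  measurable_fun setT F -> (forall x, 0 <= F x) ->
  (\int[vol]_y (expR (- (alpha / 2 * dist3 y y0)) * A y `^ p')%:E <= D%:E)%E ->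
  (forall e : R, 0 < e -> exists s d : T -> R,
    [/\ measurable_fun setT s /\ (forall x, 0 <= s x),
        measurable_fun setT d /\ (forall x, 0 <= d x),
        (\int[vol]_x (s x `^ p)%:E <= e%:E)%E, (\int[vol]_x (d x `^ p)%:E <= e%:E)%E &
        {ae vol, forall x, ((F x)%:E <= (s x)%:E + (A x)%:E *
          potential (yukawa_kernel alpha) (fun y => A y * (F y + d y))%R x)%E}]) ->
  {ae vol, forall x, ((F x)%:E <= (A x)%:E *
     potential (yukawa_kernel alpha) (fun y => A y * F y)%R x)%E}.
Proof.
move=> p1 pp' a0 mA A0 mF F0 AD approx.
have a2 : 0 < alpha / 2 by rewrite divr_gt0.
pose w (x : T) := expR (- (alpha / 2 * dist3 x y0)).
have w0 x : 0 <= w x by exact: expR_ge0.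
have w1 x : w x <= 1.
  by rewrite -[leRHS]expR0 ler_expR oppr_le0 mulr_ge0 ?dist3_ge0// ltW.
have mw : measurable_fun setT w.
  by apply: (measurableT_comp (measurable_expR_scale _)); exact: measurable_fun_dist3.
set k := yukawa_kernel alpha.
have k0 z : 0 <= k z by exact: yukawa_kernel_ge0.
have mk : measurable_fun setT k by exact: measurable_yukawa_kernel.
pose G := potential k (fun y => A y * F y).
have mAF : measurable_fun setT (fun y => A y * F y) by exact: measurable_funM.
have AF0 y : 0 <= A y * F y by rewrite mulr_ge0.
have mG : measurable_fun setT G by exact: measurable_potential.
have G0 x : (0 <= G x)%E by apply: integral_ge0 => y _; rewrite lee_fin mulr_ge0.
have A1 x : 0 < 1 + A x by rewrite ltr_pwDl.
pose h x : \bar R := maxe 0%E ((F x / (1 + A x))%:E - (A x / (1 + A x))%:E * G x)%E.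
have h0 x : (0 <= h x)%E by rewrite le_max lexx.
have mA1 : measurable_fun setT (fun x => (1 + A x)^-1).
  by apply: measurable_inv_fun; exact: measurable_funD.
have mh : measurable_fun setT h.
  apply: measurable_maxe => //; apply: emeasurable_funB.
    by apply/measurable_EFinP; exact: measurable_funM.
  apply: emeasurable_funM => //.
  by apply/measurable_EFinP; exact: measurable_funM.
have mwh : measurable_fun setT (fun x => (w x)%:E * h x)%E.
  by apply: emeasurable_funM => //; exact/measurable_EFinP.
have wh0 x : (0 <= (w x)%:E * h x)%E by rewrite mule_ge0 ?lee_fin.
pose W := 4 * pi * Gamma 3 / (alpha / 2) `^ 3.
have WE : (\int[vol]_x (w x)%:E = W%:E)%E by exact: integral_expR_dist.
pose M := yukawa_moment (alpha / 2) 1.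
have M0 : 0 <= M by rewrite ltW// yukawa_moment_gt0// ltr01 ltr1n.
have W0 : 0 <= W by rewrite -lee_fin -WE; apply: integral_ge0 => x _; rewrite lee_fin.
have D0 : 0 <= D.
  by rewrite -lee_fin (le_trans _ AD)//; apply: integral_ge0 => x _; rewrite lee_fin mulr_ge0 ?expR_ge0 ?powR_ge0.
have young_int (B d : T -> R) (tau mu e D' : R) : 0 <= tau -> 0 <= mu ->
    measurable_fun setT B -> (forall x, 0 <= B x) ->
    measurable_fun setT d -> (forall x, 0 <= d x) ->
    (\int[vol]_y (w y * B y `^ p')%:E <= D'%:E)%E -> (\int[vol]_y (d y `^ p)%:E <= e%:E)%E ->
    (forall A d : R, 0 <= A -> 0 <= d -> A * d <= tau * A `^ p' + mu * d `^ p) ->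
    (\int[vol]_y (w y * (B y * d y))%:E <= (tau * D' + mu * e)%:E)%E.
  move=> t0 m0 mB B0 md d0 BD de yg.
  have mBp : measurable_fun setT (fun y => (w y * B y `^ p')%:E).
    by apply/measurable_EFinP/measurable_funM => //; exact: measurable_powR_comp.
  have mdp : measurable_fun setT (fun y => (d y `^ p)%:E).
    by apply/measurable_EFinP; exact: measurable_powR_comp.
  apply: (@le_trans _ _ (\int[vol]_y (tau%:E * (w y * B y `^ p')%:E + mu%:E * (d y `^ p)%:E))%E).
    apply: ge0_le_integral => //.
    - by move=> y _; rewrite lee_fin !mulr_ge0.
    - by apply/measurable_EFinP/measurable_funM => //; exact: measurable_funM.
    - by apply: emeasurable_funD; exact: measurable_funeM.
    move=> y _; rewrite -!EFinM -EFinD lee_fin.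
    apply: (le_trans (ler_wpM2l (w0 y) (yg _ _ (B0 y) (d0 y)))).
    rewrite mulrDr mulrCA lerD2l ler_piMl ?mulr_ge0 ?powR_ge0//.
  rewrite ge0_integralD//; last 4 first.
  - by move=> y _; rewrite mule_ge0 ?lee_fin ?mulr_ge0 ?powR_ge0.
  - exact: measurable_funeM.
  - by move=> y _; rewrite mule_ge0 ?lee_fin ?powR_ge0.
  - exact: measurable_funeM.
  rewrite (ge0_integralZl _ _ mBp) ?lee_fin//; last by move=> y _; rewrite lee_fin mulr_ge0 ?powR_ge0.
  rewrite (ge0_integralZl _ _ mdp) ?lee_fin//; last by move=> y _; rewrite lee_fin powR_ge0.
  by rewrite EFinD !EFinM; apply: leeD; apply: lee_wpmul2l => //; rewrite lee_fin.
have key (e : R) : 0 < e -> (\int[vol]_x ((w x)%:E * h x) <= e%:E)%E.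
  move=> e0.
  (* The order of choices matters: [tau] multiplies quantities that are merely finite, [mu] depends
     on [tau], and the accuracy [e'] of the approximation is chosen last. Each of the two
     contributions is at most [e / 2]. *)
  pose tau := e / 2 / (W + M * D + 1).
  have V0 : 0 < W + M * D + 1 by rewrite ltr_wpDl// addr_ge0// mulr_ge0.
  have t0 : 0 < tau by rewrite !divr_gt0.
  have [mu mu0 young] := young_epsilon p1 pp' t0.
  have M1 : 0 < 1 + M by rewrite ltr_pwDl.
  pose e' := e / 2 / (mu * (1 + M)).
  have e'0 : 0 < e' by rewrite !divr_gt0// mulr_gt0.
  have [s [d [[ms s0] [md d0] si di ae]]] := approx _ e'0.
  have mAd : measurable_fun setT (fun y => A y * d y) by exact: measurable_funM.
  have Ad0 y : 0 <= A y * d y by rewrite mulr_ge0.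
  pose t := potential k (fun y => A y * d y).
  have t0' x : (0 <= t x)%E by apply: integral_ge0 => y _; rewrite lee_fin mulr_ge0.
  have mt : measurable_fun setT t by exact: measurable_potential.
  have ms' : measurable_fun setT (fun x => (w x * (1 * s x))%:E).
    by apply/measurable_EFinP; do 2 apply: measurable_funM => //.
  have mwt : measurable_fun setT (fun x => (w x)%:E * t x)%E.
    by apply: emeasurable_funM => //; exact/measurable_EFinP.
  apply: (@le_trans _ _ (\int[vol]_x ((w x * (1 * s x))%:E + (w x)%:E * t x))%E).
    apply: ae_ge0_le_integral => //.
    - by move=> x _; rewrite adde_ge0// ?lee_fin ?mule_ge0 ?lee_fin// mulr_ge0// mulr_ge0.
    - exact: emeasurable_funD.
    apply: filterS ae => x Fx _.
    rewrite EFinM -ge0_muleDr ?lee_fin ?mul1r//; apply: lee_wpmul2l; rewrite ?lee_fin//.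
    apply: defect_le => //; rewrite -potentialD//.
    by rewrite (_ : (fun y => _) = (fun y => A y * (F y + d y)))//; apply/funext => y; rewrite mulrDr.
  rewrite ge0_integralD//; last 2 first.
  - by move=> x _; rewrite lee_fin !mulr_ge0.
  - by move=> x _; rewrite mule_ge0 ?lee_fin.
  apply: (@le_trans _ _ ((tau * W + mu * e')%:E + M%:E * (tau * D + mu * e')%:E)%E).
    apply: leeD.
      apply: (young_int (fun=> 1) s tau mu e' W) => //; try exact: ltW.
      by under eq_integral do rewrite powR1 mulr1; rewrite WE.
    apply: (le_trans (weighted_potential y0 a0 mAd Ad0)).
    by apply: lee_wpmul2l; [rewrite lee_fin|apply: (young_int A d tau mu e' D) => //; exact: ltW].
  rewrite -EFinM -EFinD lee_fin.
  have -> : tau * W + mu * e' + M * (tau * D + mu * e') = tau * (W + M * D) + (mu * (1 + M)) * e' by ring.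
  have -> : mu * (1 + M) * e' = e / 2 by rewrite /e' mulrC divfK// mulf_neq0 ?gt_eqF.
  have : tau * (W + M * D) <= tau * (W + M * D + 1) by rewrite ler_wpM2l ?(ltW t0)// lerDl.
  have -> : tau * (W + M * D + 1) = e / 2 by rewrite /tau divfK// gt_eqF.
  by move=> h1; lra.
have i0 : (\int[vol]_x `|(w x)%:E * h x| = 0)%E.
  under eq_integral do rewrite gee0_abs//.
  apply/eqP; rewrite eq_le integral_ge0// andbT.
  by apply/lee_addgt0Pr => e e0; rewrite add0e key.
have /(ae_eq_integral_abs _ measurableT mwh).1 := i0.
apply: filterS => x /(_ I) /eqP; rewrite mule_eq0 eqe gt_eqF ?expR_gt0//= => /eqP.
exact: defect_eq0.
Qed.

End AlmostFixpoint.

(** * The Birman-Schwinger operator *)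

Section BirmanSchwinger.
Context {R : realType}.
Local Notation T := (space3 R).

Lemma cabsM (z w : R[i]) : cabs (z * w) = cabs z * cabs w.
Proof. exact: ComplexField.Normc.normcM. Qed.

Lemma cabsD (z w : R[i]) : cabs (z + w) <= cabs z + cabs w.
Proof. exact: (@le_normcD R z w). Qed.

Lemma cabsN (z : R[i]) : cabs (- z) = cabs z.
Proof. exact: (@normcN R z). Qed.

Lemma cabs_real (r : R) : cabs (r%:C)%C = `|r|.
Proof. by rewrite cabsE /= expr0n addr0 sqrtr_sqr. Qed.

Lemma cabs_csgn_le1 (z : R[i]) : cabs (csgn z) <= 1.
Proof.
rewrite /csgn; case: (eqVneq z 0) => [_|z0].
  by rewrite (_ : 0 = (0%:C)%C)// cabs_real normr0.
have c0 : cabs z != 0.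
  by apply/eqP => /(@ComplexField.Normc.eq0_normc R z)/eqP; exact/negP.
rewrite cabsM (_ : cabs _^-1 = (cabs (cabs z)%:C%C)^-1); last exact: ComplexField.Normc.normcV.
by rewrite cabs_real (ger0_norm (cabs_ge0 z)) divff.
Qed.

Lemma cabs_factor_a (q : field3 R) (x : T) : cabs (factor_a q x) = cabs (q x) `^ 2^-1.
Proof. by rewrite /factor_a cabs_real ger0_norm// powR_ge0. Qed.

Lemma cabs_factor_b_le (q : field3 R) (x : T) : cabs (factor_b q x) <= cabs (q x) `^ 2^-1.
Proof.
rewrite /factor_b cabsM cabs_real (ger0_norm (powR_ge0 _ _)).
by rewrite -[leRHS]mul1r ler_wpM2r ?powR_ge0// cabs_csgn_le1.
Qed.

Lemma measurable_cabs_sqrt (q : field3 R) : cmeasurable q ->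
  measurable_fun setT (fun x => cabs (q x) `^ 2^-1).
Proof. by move=> mq; apply: measurable_powR_comp; exact: measurable_cabs. Qed.

Lemma cmeasurable_factor_a (q : field3 R) : cmeasurable q -> cmeasurable (factor_a q).
Proof. by move=> mq; split; [exact: measurable_cabs_sqrt|exact: measurable_cst]. Qed.

Lemma ae_le_potential (alpha : R) (f g : T -> R) (x : T) :
  measurable_fun setT f -> (forall y, 0 <= f y) ->
  measurable_fun setT g -> (forall y, 0 <= g y) ->
  {ae vol, forall y, f y <= g y} ->
  (potential (yukawa_kernel alpha) f x <= potential (yukawa_kernel alpha) g x)%E.
Proof.
move=> mf f0 mg g0 fg.
have mk (h : T -> R) : measurable_fun setT h ->
    measurable_fun setT (fun y => (yukawa_kernel alpha (x, y) * h y)%:E).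
  move=> mh; apply/measurable_EFinP/measurable_funM; last exact: mh.
  exact: (measurableT_comp (measurable_yukawa alpha)
    (measurable_fun_dist3 (measurable_cst x) (@measurable_id _ T setT))).
apply: ae_ge0_le_integral.
- exact: measurableT.
- by move=> y _; rewrite lee_fin mulr_ge0 ?yukawa_kernel_ge0.
- exact: mk.
- by move=> y _; rewrite lee_fin mulr_ge0 ?yukawa_kernel_ge0.
- exact: mk.
apply: filterS fg => y fgy _.
by rewrite lee_fin ler_wpM2l ?yukawa_kernel_ge0.
Qed.

Variables (p a b : R) (lam : R[i]) (q : field3 R).
Hypotheses (p1 : 1 < p) (a0 : 0 < a).
Hypothesis lamE : lam = ((b ^+ 2 - a ^+ 2) +i* (2 * a * b))%C.
Hypothesis mq : cmeasurable q.

Let A (x : T) := cabs (q x) `^ 2^-1.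

(** The graph unfolds to [m = a v], [(- Delta - lambda) w = m] and [g = b w], with [|a| = A] and
    [|b| <= A]; the resolvent bound handles the middle equation. *)
Lemma birman_schwinger_bound (v g : field3 R) : birman_schwinger p q lam v g ->
  inLp p v /\
  {ae vol, forall x, ((cabs (g x))%:E <= (A x)%:E *
    potential (yukawa_kernel a) (fun y => A y * cabs (v y))%R x)%E}.
Proof.
move=> [w [m [iv im mE] [l [il [d1 [d2 [W lE]]]] mlE]] [iw ig gE]].
split=> //.
have key : {ae vol, forall x, m x + lam * w x = - \sum_(i < 3) d2 i i x}.
  by apply: filterS lE => x lx; rewrite mlE subrK; exact: lx.
have wb := resolvent_bound a0 p1 lamE W im key.
have mA : measurable_fun setT A by exact: measurable_cabs_sqrt.
have mm : measurable_fun setT (fun y => cabs (m y)) by apply: measurable_cabs; case: im.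
have mv : measurable_fun setT (fun y => cabs (v y)) by apply: measurable_cabs; case: iv.
have mAv : measurable_fun setT (fun y => A y * cabs (v y)) by exact: measurable_funM.
have mle : {ae vol, forall y, cabs (m y) <= A y * cabs (v y)}.
  apply: filterS mE => y my; have -> := my I.
  by rewrite cabsM cabs_factor_a.
have pot x := ae_le_potential a x mm (fun y => cabs_ge0 _) mAv
  (fun y => mulr_ge0 (powR_ge0 _ _) (cabs_ge0 _)) mle.
apply: filterS2 gE wb => x gx wx; have -> := gx I.
rewrite cabsM EFinM; apply: lee_pmul.
- by rewrite lee_fin cabs_ge0.
- by rewrite lee_fin cabs_ge0.
- by rewrite lee_fin cabs_factor_b_le.
- exact: le_trans wx (pot x).
Qed.

Lemma cLnorm_le_integral (u : field3 R) (t e : R) : 0 <= t -> t `^ p <= e ->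
  (cLnorm p u <= t%:E)%E -> (\int[vol]_x (cabs (u x) `^ p)%:E <= e%:E)%E.
Proof.
move=> t0 te ut; have p0 : 0 < p by exact: lt_trans ltr01 p1.
rewrite cLnorm_powR ?gt_eqF//; apply: (@le_trans _ _ (t%:E `^ p)%E).
  apply: (gt0_ler_poweR (ltW p0)) ut.
    by rewrite in_itv/= leey andbT; exact: Lnorm_ge0.
  by rewrite in_itv/= leey andbT lee_fin.
by rewrite poweR_EFin lee_fin.
Qed.

Lemma cLnorm_integral_gt0 (f : field3 R) : inLp p f -> ~ (f = (fun=> 0) %[ae vol]) ->
  (0 < \int[vol]_x (cabs (f x) `^ p)%:E)%E.
Proof.
move=> [mf _] fn0; have p0 : p != 0 by rewrite gt_eqF// (lt_trans ltr01).
have i0 : (0 <= \int[vol]_x (cabs (f x) `^ p)%:E)%E.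
  by apply: integral_ge0 => x _; rewrite lee_fin powR_ge0.
rewrite lt_neqAle i0 andbT; apply/eqP => /esym I0; apply: fn0.
have mF : measurable_fun setT (fun x => (cabs (f x) `^ p)%:E).
  by apply/measurable_EFinP/measurable_powR_comp; exact: measurable_cabs.
have /(ae_eq_integral_abs vol measurableT mF) : (\int[vol]_x `|(cabs (f x) `^ p)%:E| = 0)%E.
  rewrite -I0; apply: eq_integral => x _.
  by rewrite gee0_abs// lee_fin powR_ge0.
apply: filterS => x /(_ I)/= [] /powR_eq0_eq0 c0 _.
exact: (@ComplexField.Normc.eq0_normc R _ c0).
Qed.

(** The shape is the one delivered by linearity with scalar [-1]: from [Q v = g] and [Q f = - f] it
    yields [Q (f - v) = - g - f]. *)
Lemma cabs_perturb (f g : R[i]) : cabs f <= cabs (- 1 * g + - 1 * f) + cabs g.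
Proof.
rewrite -mulrDr mulN1r cabsN -(cabsN g) -[in leLHS](_ : g + f - g = f); first exact: cabsD.
by ring.
Qed.

Lemma cabs_sub_add (f v : R[i]) : cabs v <= cabs f + cabs (- 1 * v + f).
Proof.
rewrite -(cabsN (_ + f)) -[in leLHS](_ : f - (- 1 * v + f) = v); first exact: cabsD.
by ring.
Qed.

(* On the domain of the unextended operator the bound is exact; the two error
   terms come from the density of this domain and the boundedness of [Q]. *)
Lemma bounded_extension_fixpoint (p' nu : R) (Q : operator R) (f : field3 R) :
  p^-1 + p'^-1 = 1 -> 0 < nu -> (Mnorm nu p' (factor_a q) < +oo)%E ->
  is_bounded_extension p (birman_schwinger p q lam) Q ->
  Q f (fun x => - 1 * f x) ->
  {ae vol, forall x, ((cabs (f x))%:E <= (A x)%:E *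
    potential (yukawa_kernel a) (fun y => A y * cabs (f y))%R x)%E}.
Proof.
move=> pp' nu0 ha [dense [[dom ext uniq T0 lin] tot [K bnd]] sub] Qf.
have [iF _] := dom _ _ Qf; have [mf _] := iF.
have a2 : 0 < a / 2 by rewrite divr_gt0.
have [D DP] := integral_expR_dist_Mnorm nu0 a2 (cmeasurable_factor_a mq) ha.
have mA : measurable_fun setT A by exact: measurable_cabs_sqrt.
have A0 x : 0 <= A x by exact: powR_ge0.
apply: (@almost_fixpoint _ p p' a D A (fun x => cabs (f x)) ((0, 0), 0)) => //.
- exact: measurable_cabs.
- by move=> x; exact: cabs_ge0.
- apply: le_trans (DP ((0, 0), 0)); rewrite le_eqVlt; apply/orP; left; apply/eqP.
  by apply: eq_integral => y _; rewrite cabs_factor_a dist3C.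
move=> e e0; have p0 : 0 < p by exact: lt_trans ltr01 p1.
pose t := e `^ p^-1; have t0 : 0 < t by exact: powR_gt0.
have tp : t `^ p = e by rewrite /t -powRrM mulVf ?gt_eqF// powRr1 ?ltW.
have K0 : 0 < 1 + `|K| by rewrite ltr_pwDl.
(* With this accuracy both [f - v] and its image under [Q] have norm at most [t = e^(1/p)]. *)
pose e' := t / (1 + `|K|); have e'0 : 0 < e' by rewrite divr_gt0.
have [v [g [Bvg dist]]] := dense f e' iF e'0.
have Q2 := lin (- 1) _ _ _ _ (sub _ _ Bvg) Qf.
have [ild ils] := dom _ _ Q2; have [iv Bb] := birman_schwinger_bound Bvg.
have [md _] := ild; have [ms _] := ils; have [mv _] := iv.
have dE : cLnorm p (fun x => - 1 * v x + f x) = Lp_dist p f v.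
  by rewrite /Lp_dist; congr (cLnorm p _); apply/funext => x; ring.
have e't : e' <= t.
  by rewrite /e' ler_pdivrMr//; apply: (ler_peMr (ltW t0)); rewrite lerDl.
have dle : (cLnorm p (fun x => - 1 * v x + f x)%R <= e'%:E)%E by rewrite dE ltW.
exists (fun x => cabs (- 1 * g x + - 1 * f x)), (fun x => cabs (- 1 * v x + f x)).
split.
- by split=> [|x]; [exact: measurable_cabs|exact: cabs_ge0].
- by split=> [|x]; [exact: measurable_cabs|exact: cabs_ge0].
- apply: (@cLnorm_le_integral (fun x => - 1 * g x + - 1 * f x) t); rewrite ?tp ?(ltW t0)//.
  apply: le_trans (bnd _ _ Q2) _.
  apply: (@le_trans _ _ ((1 + `|K|)%:E * e'%:E)%E).
    apply: (@le_trans _ _ ((1 + `|K|)%:E * cLnorm p (fun x => - 1 * v x + f x)%R)%E).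
      by rewrite lee_wpmul2r ?Lnorm_ge0// lee_fin (le_trans (ler_norm K))// lerDr.
    by rewrite lee_wpmul2l ?lee_fin ?(ltW K0).
  by rewrite -EFinM lee_fin /e' mulrC divfK ?gt_eqF.
- apply: (@cLnorm_le_integral (fun x => - 1 * v x + f x) t); rewrite ?tp ?(ltW t0)//.
  by apply: le_trans dle _; rewrite lee_fin.
apply: filterS Bb => x Bx.
apply: (@le_trans _ _ ((cabs (- 1 * g x + - 1 * f x))%:E + (cabs (g x))%:E)%E).
  by rewrite -EFinD lee_fin cabs_perturb.
rewrite leeD2l//; apply: le_trans Bx _; rewrite lee_wpmul2l ?lee_fin//.
have mcf := measurable_cabs mf; have mcv := measurable_cabs mv; have mcd := measurable_cabs md.
apply: ae_le_potential.
- exact: measurable_funM.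
- by move=> y; rewrite mulr_ge0 ?cabs_ge0.
- by apply: measurable_funM => //; exact: measurable_funD.
- by move=> y; rewrite mulr_ge0 ?addr_ge0 ?cabs_ge0.
apply: nearW => y; rewrite ler_wpM2l//; exact: cabs_sub_add.
Qed.

End BirmanSchwinger.

(** * The explicit constant, and the eigenvalue estimate *)

Lemma yukawa_moment_conjugate (R : realType) (gamma alpha : R) : 0 < gamma -> 0 < alpha ->
  yukawa_moment alpha ((gamma + 3 / 2) / (gamma + 3 / 2 - 1)) `^ (gamma + 3 / 2 - 1) =
  (4 * pi)^-1 * ((2 * gamma + 1) / (2 * gamma + 3)) `^ (2 * gamma) *
  Gamma (4 * gamma / (2 * gamma + 1)) `^ ((2 * gamma + 1) / 2) / alpha `^ (2 * gamma).
Proof.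
move=> g0 a0; set m := (gamma + 3 / 2) / _; rewrite /yukawa_moment.
have g1 : 2 * gamma + 1 != 0 by rewrite gt_eqF//; clear -g0; lra.
have g2 : gamma + 3 / 2 - 1 != 0 by rewrite gt_eqF//; clear -g0; lra.
have g3 : 0 < 2 * gamma + 3 by clear -g0; lra.
have mE : m = (2 * gamma + 3) / (2 * gamma + 1).
  by rewrite /m; apply/eqP; rewrite eqr_div//; apply/eqP; field.
have g4 : 0 < 2 * gamma + 1 by clear -g0; lra.
have m0 : 0 < m by rewrite mE divr_gt0.
have m3 : 3 - m = 4 * gamma / (2 * gamma + 1).
  by rewrite mE; apply: (mulIf g1); rewrite mulrBl !divfK//; clear; ring.
have eE : gamma + 3 / 2 - 1 = (2 * gamma + 1) / 2 by clear; field.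
have pi4 : 0 < 4 * pi :> R by rewrite mulr_gt0 ?pi_gt0.
have G0 : 0 <= Gamma (3 - m).
  by apply: ltW; apply: Gamma_gt0; rewrite m3 divr_gt0// mulr_gt0.
have -> : (4 * pi) `^ (- m) * (4 * pi * Gamma (3 - m) / (m * alpha) `^ (3 - m)) =
    (4 * pi) `^ (1 - m) * (Gamma (3 - m) * (m * alpha) `^ (- (3 - m))).
  rewrite (@powRD _ _ 1 (- m)) ?(gt_eqF pi4) ?implybT// (powRr1 (ltW pi4)) (powRN (m * alpha)).
  by rewrite -(mulrA (4 * pi) (Gamma _)) mulrA (mulrC _ (4 * pi)).
rewrite (powRM _ (powR_ge0 _ _) (mulr_ge0 G0 (powR_ge0 _ _))).
rewrite (powRM _ G0 (powR_ge0 _ _)) -!powRrM eE.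
(* Since [m = (2 gamma + 3)/(2 gamma + 1)] and the outer exponent is [(2 gamma + 1)/2], the power of
   [4 pi] becomes [-1] and that of [m alpha] becomes [- 2 gamma]. *)
rewrite (_ : (1 - m) * _ = - 1); last by rewrite mE; field.
rewrite (_ : - (3 - m) * _ = - (2 * gamma)); last by rewrite m3; field.
have mV : ((2 * gamma + 1) / (2 * gamma + 3)) `^ (2 * gamma) = (m `^ (2 * gamma))^-1.
  by rewrite mE -invf_div -(powR_inv1 (divr_ge0 (ltW g3) (ltW g4))) -powRrM mulN1r powRN.
rewrite m3 powRN (powRM _ (ltW m0) (ltW a0)) powRN (powRr1 (ltW pi4)) mV (invfM (m `^ _)).
by rewrite -!mulrA; congr (_ * _); exact: mulrCA.
Qed.

Lemma half_angle (R : realType) (rho theta : R) : 0 <= rho ->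
  (rho * cos theta = (Num.sqrt rho * cos (theta / 2)) ^+ 2 - (Num.sqrt rho * sin (theta / 2)) ^+ 2) /\
  (rho * sin theta = 2 * (Num.sqrt rho * sin (theta / 2)) * (Num.sqrt rho * cos (theta / 2))).
Proof.
move=> r0; have tE : theta = (theta / 2) *+ 2 by rewrite -mulr_natr divfK.
rewrite !exprMn sqr_sqrtr// -mulrBr [in LHS]tE [in X in _ /\ X]tE cos_mulr2n sin_mulr2n; split.
  by rewrite sin2cos2; congr (_ * _); ring.
rewrite -{1}(sqr_sqrtr r0) -tE; ring.
Qed.

(** For [alpha = rho^(1/2) sin (theta / 2)] one has [alpha^(2 gamma) = rho^gamma sin^(2 gamma)
    (theta / 2)]; solving the inequality for [rho^gamma] leaves exactly [Cconst]. The sine is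
    positive because [theta / 2] lies between 0 and [pi]. *)
Lemma le_Cconst (R : realType) (gamma theta rho N : R) : 0 < gamma -> 0 < theta < 2 * pi ->
  0 < rho ->
  1 <= N * yukawa_moment (Num.sqrt rho * sin (theta / 2))
    ((gamma + 3 / 2) / (gamma + 3 / 2 - 1)) `^ (gamma + 3 / 2 - 1) ->
  rho `^ gamma <= Cconst gamma theta * N.
Proof.
move=> g0 /andP[t0 tpi] r0.
have s0 : 0 < sin (theta / 2) by rewrite sin_gt0_pi// ?divr_gt0// ltr_pdivrMr// mulrC.
have sr0 : 0 < Num.sqrt rho by rewrite sqrtr_gt0.
rewrite yukawa_moment_conjugate ?mulr_gt0// (powRM _ (ltW sr0) (ltW s0)).
have -> : Num.sqrt rho `^ (2 * gamma) = rho `^ gamma.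
  by rewrite -powR12_sqrt ?(ltW r0)// -powRrM mulrA mulVf// mul1r.
have S0 : 0 < sin (theta / 2) `^ (2 * gamma) by rewrite powR_gt0.
rewrite mulrA ler_pdivlMr ?mul1r ?mulr_gt0 ?powR_gt0// -ler_pdivlMr//.
move=> /le_trans; apply; rewrite /Cconst (invfM (4 * pi)) le_eqVlt; apply/orP; left; apply/eqP.
by move: (4 * pi)^-1 (sin _ `^ _)^-1 (_ `^ _) (_ `^ _) => x1 x2 x3 x4; ring.
Qed.

Theorem corollary3p3 (R : realType) (p p' gamma : R) (q : field3 R)
    (hp : 1 < p) (hp' : p^-1 + p'^-1 = 1)
    (hgamma : 0 < gamma) (hgamma_p : 3 < p -> p - 3 <= 2 * gamma)
    (hq : inLp (gamma + 3 / 2) q)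
    (ha : exists2 nu : R, 0 < nu < p' & (Mnorm nu p' (factor_a q) < +oo)%E)
    (hb : exists2 mu : R, 0 < mu < p & (Mnorm mu p (factor_b q) < +oo)%E)
    (hq0 : forall e : R, 0 < e -> exists rho : R, forall x : space3 R,
       rho < enorm x ->
       (\int[vol]_(y in [set y | (dist3 x y < 1)%R]) (cabs (q y))%:E < e%:E)%E)
    (H : operator R) (hH : schrodinger_operator p q H)
    (lambda : R[i]) (hlambda : ~ nonneg_halfline lambda)
    (heig : op_eigenvalue H lambda)
    (theta : R) (htheta : 0 < theta < 2 * pi)
    (harg : lambda = (cabs lambda)%:C%C * (cos theta +i* sin theta)%C) :
  ((cabs lambda `^ gamma)%:E <=
   (Cconst gamma theta)%:E *
   \int[vol]_x (cabs (q x) `^ (gamma + 3 / 2))%:E)%E.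
Proof.
have [Q [bext _ _ _ eigQ]] := hH.
have /(eigQ _ hlambda)[f fn0 Qf] := heig.
have bQ := bext _ hlambda.
have [_ [[dom _ _ _ _] _ _] _] := bQ; have [iF _] := dom _ _ Qf; have [mf _] := iF.
have [nu /andP[nu0 nup'] anu] := ha.
have [mq _] := hq.
set r := gamma + 3 / 2 in hq *.
have r32 : 3 / 2 < r by rewrite ltrDr.
have rn0 : r != 0 by rewrite gt_eqF// (lt_trans _ r32)// divr_gt0.
(* As [2 r = 2 gamma + 3], this follows from [gamma > 0] when [p <= 3], and is the relation assumed
   between [gamma] and [p] otherwise. *)
have p2r : p <= 2 * r.
  rewrite /r; have [p3|p3] := leP p 3; first by clear -p3 hgamma; lra.
  by have := hgamma_p p3; clear; lra.
have rho0 : 0 < cabs lambda.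
  rewrite lt_neqAle cabs_ge0 andbT eq_sym; apply/eqP => l0; apply: hlambda.
  by rewrite /nonneg_halfline/= (@ComplexField.Normc.eq0_normc R _ l0).
pose alpha := Num.sqrt (cabs lambda) * sin (theta / 2).
have a0 : 0 < alpha.
  case/andP: htheta => t0 tpi; rewrite mulr_gt0 ?sqrtr_gt0// sin_gt0_pi// ?divr_gt0//.
  by rewrite ltr_pdivrMr// mulrC.
have lamE : lambda = (((Num.sqrt (cabs lambda) * cos (theta / 2)) ^+ 2 - alpha ^+ 2) +i*
    (2 * alpha * (Num.sqrt (cabs lambda) * cos (theta / 2))))%C.
  have [<- <-] := half_angle theta (ltW rho0); rewrite [LHS]harg.
  by apply/eqP; rewrite eq_complex /= !mul0r subr0 addr0 !eqxx.
have fix_f := bounded_extension_fixpoint hp a0 lamE mq hp' nu0 anu bQ Qf.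
have p'0 : 0 < p' by exact: lt_trans nup'.
(* The rate [alpha / 2 * p'] is that of the [p']-th power of the exponential factor split off in the
   bootstrap. *)
have [D DP] := integral_expR_dist_Mnorm nu0 (mulr_gt0 (divr_gt0 a0 (ltr0n R 2)) p'0)
  (cmeasurable_factor_a mq) anu.
have qoo := cLnorm_lty rn0 hq.
pose N := fine (\int[vol]_x (cabs (q x) `^ r)%:E).
have NE : (\int[vol]_x (cabs (q x) `^ r)%:E = N%:E)%E.
  rewrite fineK// ge0_fin_numE//.
  by apply: integral_ge0 => x _; rewrite lee_fin powR_ge0.
have pn0 : p != 0 by rewrite gt_eqF// (lt_trans ltr01).
rewrite NE -EFinM lee_fin; apply: le_Cconst => //.
apply: (yukawa_fixpoint_bound hp hp' r32 p2r a0 (measurable_cabs_sqrt mq)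
  (fun x => powR_ge0 _ _) (measurable_cabs mf) (fun x => cabs_ge0 _) _ _
  (cLnorm_integral_gt0 hp iF fn0) (cLnorm_lty pn0 iF) fix_f).
  move=> x; apply: le_trans (DP x); rewrite le_eqVlt; apply/orP; left; apply/eqP.
  by apply: eq_integral => y _; rewrite cabs_factor_a.
rewrite -NE; apply: eq_integral => x _.
by rewrite -powRrM mulrA mulVf// mul1r.
Qed.
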